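(* Let $\langle\cdot,\cdot\rangle$ be a regular generalized discrete Sobolev inner product $$\langle h,g\rangle=\int hg\,d\mu+\sum_{j=1}^m\sum_{i=0}^{N_j}h^{(i)}(c_j)\,\mathcal L_{j,i}(g;c_j)$$ such that $\mu\in \mathrm M_{\mathbb C}(0,1)$ and $c_1,\dots,c_m\in\mathbb C\setminus S_\mu$, where $S_\mu=\operatorname{supp}(\mu)$. Let $\{L_n\}$ be the sequence of monic orthogonal polynomials with respect to $\mu$, let $\{S_n\}$ be the monic orthogonal polynomials with respect to $\langle\cdot,\cdot\rangle$, and let $I_j$ be the dimension of the matrix $\Gamma_j^*$. Then for all sufficiently large $n$ the degree of $S_n$ is $n$; each point $c_j$ attracts exactly $I_j$ zeros of $S_n$, while the rest of the zeros of $S_n$ concentrate on $S_\mu$. Moreover, for each fixed integer $\nu\ge 0$, $$\lim_{n\to\infty}\frac{S_n^{(\nu)}(z)}{L_n^{(\nu)}(z)}=\prod_{j=1}^m\left(\frac{(\varphi(z)-\varphi(c_j))^2}{2\varphi(z)(z-c_j)}\right)^{I_j}$$ uniformly on every compact subset of $\overline{\mathbb C}\setminus S_\mu$.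
   Context: $\overline{\mathbb C}=\mathbb C\cup\{\infty\}$; $\mathbb P_k$ is the space of polynomials with complex coefficients of degree at most $k$. $\varphi(z)=z+\sqrt{z^2-1}$ for $z\in\mathbb C\setminus[-1,1]$, with $\sqrt{z^2-1}$ the holomorphic branch on $\mathbb C\setminus[-1,1]$ that is positive for $z>1$. Values at removable singularities (such as $z=c_j$, $z=\infty$) are taken by continuity. Class $\mathrm M_{\mathbb C}(0,1)$: a complex Borel measure $\rho$ with compact support $S_\rho\subset\mathbb C$ belongs to $\mathrm M_{\mathbb C}(0,1)$ if $S_\rho=[-1,1]\cup E$, where $E$ is an at most denumerable set of isolated points in $\mathbb C\setminus[-1,1]$, and there is $n_0$ such that for all $n\ge n_0$ there are polynomials $q_n$ of degree exactly $n$ with $\int p\,q_n\,d\rho=0$ for all $p\in\mathbb P_{n-1}$ and $\int q_n^2\,d\rho=1$ (no complex conjugation), satisfying: (i) $xq_n(x)=\alpha_{n+1}q_{n+1}(x)+\beta_nq_n(x)+\alpha_nq_{n-1}(x)$ for $n>n_0$ with complex $\alpha_n,\beta_n$; (ii) $\lim_{n\to\infty}\alpha_n=\tfrac12$, $\lim_{n\to\infty}\beta_n=0$; (iii) for each fixed $\nu\in\mathbb Z$ there is a constant $C<\infty$ with $\int|q_n(x)q_{n+\nu}(x)|\,|d\rho(x)|\le C$ for all $n$ with $n,n+\nu\ge n_0$, where $|d\rho|$ is the total variation of $\rho$. Generalized discrete Sobolev inner product: $\mu$ is a complex measure with compact support, $c_1,\dots,c_m$ are distinct complex numbers, $N_j\ge0$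 are integers, and $\mathcal L_{j,i}(g;c_j)$ is the value at $c_j$ of $\mathcal L_{j,i}(g)$, where each $\mathcal L_{j,i}$ is a linear ordinary differential operator with constant complex coefficients and $\mathcal L_{j,N_j}\not\equiv0$ for $j=1,\dots,m$. For each $j$ let $J_j$ be the maximum order of the operators $\mathcal L_{j,i}$, $i=0,\dots,N_j$, write $\mathcal L_{j,i}(g)=\sum_{k=0}^{J_j}\gamma^j_{i,k}g^{(k)}$, and let $\Gamma_j=(\gamma^j_{i,k})_{0\le i\le N_j,\,0\le k\le J_j}$. $\Gamma_j^*$ is the matrix obtained from $\Gamma_j$ by deleting all rows and all columns that are zero vectors. The inner product is called regular if for each $j=1,\dots,m$ the matrix $\Gamma_j^*$ is a square matrix with nonzero determinant; its dimension (number of rows) is denoted $I_j$. Orthogonal polynomials: $S_n$ is the monic polynomial of least degree, not identically zero, such that $\langle p,S_n\rangle=0$ for all $p\in\mathbb P_{n-1}$; $L_n$ is the monic polynomial of least degree, not identically zero, such that $\int p\,L_n\,d\mu=0$ for all $p\in\mathbb P_{n-1}$. ''$c_j$ attracts exactly $I_j$ zeros of $S_n$'' means: each sufficiently small neighborhood of $c_j$ contains, for all sufficiently large $n$, exactly $I_j$ zeros of $S_n$ (counting multiplicity). ''The rest of the zeros concentrate on $S_\mu$'' means: any neighborhood of $S_\mu$ compactly contained in $\mathbb C\setminus\{c_1,\dots,c_m\}$ contains, for all sufficiently large $n$, exactly $n-(I_1+\dots+I_m)$ zeros of $S_n$. *)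

(* Defs.v *)
From HB Require Import structures.
From mathcomp Require Import all_boot all_order all_algebra.
From mathcomp Require Import complex.
From mathcomp Require Import all_classical all_reals all_analysis.

Set Implicit Arguments.
Unset Strict Implicit.
Unset Printing Implicit Defensive.

Import Order.TTheory GRing.Theory Num.Theory.
Import numFieldNormedType.Exports.
Import ComplexField.Normc.

Local Open Scope classical_set_scope.
Local Open Scope ring_scope.
Local Open Scope complex_scope.

(* The complex numbers R[i] over an arbitrary R : realType, with the topology of
   the modulus. *)
HB.instance Definition _ (R : realType) := NormedModule.copy R[i] R[i]^o.

Definition borelC (R : realType) := g_sigma_algebraType (@open R[i]).

(* A charge is finite-valued and countably additive; since the library's notion
   allows values in any numFieldType, complex measures are R[i]-valued charges. *)
Notation complex_measure R := ({charge set (borelC R) -> \bar R[i]})%R.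

Section complex_measure.
Context {R : realType}.
Implicit Types (mu : complex_measure R) (A U : set (borelC R)).

Let Re_norm (z : R[i]) : `|complex.Re z| <= normc z.
Proof.
by case: z => a b; rewrite -sqrtr_sqr ler_wsqrtr// lerDl sqr_ge0.
Qed.

Let Im_norm (z : R[i]) : `|complex.Im z| <= normc z.
Proof.
by case: z => a b; rewrite -sqrtr_sqr ler_wsqrtr// lerDr sqr_ge0.
Qed.

Let part_charge (part : R[i] -> R) mu A : \bar R := (part (fine (mu A)))%:E.

Let part_semi_sigma_additive (part : R[i] -> R) mu :
  {morph part : x y / x + y} -> {morph part : x / - x} ->
  (forall z, `|part z| <= normc z) -> semi_sigma_additive (part_charge part mu).
Proof.
move=> partD partN part_le F mF tF mUF.
have part0 : part 0 = 0 by rewrite -[0 in LHS](subrr 0) partD partN subrr.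
have finF i : mu (F i) \is a fin_num by exact: fin_num_measure.
have finU : mu (\bigcup_n F n) \is a fin_num by exact: fin_num_measure.
have cvgF := @charge_semi_sigma_additive _ _ _ mu F mF tF mUF.
rewrite -(fineK finU) in cvgF.
move/fine_cvg/cvgrPdist_lt : cvgF => h.
apply: cvg_EFin.
  by apply: nearW => n; apply/sum_fin_numP => i _ _.
apply/cvgrPdist_lt => e e0.
have {}/h : 0 < e%:C by rewrite ltcR.
apply: filterS => n /=; rewrite -sum_fine// => hz.
rewrite -sum_fine//=.
rewrite -(big_morph part partD part0) -partN -partD.
by apply: le_lt_trans (part_le _) _; rewrite -ltcR.
Qed.

Definition Re_charge mu A : \bar R := (complex.Re (fine (mu A)))%:E.

Definition Im_charge mu A : \bar R := (complex.Im (fine (mu A)))%:E.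

Let Re_charge_sigma_additive mu : semi_sigma_additive (Re_charge mu).
Proof.
by apply: part_semi_sigma_additive Re_norm; [case=> a b [c d]|case=> a b].
Qed.

Let Im_charge_sigma_additive mu : semi_sigma_additive (Im_charge mu).
Proof.
by apply: part_semi_sigma_additive Im_norm; [case=> a b [c d]|case=> a b].
Qed.

Let Re_charge0 mu : Re_charge mu set0 = 0%E.
Proof. by rewrite /Re_charge charge0. Qed.

Let Im_charge0 mu : Im_charge mu set0 = 0%E.
Proof. by rewrite /Im_charge charge0. Qed.

HB.instance Definition _ mu := isCharge.Build _ (borelC R) R (Re_charge mu)
  (Re_charge0 mu) (fun _ _ => isT) (@Re_charge_sigma_additive mu).

HB.instance Definition _ mu := isCharge.Build _ (borelC R) R (Im_charge mu)
  (Im_charge0 mu) (fun _ _ => isT) (@Im_charge_sigma_additive mu).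

(* The families F need not cover A: adjoining the remainder of A to F can only
   increase the sum, so this is the usual supremum over countable measurable
   partitions when A is measurable. *)
Definition total_variation mu A : \bar R := ereal_sup
  [set (\sum_(0 <= i <oo) (normc (fine (mu (F i))))%:E)%E | F in
    [set F : (set (borelC R))^nat | [/\ forall i, measurable (F i),
      trivIset setT F & \bigcup_i F i `<=` A]]].

(* The Jordan parts do not depend on the chosen Hahn decomposition. *)
Definition charge_integral (nu : {charge set (borelC R) -> \bar R})
    (f : borelC R -> R) : R :=
  let hP := cid (Hahn_decomposition nu) in
  let hPN := svalP (cid (svalP hP)) in
  \int[jordan_pos hPN]_x f x - \int[jordan_neg hPN]_x f x.

Definition cintegral mu (f : R[i] -> R[i]) : R[i] :=
  (charge_integral (Re_charge mu) (fun x => complex.Re (f x))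
     - charge_integral (Im_charge mu) (fun x => complex.Im (f x)))
  +i* (charge_integral (Im_charge mu) (fun x => complex.Re (f x))
     + charge_integral (Re_charge mu) (fun x => complex.Im (f x))).

Definition integral_form mu (h g : {poly R[i]}) : R[i] :=
  cintegral mu (fun x => h.[x] * g.[x]).

Definition supp mu : set R[i] :=
  [set z | forall U : set R[i], open U -> U z -> (0 < total_variation mu U)%E].

End complex_measure.

Section class_M.
Context {R : realType}.

Definition segment11 : set R[i] := [set x%:C | x in `[(-1 : R), 1]%classic].

Definition classM (rho : complex_measure R) : Prop :=
  compact (supp rho) /\
  (exists E : set R[i], [/\ countable E, E `&` segment11 = set0,
     E `<=` isolated E & supp rho = segment11 `|` E]) /\
  exists (n0 : nat) (q : nat -> {poly R[i]}) (alpha beta : nat -> R[i]),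
    [/\ forall n, (n0 <= n)%N ->
          [/\ size (q n) = n.+1,
              forall p : {poly R[i]}, (size p <= n)%N ->
                integral_form rho p (q n) = 0
            & integral_form rho (q n) (q n) = 1],
        forall n, (n0 < n)%N ->
          'X * q n = alpha n.+1 *: q n.+1 + beta n *: q n + alpha n *: q n.-1,
        alpha @ \oo --> (2^-1 : R[i]),
        beta @ \oo --> (0 : R[i])
      & forall nu : int, exists B : R, forall n k : nat,
          (n0 <= n)%N -> (n0 <= k)%N -> k%:Z = n%:Z + nu ->
          (\int[total_variation rho]_x
             (normc ((q n).[x : R[i]] * (q k).[x : R[i]]))%:E <= B%:E)%E].

End class_M.

Section prune.
Context {F : fieldType} {p q : nat} (A : 'M[F]_(p, q)).

Definition nz_rows : {set 'I_p} := [set i | row i A != 0].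
Definition nz_cols : {set 'I_q} := [set k | col k A != 0].

(* enum_val enumerates these sets in increasing order. *)
Definition prune : 'M[F]_(#|nz_rows|, #|nz_cols|) :=
  mxsub enum_val enum_val A.

Definition prune_regular : Prop :=
  exists e : #|nz_cols| = #|nz_rows|, \det (castmx (erefl, e) prune) != 0.

End prune.

Section sobolev.
Context {R : realType} (mu : complex_measure R).
Variables (m : nat) (c : 'I_m -> R[i]) (N : 'I_m -> nat).

(* A linear differential operator with constant coefficients
   \sum_k a_k (d/dx)^k is encoded by the polynomial \sum_k a_k X^k. *)
Definition diffop (D g : {poly R[i]}) : {poly R[i]} :=
  \sum_(k < size D) D`_k *: g^`(k).

Variable L : forall j : 'I_m, 'I_(N j).+1 -> {poly R[i]}.

Definition sobolev_form (h g : {poly R[i]}) : R[i] :=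
  integral_form mu h g +
  \sum_(j < m) \sum_(i < (N j).+1) h^`(i).[c j] * (diffop (L i) g).[c j].

Definition max_order (j : 'I_m) : nat :=
  \max_(i < (N j).+1) (size (L (j := j) i)).-1.

Definition Gamma (j : 'I_m) : 'M[R[i]]_((N j).+1, (max_order j).+1) :=
  \matrix_(i, k) (L (j := j) i)`_k.

Definition regular_form : Prop := forall j, prune_regular (Gamma j).

Definition pruned_dim (j : 'I_m) : nat := #|nz_rows (Gamma j)|.

End sobolev.

Section orthogonality.
Context {R : realType}.

Definition orthogonal_poly (form : {poly R[i]} -> {poly R[i]} -> R[i])
    (n : nat) (P : {poly R[i]}) : Prop :=
  forall p : {poly R[i]}, (size p <= n)%N -> form p P = 0.

Definition monic_orthogonal form n P : Prop :=
  [/\ P \is monic, orthogonal_poly form n P &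
      forall Q, Q != 0 -> orthogonal_poly form n Q -> (size P <= size Q)%N].

Definition nzeros (P : {poly R[i]}) (U : set R[i]) : nat :=
  count (fun z => z \in U) (sval (closed_field_poly_normal P)).

End orthogonality.

Section sphere.
Context {R : realType}.

Definition sphere := one_point_compactification R[i].

(* l is the value of f at z after extending f by continuity; the limit is taken
   over the punctured neighborhoods of z in the sphere, so the default value 0
   used by oapp at the point at infinity is irrelevant. *)
Definition value_at (f : R[i] -> R[i]) (z : sphere) (l : R[i]) : Prop :=
  oapp f 0 w @[w --> z^'] --> l.

Definition cvg_uniformly_on (K : set sphere) (f : nat -> R[i] -> R[i])
    (g : R[i] -> R[i]) : Prop :=
  forall e : R, 0 < e -> \forall n \near \oo, forall z, K z ->
    exists u l, [/\ value_at (f n) z u, value_at g z l & normc (u - l) < e].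

Definition is_sqrt_branch (s : R[i] -> R[i]) : Prop :=
  (forall z, ~ segment11 z -> derivable s z 1 /\ s z ^+ 2 = z ^+ 2 - 1) /\
  (forall x : R, 1 < x -> 0 < s x%:C).

Definition inv_joukowski (s : R[i] -> R[i]) (z : R[i]) : R[i] := z + s z.

End sphere.

(* Main.v *)
Require Import Defs.
From mathcomp Require Import all_boot all_order all_algebra.
From mathcomp Require Import complex.
From mathcomp Require Import all_classical all_reals all_analysis.
From mathcomp Require Import measurable_realfun.
From mathcomp Require Import ring lra zify.

(** The proof compares the Sobolev polynomials with the orthonormal polynomials [q
    n] of the measure.

    Off the support, [q n.+1 / q n] tends to [phi] locally uniformly
    ([ratio_asymptotics]): the three-term recurrence is asymptotically the one with
    constant coefficients 1/2, 0, 1/2, whose solutions are combinations of the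
    powers of [phi] and [1 / phi], and the recessive solution is excluded because
    the Christoffel--Darboux kernel integrates to 1 ([q_no_decay]). Differentiating
    the recurrence gives the analogue for derivatives, the logarithmic derivative of
    [q n] growing like [n / sqrt (z ^ 2 - 1)] ([derivn_ratio]).

    Testing the Sobolev orthogonality of [S] against the kernel expresses [S / q n]
    as a constant plus a combination, with unknown weights, of the remainders of the
    Taylor expansions of [q n.-1 / q n] at the nodes ([sobolev_representation]). At
    a node [c j] the Taylor coefficients of [q n] grow like powers of [n] times [q n
    (c j)]. Together with the regularity of the inner product, this makes all but
    the first [I_j] weights negligible, and makes the first [I_j] Taylor
    coefficients of [S / q n] at [c j] small compared with the weights
    ([point_domination]). Both use that matrices of falling factorials at distinct
    integers are invertible.

    Normalise the weights and pass to the limit along an ultrafilter. The limit of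
    [S / q n] is a combination of remainders of the Taylor expansions of [u = 1 /
    phi] and vanishes to order [I_j] at [c j]. Such a function is determined by its
    value at infinity ([limit_fun_unique]): over the node polynomial, the difference
    of two candidates has the form [X u + Y] with polynomials [X] and [Y] of low
    degree, and the product of [X u + Y] with its conjugate [X phi + Y] is a
    polynomial with more zeros than its degree allows; so it vanishes identically,
    and [X = Y = 0] because [z ^ 2 - 1] is not a square. The explicit product of the
    theorem is a solution. All ultrafilters giving the same limit, the leading
    coefficient of [S] does not vanish for large [n], and [S / L] converges
    pointwise; local boundedness upgrades this to locally uniform convergence
    ([sobolev_asymptotics]).

    The rest is classical complex analysis for quotients of polynomials, derived
    from the maximum principle: Cauchy's estimate passes to the derivatives
    ([derivn_ratio_cvg]), the maximum principle outside of a disc reaches infinity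
    ([exterior_ratio]), and a Hurwitz argument counts the zeros near the nodes
    ([nzeros_disc]), where the limit has zeros of order [I_j] and no others
    elsewhere off the support. *)

Set Implicit Arguments.
Unset Strict Implicit.
Unset Printing Implicit Defensive.

Import Order.TTheory GRing.Theory Num.Theory.
Import numFieldNormedType.Exports.
Import ComplexField.Normc HBNNSimple.

Local Open Scope classical_set_scope.
Local Open Scope ring_scope.
Local Open Scope complex_scope.

(** * The topology of the complex modulus *)

#[global] Instance complex_nbhs_filter (R : realType) (z : R[i]) :
  ProperFilter (nbhs z) := nbhs_pfilter z.

Section ComplexModulus.
Context {R : realType}.
Implicit Types (z w : R[i]) (e r : R).

Lemma normc_norm z : `|z| = (normc z)%:C.
Proof. by case: z. Qed.

Lemma normc_ge0 z : 0 <= normc z.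
Proof. by case: z => a b; exact: sqrtr_ge0. Qed.

Lemma normc_eq0 z : (normc z == 0) = (z == 0).
Proof.
by apply/eqP/eqP => [/eq0_normc//|->]; rewrite normc0.
Qed.

Lemma normc_gt0 z : (0 < normc z) = (z != 0).
Proof. by rewrite lt_def normc_ge0 andbT normc_eq0. Qed.

Lemma normc_opp z : normc (- z) = normc z.
Proof. exact: normcN. Qed.

Lemma normcD z w : normc (z + w) <= normc z + normc w.
Proof. exact: le_normcD. Qed.

Lemma normc_sub z w : normc (z - w) = normc (w - z).
Proof. by rewrite -normc_opp opprB. Qed.

Lemma normcB z w : normc z - normc w <= normc (z - w).
Proof. by rewrite lerBlDr; have := normcD (z - w) w; rewrite subrK. Qed.

Lemma normcX z n : normc (z ^+ n) = normc z ^+ n.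
Proof. by elim: n => [|n IH]; rewrite ?normc1// !exprS normcM IH. Qed.

Lemma normc_real r : normc r%:C = `|r|.
Proof. by rewrite /normc/= expr0n addr0 sqrtr_sqr. Qed.

Lemma normc_nat n : normc (n%:R : R[i]) = n%:R.
Proof.
have -> : (n%:R : R[i]) = (n%:R : R)%:C by rewrite rmorph_nat.
by rewrite normc_real ger0_norm.
Qed.

Lemma normc_sum (I : Type) (s : seq I) (P : pred I) (F : I -> R[i]) :
  normc (\sum_(i <- s | P i) F i) <= \sum_(i <- s | P i) normc (F i).
Proof.
elim/big_rec2: _ => [|i y x _ h]; first by rewrite normc0.
by apply: le_trans (normcD _ _) _; rewrite lerD2l.
Qed.

Lemma ltc_real z e : (`|z| < e%:C) = (normc z < e).
Proof. by rewrite normc_norm ltcR. Qed.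

Lemma posc_real z : 0 < z -> exists2 e : R, 0 < e & z = e%:C.
Proof.
case: z => a b; rewrite ltcE /= => /andP[/eqP-> a0]; by exists a.
Qed.

Lemma cvg_normcP (T : Type) (F : set_system T) {FF : Filter F} (f : T -> R[i])
    (l : R[i]) :
  f @ F --> l <-> forall e : R, 0 < e -> \forall t \near F, normc (f t - l) < e.
Proof.
split=> [/cvgrPdist_lt h e e0|h].
  have /h : 0 < e%:C by rewrite ltcR.
  by apply: filterS => t; rewrite ltc_real normc_sub.
apply/cvgrPdist_lt => z /posc_real[e e0 ->].
by apply: filterS (h e e0) => t; rewrite ltc_real normc_sub.
Qed.

Lemma nbhs_normcP z (A : set R[i]) :
  nbhs z A <-> exists2 e : R, 0 < e & forall w, normc (w - z) < e -> A w.
Proof.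
split=> [/nbhs_ballP[x /= /posc_real[e e0 ->] h]|[e e0 h]].
  exists e => // w zw; apply: h; rewrite /ball/= ltc_real normc_sub//.
apply/nbhs_ballP; exists e%:C => /=; first by rewrite ltcR.
by move=> w; rewrite /ball/= ltc_real normc_sub => /h.
Qed.

Lemma nbhs_normc_ball z e : 0 < e -> \forall w \near z, normc (w - z) < e.
Proof. by move=> e0; apply/nbhs_normcP; exists e. Qed.

Lemma normc_continuous : continuous (@normc R).
Proof.
move=> z; apply/cvgrPdist_lt => e e0.
near=> w.
have : normc (w - z) < e by near: w; exact: nbhs_normc_ball.
apply: le_lt_trans; rewrite ler_norml; apply/andP; split.
  by have := normcB w z; lra.
by have := normcB z w; rewrite normc_sub; lra.
Unshelve. all: by end_near. Qed.

Lemma Re_normc z : `|complex.Re z| <= normc z.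
Proof. by case: z => a b; rewrite -sqrtr_sqr ler_wsqrtr// lerDl sqr_ge0. Qed.

Lemma Im_normc z : `|complex.Im z| <= normc z.
Proof. by case: z => a b; rewrite -sqrtr_sqr ler_wsqrtr// lerDr sqr_ge0. Qed.

Lemma normc_ReIm z : normc z <= `|complex.Re z| + `|complex.Im z|.
Proof.
case: z => a b; have {1}-> : a +i* b = a%:C + (0 +i* b) :> R[i].
  by apply/eqP; rewrite eq_complex /= addr0 add0r !eqxx.
apply: le_trans (normcD _ _) _; rewrite normc_real lerD2l.
by rewrite /= expr0n add0r sqrtr_sqr.
Qed.

Lemma Re_continuous : continuous (@complex.Re R).
Proof.
move=> z; apply/cvgrPdist_lt => e e0; near=> w.
rewrite -raddfB/=; apply: le_lt_trans (Re_normc _) _; rewrite normc_sub.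
by near: w; exact: nbhs_normc_ball.
Unshelve. all: by end_near. Qed.

Lemma Im_continuous : continuous (@complex.Im R).
Proof.
move=> z; apply/cvgrPdist_lt => e e0; near=> w.
rewrite -raddfB/=; apply: le_lt_trans (Im_normc _) _; rewrite normc_sub.
by near: w; exact: nbhs_normc_ball.
Unshelve. all: by end_near. Qed.

Lemma complex_continuous : continuous (fun x : R * R => x.1 +i* x.2 : R[i]).
Proof.
case=> a b; apply/cvg_normcP => e e0.
have e20 : 0 < e / 2 by lra.
exists (ball a (e / 2), ball b (e / 2)) => /=.
  by split; exact: nbhsx_ballx.
move=> [x y] [/= ax yb] /=; apply: le_lt_trans (normc_ReIm ((x - a) +i* (y - b))) _ => /=.
move: ax yb; rewrite /ball/= (distrC a) (distrC b); lra.
Qed.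

Lemma horner_continuous (p : {poly R[i]}) : continuous (horner p).
Proof.
elim/poly_ind: p => [|p a IH].
  have -> : horner (0 : {poly R[i]}) = fun=> 0.
    by apply/funext => z; rewrite horner0.
  by move=> z; exact: cvg_cst.
have -> : horner (p * 'X + a%:P) = fun z => p.[z] * z + a.
  by apply/funext => z; rewrite hornerMXaddC.
by move=> z; apply: cvgD; [apply: cvgM => //; exact: IH|exact: cvg_cst].
Qed.

Lemma normcB_continuous z : continuous (fun w => normc (w - z)).
Proof.
move=> w; apply: (@continuous_comp R[i] R[i] R (fun w => w - z) (@normc R)).
  by apply: cvgB; [exact: cvg_id|exact: cvg_cst].
exact: normc_continuous.
Qed.

Lemma closed_disc_closed z r : closed [set w | normc (w - z) <= r].
Proof.
apply: (@closed_comp _ _ (fun w => normc (w - z)) [set x | x <= r]).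
  by move=> w _; exact: normcB_continuous.
exact: closed_le.
Qed.

Lemma compact_normc (A : set R[i]) r :
  closed A -> (forall z, A z -> normc z <= r) -> compact A.
Proof.
move=> cA Ar.
have cB : compact ((fun x : R * R => x.1 +i* x.2 : R[i]) @`
    (`[(- r), r]%classic `*` `[(- r), r]%classic)).
  apply: continuous_compact.
    by apply: continuous_subspaceT; exact: complex_continuous.
  by apply: compact_setX; exact: segment_compact.
apply: (subclosed_compact cA cB) => -[a b] /Ar zr.
exists (a, b) => //=; split; rewrite /= in_itv /= -ler_norml.
  exact: le_trans (Re_normc (a +i* b)) zr.
exact: le_trans (Im_normc (a +i* b)) zr.
Qed.

Lemma closed_disc_compact z r : compact [set w | normc (w - z) <= r].
Proof.
apply: (@compact_normc _ (normc z + r)); first exact: closed_disc_closed.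
by move=> w /= wr; have := normcB w z; lra.
Qed.

End ComplexModulus.

(** * The maximum principle for rational functions *)

Section MaximumPrinciple.
Context {R : realType}.
Implicit Types (P Q : {poly R[i]}) (z c : R[i]) (r M e : R).

Definition quot P Q z : R[i] := P.[z] / Q.[z].

Lemma quot_continuous P Q z : Q.[z] != 0 -> {for z, continuous (quot P Q)}.
Proof.
move=> Qz; apply: cvgM; first exact: horner_continuous.
by apply: cvgV => //; exact: horner_continuous.
Qed.

(** If the quotient is not constant, it behaves near [z] like
    [a + b * (y - z) ^ k] with [b] and [k] nonzero, and its modulus increases in a
    direction in which [b * (y - z) ^ k] is a positive multiple of [a]. *)
Lemma rational_local_max P Q z : Q.[z] != 0 ->
  (\forall w \near z, normc (quot P Q w) <= normc (quot P Q z)) ->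
  P = quot P Q z *: Q.
Proof.
move=> Qz zmax; set a := quot P Q z.
apply/eqP; rewrite -subr_eq0; apply/negPn/negP => D0.
have [k [H]] := multiplicity_XsubC (P - a *: Q) z.
rewrite D0 /= => Hz DE.
have k0 : (0 < k)%N.
  case: k DE => // DE; move: Hz; rewrite /root.
  have := congr1 (horner^~ z) DE; rewrite expr0 mulr1 => <-.
  by rewrite hornerD hornerN hornerZ /a /quot divfK// subrr eqxx.
have Hz0 : H.[z] != 0 by [].
set b := quot H Q z.
have b0 : b != 0 by rewrite /b /quot mulf_neq0// invr_eq0.
(* With [w = a] or 1, the direction [v] satisfies [b * v ^+ k = w], so that
   moving along it adds a positive multiple of [w] to the value [a]. *)
pose w : R[i] := if a == 0 then 1 else a.
have w0 : w != 0 by rewrite /w; case: ifPn => // _; exact: oner_neq0.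
pose v := k.-root (w / b).
have vk : v ^+ k * b = w by rewrite /v rootCK// divfK.
have v0 : v != 0.
  by apply: contra_neq w0 => v0; rewrite -vk v0 expr0n -[k]prednK//= mul0r.
have nw : 0 < normc w / 2 by rewrite divr_gt0// normc_gt0.
have nvk : 0 < normc (v ^+ k) by rewrite normc_gt0 expf_neq0.
have /nbhs_normcP[e e0 he] : \forall y \near z,
    [/\ normc (quot P Q y) <= normc a, Q.[y] != 0 &
        normc (quot H Q y - b) < normc w / 2 / normc (v ^+ k)].
  near=> y; split; first by near: y.
    rewrite -normc_gt0; near: y.
    have /cvgrPdist_lt/(_ (normc Q.[z])) : (fun y => normc Q.[y]) @ z --> normc Q.[z].
      apply: (@continuous_comp R[i] R[i] R (horner Q) (@normc R)).
        exact: horner_continuous.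
      exact: normc_continuous.
    rewrite normc_gt0 => /(_ Qz); apply: filterS => y.
    by rewrite real_ltr_norml ?num_real// => /andP[_]; lra.
  near: y; have := quot_continuous (P := H) Qz.
  by move/cvg_normcP; apply; rewrite divr_gt0.
pose t : R := e / (2 * normc v).
have nv : 0 < normc v by rewrite normc_gt0.
have t0 : 0 < t by rewrite divr_gt0// mulr_gt0.
have [] := he (z + t%:C * v).
  rewrite addrAC subrr add0r normcM normc_real gtr0_norm//.
  have -> : t * normc v = e / 2 by rewrite /t; field; rewrite gt_eqF.
  by lra.
set y := z + _ => h1 Qy h2.
have fy : quot P Q y = a + t%:C ^+ k * (w + v ^+ k * (quot H Q y - b)).
  have PE : P.[y] = a * Q.[y] + H.[y] * (t%:C * v) ^+ k.
    have := congr1 (horner^~ y) DE; rewrite hornerD hornerN hornerZ hornerM.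
    rewrite horner_exp hornerXsubC => /(canRL (subrK _)) ->.
    by rewrite addrC {2}/y addrAC subrr add0r.
  rewrite mulrBr vk [w + _]addrC subrK /quot PE exprMn.
  by field.
have tk : 0 < t ^+ k by rewrite exprn_gt0.
have h3 : normc (t%:C ^+ k * (v ^+ k * (quot H Q y - b))) < t ^+ k * (normc w / 2).
  rewrite normcM normcX normc_real gtr0_norm// ltr_pM2l// normcM mulrC.
  by rewrite -ltr_pdivlMr.
have h4 : normc a + t ^+ k * normc w <= normc (a + t%:C ^+ k * w).
  rewrite /w; case: ifPn => [/eqP ->|_].
    by rewrite normc0 !add0r normcM normcX normc_real gtr0_norm.
  have -> : a + t%:C ^+ k * a = (1 + t ^+ k)%:C * a.
    by rewrite rmorphD rmorphXn /= mulrDl mul1r.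
  rewrite (normcM (1 + t ^+ k)%:C a) normc_real; by rewrite gtr0_norm ?addr_gt0// mulrDl mul1r.
have : normc (a + t%:C ^+ k * w) <= normc (quot P Q y) +
    normc (t%:C ^+ k * (v ^+ k * (quot H Q y - b))).
  rewrite -[X in _ <= _ + X]normc_opp.
  apply: le_trans (normcD _ _); rewrite fy mulrDr addrA addrK//.
have : 0 < t ^+ k * (normc w / 2) by rewrite mulr_gt0.
by lra.
Unshelve. all: by end_near. Qed.

(** The interior maximum is excluded by [rational_local_max], so the maximum
    over the compact set [X], which exists, sits outside its interior. *)
Lemma rational_max_principle P Q (X : set R[i]) z0 M : compact X ->
  X z0 -> ~ interior X z0 ->
  (forall z, X z -> Q.[z] != 0) ->
  (forall z, X z -> ~ interior X z -> normc (quot P Q z) <= M) ->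
  forall z, X z -> normc (quot P Q z) <= M.
Proof.
move=> cX Xz0 iz0 QX bX z Xz.
have [||z1 /[!inE] Xz1 zmax] :=
    @compact_EVT_max R[i] R (fun z => normc (quot P Q z)) X _ cX; first by exists z0.
  apply: continuous_in_subspaceT => w /[!inE] Xw.
  apply: (@continuous_comp R[i] R[i] R (quot P Q) (@normc R)).
    exact: quot_continuous (QX _ Xw).
  exact: normc_continuous.
have [iz1|] := pselect (interior X z1); last first.
  by move=> /(bX _ Xz1); apply: le_trans; apply: zmax; rewrite inE.
have PE : P = quot P Q z1 *: Q.
  apply: rational_local_max; first exact: QX.
  by apply: filterS iz1 => w Xw; apply: zmax; rewrite inE.
have := bX _ Xz0 iz0.
by rewrite PE /quot !hornerZ !mulfK ?QX.
Qed.

Lemma rational_max_disc P Q c r M : 0 < r ->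
  (forall z, normc (z - c) <= r -> Q.[z] != 0) ->
  (forall z, normc (z - c) = r -> normc (quot P Q z) <= M) ->
  forall z, normc (z - c) <= r -> normc (quot P Q z) <= M.
Proof.
move=> r0 QX bX z zr.
have intX w : normc (w - c) < r -> interior [set w | normc (w - c) <= r] w.
  move=> wr; apply/nbhs_normcP; exists (r - normc (w - c)); first by lra.
  move=> y yw /=; have -> : y - c = (y - w) + (w - c) by rewrite addrA subrK.
  by apply: le_trans (normcD _ _) _; lra.
have nintX w : normc (w - c) = r -> ~ interior [set w | normc (w - c) <= r] w.
  move=> wr /nbhs_normcP[e e0 /(_ (w + (e / (2 * r))%:C * (w - c)))].
  rewrite addrAC subrr add0r normcM normc_real gtr0_norm ?divr_gt0 ?mulr_gt0//.
  rewrite wr invfM mulrA divfK ?gt_eqF// => /(_ ltac:(lra)) /=.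
  have -> : w + (e / 2 / r)%:C * (w - c) - c = (1 + e / 2 / r)%:C * (w - c).
    by rewrite rmorphD mulrDl mul1r addrAC.
  rewrite normcM wr normc_real gtr0_norm; last by rewrite addr_gt0// !divr_gt0.
  by rewrite mulrDl divfK ?gt_eqF// mul1r; lra.
apply: (@rational_max_principle P Q [set w | normc (w - c) <= r] (c + r%:C)) => //.
- exact: closed_disc_compact.
- by rewrite /= addrAC subrr add0r normc_real gtr0_norm.
- by apply: nintX; rewrite addrAC subrr add0r normc_real gtr0_norm.
- move=> w /= wr; rewrite le_eqVlt in wr; case/orP: wr => [/eqP/bX//|/intX//].
Qed.

Lemma poly_growth P n : (size P <= n)%N ->
  exists2 C : R, 0 < C & forall z, 1 <= normc z ->
    normc z * normc P.[z] <= C * normc z ^+ n.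
Proof.
move=> Pn; exists (1 + \sum_(i < n) normc P`_i).
  by rewrite ltr_wpDr// sumr_ge0// => i _; exact: normc_ge0.
move=> z z1; rewrite (horner_coef_wide _ Pn).
have h : normc z * normc (\sum_(i < n) P`_i * z ^+ i) <=
    (\sum_(i < n) normc P`_i) * normc z ^+ n.
  rewrite mulr_suml; apply: le_trans (ler_wpM2l (normc_ge0 _) (normc_sum _ _ _)) _.
  rewrite mulr_sumr; apply: ler_sum => i _.
  rewrite normcM normcX mulrCA -exprS ler_wpM2l ?normc_ge0//.
  exact: ler_weXn2l.
apply: le_trans h _; rewrite mulrDl mul1r lerDr exprn_ge0//; lra.
Qed.

Lemma poly_lower_growth Q : Q != 0 ->
  exists2 C : R, 0 < C & exists2 T : R, 1 <= T & forall z, T <= normc z ->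
    C * normc z ^+ (size Q).-1 <= normc Q.[z].
Proof.
move=> Q0; set n := (size Q).-1.
have sQ : size Q = n.+1 by rewrite /n prednK// lt0n size_poly_eq0.
pose Q1 := Q - (lead_coef Q)%:P * 'X^n.
have sQ1 : (size Q1 <= n)%N.
  apply/leq_sizeP => j nj; rewrite coefB coefCM coefXn.
  have [->|jn] := eqVneq j n; first by rewrite mulr1 lead_coefE -/n subrr.
  by rewrite mulr0 subr0 nth_default// sQ ltn_neqAle eq_sym jn.
have [C C0 hC] := poly_growth sQ1.
have l0 : 0 < normc (lead_coef Q) by rewrite normc_gt0 lead_coef_eq0.
set l := normc _ in l0.
exists (l / 2); first by rewrite divr_gt0.
exists (1 + 2 * C / l) => [|z zT]; first by rewrite lerDl divr_ge0 ?mulr_ge0// ltW.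
have hl : 0 <= 2 * C / l by rewrite divr_ge0 ?mulr_ge0// ltW.
have z1 : 1 <= normc z by lra.
have := hC _ z1; rewrite /Q1 hornerD hornerN hornerCM hornerXn => h.
have h2 : l * normc z ^+ n <= normc Q.[z] +
     normc (Q.[z] - lead_coef Q * z ^+ n).
  rewrite normc_sub /l -normcX -normcM.
  by apply: le_trans _ (normcD _ _); rewrite addrC subrK.
have zn : 0 < normc z ^+ n by rewrite exprn_gt0//; lra.
rewrite -(ler_pM2l (_ : 0 < normc z)); last by lra.
have : 2 * C <= l * normc z.
  by rewrite [l * _]mulrC -ler_pdivrMr//; lra.
move=> /(ler_wpM2r (ltW zn)) h3.
have /ltW z0 : 0 < normc z by lra.
have := ler_wpM2l z0 h2.
by lra.
Qed.

Lemma quot_infty P Q : (size P < size Q)%N -> forall e, 0 < e ->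
  exists2 T : R, 1 <= T & forall z, T <= normc z ->
    Q.[z] != 0 /\ normc (quot P Q z) <= e.
Proof.
move=> PQ e e0.
have Q0 : Q != 0 by rewrite -size_poly_gt0; exact: leq_ltn_trans PQ.
have PQ' : (size P <= (size Q).-1)%N by rewrite -ltnS prednK ?size_poly_gt0.
have [C C0 hC] := poly_growth PQ'.
have [D D0 [T T1 hD]] := poly_lower_growth Q0.
exists (T + C / (e * D)) => [|z zT].
  by rewrite ler_wpDr// divr_ge0 ?mulr_ge0// ltW.
have h : 0 <= C / (e * D) by rewrite divr_ge0 ?mulr_ge0// ltW.
have zn : 0 < normc z ^+ (size Q).-1 by rewrite exprn_gt0//; lra.
have hQ : D * normc z ^+ (size Q).-1 <= normc Q.[z] by apply: hD; lra.
have Qz : 0 < normc Q.[z] by apply: lt_le_trans hQ; rewrite mulr_gt0.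
split; first by rewrite -normc_gt0.
rewrite /quot normcM normcV ler_pdivrMr// -(ler_pM2l (_ : 0 < normc z)); last by lra.
apply: le_trans (hC _ _) _; first by lra.
have hz : C <= e * D * normc z.
  by rewrite [leRHS]mulrC -ler_pdivrMr ?mulr_gt0//; lra.
have z0 : 0 < normc z by lra.
apply: le_trans (_ : e * D * normc z * normc z ^+ (size Q).-1 <= _).
  by rewrite ler_wpM2r// ltW.
have ze : 0 <= normc z * e by rewrite mulr_ge0// ltW.
by have := ler_wpM2l ze hQ; lra.
Qed.

(** The maximum principle for an annulus whose outer circle is so large that the
    quotient is small there. *)
Lemma rational_max_exterior P Q r M : 0 < r -> (size P < size Q)%N ->
  (forall z, r <= normc z -> Q.[z] != 0) ->
  (forall z, normc z = r -> normc (quot P Q z) <= M) ->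
  forall z, r <= normc z -> normc (quot P Q z) <= M.
Proof.
move=> r0 PQ QX bX z zr.
apply/ler_addgt0Pr => e e0.
have [T0 T01 hT0] := quot_infty PQ e0.
pose T := T0 + r + normc z.
have rT : r < T by rewrite /T; have := normc_ge0 z; lra.
pose X := [set w : R[i] | r <= normc w] `&` [set w | normc (w - 0) <= T].
have nrr : normc (r%:C : R[i]) = r by rewrite normc_real gtr0_norm.
have M0 : 0 <= M by apply: le_trans (bX _ nrr); exact: normc_ge0.
have bndX w : X w -> ~ interior X w -> normc w = r \/ normc w = T.
  move=> [/= w1]; rewrite subr0 => w2 iw.
  have [|rw] := eqVneq (normc w) r; first by left.
  have [|Tw] := eqVneq (normc w) T; first by right.
  have {rw}w1 : r < normc w by rewrite lt_neqAle eq_sym rw.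
  have {Tw}w2 : normc w < T by rewrite lt_neqAle Tw.
  exfalso; apply: iw; apply/nbhs_normcP.
  exists (Num.min (normc w - r) (T - normc w)); first by rewrite lt_min !subr_gt0 w1 w2.
  move=> y; rewrite lt_min => /andP[y1 y2]; split => /=.
    by have := normcB w y; rewrite normc_sub; lra.
  by rewrite subr0; have := normcB y w; lra.
apply: (@rational_max_principle P Q X (r%:C)) => //.
- apply: (@compact_normc _ _ T); last by move=> w [_ /=]; rewrite subr0.
  apply: closedI; last exact: closed_disc_closed.
  apply: (@closed_comp _ _ (@normc R) [set x | r <= x]); last exact: closed_ge.
  by move=> w _; exact: normc_continuous.
- split; first by change (r <= normc (r%:C : R[i])); rewrite nrr.
  by change (normc (r%:C - 0 : R[i]) <= T); rewrite subr0 nrr ltW.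
- move=> /nbhs_normcP[d d0 /(_ (r - Num.min (d / 2) r)%:C)].
  have m0 : 0 < Num.min (d / 2) r by rewrite lt_min r0 divr_gt0.
  have m1 : Num.min (d / 2) r <= d / 2 by rewrite ge_min lexx.
  have m2 : Num.min (d / 2) r <= r by rewrite ge_min lexx orbT.
  rewrite -rmorphB normc_real addrAC subrr add0r normrN gtr0_norm//.
  move=> /(_ ltac:(lra))[+ _].
  by rewrite /mkset normc_real ger0_norm; lra.
- by move=> w [/= w1 _]; exact: QX.
- move=> w Xw /(bndX _ Xw)[wr|wT]; first by apply: le_trans (bX _ wr) _; lra.
  have [|_ h] := hT0 w; last by apply: le_trans h _; lra.
  by rewrite wT /T; have := normc_ge0 z; lra.
- split; first by [].
  by change (normc (z - 0 : R[i]) <= T); rewrite subr0 /T; lra.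
Qed.

(** The numerator, over [Q], of the difference quotient of [P / Q] at [c]. *)
Definition rshift c Q P : {poly R[i]} :=
  (P - quot P Q c *: Q) %/ ('X - c%:P).

Lemma rshiftE c Q P : Q.[c] != 0 ->
  P = quot P Q c *: Q + rshift c Q P * ('X - c%:P).
Proof.
move=> Qc; rewrite /rshift divpK ?subrKC//.
rewrite dvdp_XsubCl /root hornerD hornerN hornerZ /quot divfK// subrr//.
Qed.

Lemma quot_rshift c Q P z : Q.[c] != 0 -> Q.[z] != 0 ->
  quot P Q z = quot P Q c + quot (rshift c Q P) Q z * (z - c).
Proof.
move=> Qc Qz; have {1}-> := rshiftE P Qc.
rewrite /quot hornerD hornerZ hornerM hornerXsubC mulrDl mulfK//.
by rewrite mulrAC.
Qed.

(** Schwarz lemma: on the boundary circle the difference quotient is bounded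
    trivially, and it has no pole at the centre. *)
Lemma rshift_bound c Q P r M : 0 < r ->
  (forall z, normc (z - c) <= r -> Q.[z] != 0) ->
  (forall z, normc (z - c) <= r -> normc (quot P Q z) <= M) ->
  forall z, normc (z - c) <= r -> normc (quot (rshift c Q P) Q z) <= 2 * M / r.
Proof.
move=> r0 QX bX; apply: rational_max_disc => // z zr.
have cr : normc (c - c) <= r by rewrite subrr normc0 ltW.
have zr' : normc (z - c) <= r by rewrite zr.
rewrite ler_pdivlMr// -zr -normcM.
have -> : quot (rshift c Q P) Q z * (z - c) = quot P Q z - quot P Q c.
  by rewrite (quot_rshift P (QX _ cr) (QX _ zr')) addrAC subrr add0r.
apply: le_trans (normcD _ _) _; rewrite normc_opp.
by have := bX _ cr; have := bX _ zr'; lra.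
Qed.

(** At the centre the difference quotient is the derivative. *)
Lemma quot_rshift_deriv c Q P : Q.[c] != 0 ->
  quot (rshift c Q P) Q c = (P^`().[c] * Q.[c] - P.[c] * Q^`().[c]) / Q.[c] ^+ 2.
Proof.
move=> Qc; have PE := rshiftE P Qc.
have -> : P^`().[c] = quot P Q c * Q^`().[c] + (rshift c Q P).[c].
  have /= -> := congr1 (fun p : {poly R[i]} => p^`().[c]) PE.
  rewrite derivD derivZ derivM derivXsubC hornerD hornerZ hornerD !hornerM.
  by rewrite hornerXsubC subrr mulr0 add0r hornerC mulr1.
by rewrite /quot; field.
Qed.

End MaximumPrinciple.

(** * Integrals against a complex measure *)

Section ComplexMeasure.
Context {R : realType}.
Implicit Types (mu : complex_measure R) (U A : set (borelC R)) (p : {poly R[i]}).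

Lemma open_measurableC (U : set R[i]) : open U -> measurable (U : set (borelC R)).
Proof. by move=> oU; apply: sub_sigma_algebra. Qed.

Lemma continuous_measurableC (f : R[i] -> R) : continuous f ->
  measurable_fun [set: borelC R] (f : borelC R -> R).
Proof.
move=> /continuousP cf; apply: (measurability _ (RGenOpens.measurableE R)).
move=> _ [_ [a [b ->] <-]]; rewrite setTI.
by apply: open_measurableC; apply: cf; exact: interval_open.
Qed.

Definition jpos (nu : {charge set (borelC R) -> \bar R}) :
    {finite_measure set (borelC R) -> \bar R} :=
  let hP := cid (Hahn_decomposition nu) in jordan_pos (svalP (cid (svalP hP))).

Definition jneg (nu : {charge set (borelC R) -> \bar R}) :
    {finite_measure set (borelC R) -> \bar R} :=
  let hP := cid (Hahn_decomposition nu) in jordan_neg (svalP (cid (svalP hP))).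

(** The finite measures which combine to [mu]: the Jordan parts 0 and 1 of its real
    part, 2 and 3 of its imaginary part.  A single index keeps the estimates uniform. *)
Definition jordan_part (mu : complex_measure R) (k : 'I_4) :
    {finite_measure set (borelC R) -> \bar R} :=
  if k == 0 then jpos (Re_charge mu) else if k == 1 then jneg (Re_charge mu)
  else if k == 2 then jpos (Im_charge mu) else jneg (Im_charge mu).

Lemma ge_total_variation mu A B : measurable A -> B `<=` A -> measurable B ->
  ((normc (fine (mu B)))%:E <= Defs.total_variation mu A)%E.
Proof.
move=> mA BA mB; apply: ereal_sup_ubound.
exists (fun i => if i == 0%N then B else set0).
  split.
  - by move=> i; case: ifP.
  - move=> i j _ _; case: eqP => [->|_]; case: eqP => [->|_] //.
    + by rewrite setI0 => -[].
    + by rewrite set0I => -[].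
    + by rewrite set0I => -[].
  - by move=> x [i _]; case: ifP => // _ /BA.
rewrite (@nneseries_split _ _ 0 1); last first.
  by move=> k _; rewrite lee_fin; case: k => [|k]; exact: normc_ge0.
rewrite big_nat1 eseries0 ?adde0// => i i1 _.
by rewrite gtn_eqF// charge0 -[fine _]/(0 : R[i]) normc0.
Qed.

(** A Jordan part of [A] is, up to sign, the charge of the trace of [A] on a Hahn
    set, and that trace alone is an admissible family in the supremum. *)
Lemma jordan_part_le mu k A : measurable A ->
  (jordan_part mu k A <= Defs.total_variation mu A)%E.
Proof.
move=> mA.
have hpos (nu : {charge set (borelC R) -> \bar R}) :
    (forall B, measurable B -> (`|nu B| <= (normc (fine (mu B)))%:E)%E) ->
    (jpos nu A <= Defs.total_variation mu A)%E /\ (jneg nu A <= Defs.total_variation mu A)%E.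
  move=> hnu.
  set h := svalP (cid (svalP (cid (Hahn_decomposition nu)))).
  have [[mP _] [mN _] _ _] := h.
  have hp : jpos nu A = jordan_pos h A by [].
  have hn : jneg nu A = jordan_neg h A by [].
  split.
    rewrite -/(jpos nu) hp jordan_posE cjordan_posE /crestr0 mem_set// /crestr.
    apply: le_trans (lee_abs _) _.
    apply: le_trans (hnu _ (measurableI _ _ mA mP)) _.
    by apply: ge_total_variation => //; exact: measurableI.
  rewrite -/(jneg nu) hn jordan_negE cjordan_negE /crestr0 mem_set// /crestr.
  apply: le_trans (lee_abs _) _; rewrite abseN.
  apply: le_trans (hnu _ (measurableI _ _ mA mN)) _.
  by apply: ge_total_variation => //; exact: measurableI.
have hRe := hpos (Re_charge mu); have hIm := hpos (Im_charge mu).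
have {}hRe := hRe (fun B _ => Re_normc (fine (mu B))).
have {}hIm := hIm (fun B _ => Im_normc (fine (mu B))).
by rewrite /jordan_part; case: ifP => _; [|case: ifP => _; [|case: ifP => _]];
  case: hRe => //; case: hIm.
Qed.

Lemma supp_open_compl mu : open (~` supp mu).
Proof.
rewrite openE => z /existsNP[U /not_implyP[oU /not_implyP[Uz hU]]].
have Uz' : nbhs z U by exact: open_nbhs_nbhs.
by apply: filterS Uz' => w Uw sw; apply: hU; exact: sw.
Qed.

(** The complement of the support is a union of countably many discs with
    rational centres that the total variation does not charge. *)
Lemma jordan_part_supp mu k : jordan_part mu k (~` supp mu) = 0%E.
Proof.
set nu := jordan_part mu k.
apply: measure_negligible; first by apply: open_measurableC; exact: supp_open_compl.
pose disc (x : rat * rat * nat) : set (borelC R) :=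
  [set w | normc (w - (ratr x.1.1 +i* ratr x.1.2)) < x.2.+1%:R^-1].
pose F (n : nat) : set (borelC R) := match unpickle n with
  | Some x => if `[< nu (disc x) = 0%E >] then disc x else set0
  | None => set0 end.
have odisc x : open (disc x : set R[i]).
  apply: (@open_comp _ _ (fun w : R[i] => normc (w - (ratr x.1.1 +i* ratr x.1.2)))
    [set r | r < x.2.+1%:R^-1]); last exact: open_lt.
  by move=> w _; exact: normcB_continuous.
suff hF : @subset (borelC R) (~` supp mu) (\bigcup_n F n).
  apply: (negligibleS hF).
  apply: negligible_bigcup => n; rewrite /F; case: unpickle => [x|]; last exact: negligible_set0.
  case: ifPn => [/asboolP nx|_]; last exact: negligible_set0.
  by apply/negligibleP => //; apply: open_measurableC; exact: odisc.
move=> z /existsNP[U /not_implyP[oU /not_implyP[Uz /negP]]].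
rewrite -leNgt => TVU.
have nuU : nu U = 0%E.
  apply/eqP; rewrite eq_le measure_ge0 andbT.
  by apply: le_trans (jordan_part_le _ _ _) TVU; exact: open_measurableC.
have /nbhs_normcP[e e0 hU] : nbhs z U by exact: open_nbhs_nbhs.
have [n nE] : exists n, 2 * n.+1%:R^-1 < e :> R.
  have e2 : 0 < e / 2 by rewrite divr_gt0.
  by have [n hn] := ltr_add_invr e2; exists n; rewrite mulrC -ltr_pdivlMr//; rewrite add0r in hn.
pose d : R := n.+1%:R^-1.
have d0 : 0 < d by rewrite invr_gt0.
have hd (x : R) : x - d / 2 < x by lra.
have [a az] := rat_in_itvoo (hd (complex.Re z)).
have [b bz] := rat_in_itvoo (hd (complex.Im z)).
have zd : normc (z - (ratr a +i* ratr b)) < d.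
  apply: le_lt_trans (normc_ReIm _) _; rewrite !raddfB/=.
  move: az bz; rewrite !in_itv /= => /andP[a1 a2] /andP[b1 b2].
  by rewrite !ger0_norm; lra.
have FE x : F (pickle x) = if `[< nu (disc x) = 0%E >] then disc x else set0.
  by rewrite /F pickleK.
clearbody F; exists (pickle (a, b, n)); [exact: Logic.I|rewrite FE].
case: ifPn => [_|/asboolPn[]]; first exact: zd.
apply/eqP; rewrite eq_le measure_ge0 andbT -nuU le_measure ?inE//.
- by apply: open_measurableC; exact: odisc.
- exact: open_measurableC.
- move=> w wd; apply: hU.
  have -> : w - z = (w - (ratr a +i* ratr b)) - (z - (ratr a +i* ratr b)).
    by rewrite opprB addrA subrK.
  apply: le_lt_trans (normcD _ _) _; rewrite normc_opp.
  by move: wd; rewrite /disc /= -/d => wd; move: nE; rewrite -/d; lra.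
Qed.

Lemma continuous_integrableC mu k (f : R[i] -> R) : compact (supp mu) ->
  continuous f -> (jordan_part mu k).-integrable [set: borelC R] (EFin \o f).
Proof.
move=> cS cf; set nu := jordan_part mu k.
have mS : measurable (~` supp mu : set (borelC R)).
  by apply: open_measurableC; exact: supp_open_compl.
have mf : measurable_fun [set: borelC R] (f : borelC R -> R).
  exact: continuous_measurableC.
apply/(negligible_integrable mS) => //.
- exact/measurable_EFinP.
- exact: jordan_part_supp.
apply: measurable_bounded_integrable.
- by apply: measurableD.
- by rewrite ltey_eq fin_num_measure//; exact: measurableD.
- exact: measurable_funS mf.
have := @compact_bounded R R^o (f @` supp mu).
move=> /(_ _)[|M [Mr hM]].
  by apply: continuous_compact => //; exact: continuous_subspaceT.
exists M; split => // x /hM h w [_ /= /contrapT sw]; apply: h.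
by exists w.
Qed.

Definition intp mu p : R[i] := cintegral mu (horner p).

Lemma integral_formE mu p q : integral_form mu p q = intp mu (p * q).
Proof.
rewrite /integral_form /intp; congr cintegral; apply/funext => x.
by rewrite hornerM.
Qed.

Lemma horner_Re_continuous p : continuous (fun z => complex.Re p.[z]).
Proof.
move=> z; apply: (@continuous_comp R[i] R[i] R (horner p) (@complex.Re R)).
  exact: horner_continuous.
exact: Re_continuous.
Qed.

Lemma horner_Im_continuous p : continuous (fun z => complex.Im p.[z]).
Proof.
move=> z; apply: (@continuous_comp R[i] R[i] R (horner p) (@complex.Im R)).
  exact: horner_continuous.
exact: Im_continuous.
Qed.

Lemma horner_normc_continuous p : continuous (fun z => normc p.[z]).
Proof.
move=> z; apply: (@continuous_comp R[i] R[i] R (horner p) (@normc R)).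
  exact: horner_continuous.
exact: normc_continuous.
Qed.

Lemma intp_parts mu p : intp mu p =
  (\int[jordan_part mu 0]_x complex.Re p.[x]
   - \int[jordan_part mu 1]_x complex.Re p.[x]
   - (\int[jordan_part mu 2]_x complex.Im p.[x]
   - \int[jordan_part mu 3]_x complex.Im p.[x]))
  +i* (\int[jordan_part mu 2]_x complex.Re p.[x]
   - \int[jordan_part mu 3]_x complex.Re p.[x]
   + (\int[jordan_part mu 0]_x complex.Im p.[x]
   - \int[jordan_part mu 1]_x complex.Im p.[x])).
Proof. by []. Qed.

Lemma intpD mu p q : compact (supp mu) -> intp mu (p + q) = intp mu p + intp mu q.
Proof.
move=> cS.
have hRe k : \int[jordan_part mu k]_x complex.Re (p + q).[x] =
    \int[jordan_part mu k]_x complex.Re p.[x] + \int[jordan_part mu k]_x complex.Re q.[x].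
  rewrite -RintegralD//.
  - by apply: eq_Rintegral => x _; rewrite hornerD raddfD.
  - by apply: continuous_integrableC => //; exact: horner_Re_continuous.
  - by apply: continuous_integrableC => //; exact: horner_Re_continuous.
have hIm k : \int[jordan_part mu k]_x complex.Im (p + q).[x] =
    \int[jordan_part mu k]_x complex.Im p.[x] + \int[jordan_part mu k]_x complex.Im q.[x].
  rewrite -RintegralD//.
  - by apply: eq_Rintegral => x _; rewrite hornerD raddfD.
  - by apply: continuous_integrableC => //; exact: horner_Im_continuous.
  - by apply: continuous_integrableC => //; exact: horner_Im_continuous.
rewrite !intp_parts !hRe !hIm.
by apply/eqP; rewrite eq_complex /=; apply/andP; split; apply/eqP; ring.
Qed.

Lemma intpZ mu (a : R[i]) p : compact (supp mu) -> intp mu (a *: p) = a * intp mu p.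
Proof.
move=> cS; case: a => a b.
have iRe k := continuous_integrableC k cS (horner_Re_continuous (p := p)).
have iIm k := continuous_integrableC k cS (horner_Im_continuous (p := p)).
have iZ k (c : R) f : (jordan_part mu k).-integrable [set: borelC R] (EFin \o f) ->
    (jordan_part mu k).-integrable [set: borelC R] (EFin \o (fun x => c * f x)).
  by move=> fi; have := integrableZl measurableT c fi.
have hRe k : \int[jordan_part mu k]_x complex.Re ((a +i* b) *: p).[x] =
    a * \int[jordan_part mu k]_x complex.Re p.[x]
    - b * \int[jordan_part mu k]_x complex.Im p.[x].
  rewrite -(RintegralZl a measurableT (iRe k)) -(RintegralZl b measurableT (iIm k)).
  rewrite -RintegralB//; last 2 first.
  - exact: iZ (iRe k).
  - exact: iZ (iIm k).
  by apply: eq_Rintegral => x _; rewrite hornerZ; case: (p.[x]).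
have hIm k : \int[jordan_part mu k]_x complex.Im ((a +i* b) *: p).[x] =
    a * \int[jordan_part mu k]_x complex.Im p.[x]
    + b * \int[jordan_part mu k]_x complex.Re p.[x].
  rewrite -(RintegralZl a measurableT (iIm k)) -(RintegralZl b measurableT (iRe k)).
  rewrite -RintegralD//; last 2 first.
  - exact: iZ (iIm k).
  - exact: iZ (iRe k).
  by apply: eq_Rintegral => x _; rewrite hornerZ; case: (p.[x]).
rewrite !intp_parts !hRe !hIm.
by apply/eqP; rewrite eq_complex /=; apply/andP; split; apply/eqP; ring.
Qed.

(** A majorant of the modulus of the integral of [p] given by positive measures; it
    plays the role of the integral of the modulus against the total variation. *)
Definition absint mu p : R := 2 * \sum_(k < 4) \int[jordan_part mu k]_x normc p.[x].

Lemma normc_intp mu p : compact (supp mu) -> normc (intp mu p) <= absint mu p.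
Proof.
move=> cS.
have iRe k := continuous_integrableC k cS (horner_Re_continuous (p := p)).
have iIm k := continuous_integrableC k cS (horner_Im_continuous (p := p)).
have iN k := continuous_integrableC k cS (horner_normc_continuous (p := p)).
have hRe k : `|\int[jordan_part mu k]_x complex.Re p.[x]| <=
    \int[jordan_part mu k]_x normc p.[x].
  apply: le_trans (le_normr_Rintegral measurableT (iRe k)) _.
  apply: le_Rintegral => //; last by move=> x _; exact: Re_normc.
  - exact: (integrable_norm (iRe k)).
  - exact: iN.
have hIm j : `|\int[jordan_part mu j]_x complex.Im p.[x]| <=
    \int[jordan_part mu j]_x normc p.[x].
  apply: le_trans (le_normr_Rintegral measurableT (iIm j)) _.
  apply: le_Rintegral => //; last by move=> x _; exact: Im_normc.
  - exact: (integrable_norm (iIm j)).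
  - exact: iN.
have tri (a b c d : R) : `|a - b - (c - d)| <= `|a| + `|b| + (`|c| + `|d|).
  by apply: le_trans (ler_normB _ _) _; apply: lerD; exact: ler_normB.
have tri' (a b c d : R) : `|a - b + (c - d)| <= `|a| + `|b| + (`|c| + `|d|).
  by apply: le_trans (ler_normD _ _) _; apply: lerD; exact: ler_normB.
rewrite intp_parts; apply: le_trans (normc_ReIm _) _.
apply: le_trans (lerD (tri _ _ _ _) (tri' _ _ _ _)) _.
rewrite /absint !big_ord_recl big_ord0.
have -> : lift ord0 ord0 = 1 :> 'I_4 by apply/val_inj.
have -> : lift ord0 (lift ord0 ord0) = 2 :> 'I_4 by apply/val_inj.
have -> : lift ord0 (lift ord0 (lift ord0 ord0)) = 3 :> 'I_4 by apply/val_inj.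
have -> : ord0 = 0 :> 'I_4 by apply/val_inj.
have := (hRe 0, hRe 1, hRe 2, hRe 3, hIm 0, hIm 1, hIm 2, hIm 3).
by case=> [[[[[[[? ?] ?] ?] ?] ?] ?] ?]; lra.
Qed.

Lemma Rintegral_supp mu k (f : R[i] -> R) : compact (supp mu) -> continuous f ->
  \int[jordan_part mu k]_x f x =
  \int[jordan_part mu k]_(x in [set: borelC R] `\` ~` supp mu) f x.
Proof.
move=> cS cf; congr fine; apply: negligible_integral => //.
- by apply: open_measurableC; exact: supp_open_compl.
- exact: continuous_integrableC.
- exact: jordan_part_supp.
Qed.

Lemma absint_le mu K p q (a b : R) : compact (supp mu) ->
  (forall x, supp mu x -> normc K.[x] <= a * normc p.[x] + b * normc q.[x]) ->
  absint mu K <= a * absint mu p + b * absint mu q.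
Proof.
move=> cS hK.
have iN r k := continuous_integrableC k cS (horner_normc_continuous (p := r)).
have iZ r k (c : R) : (jordan_part mu k).-integrable [set: borelC R]
    (EFin \o (fun x => c * normc r.[x])).
  by have := integrableZl measurableT c (iN r k).
have mS : measurable ([set: borelC R] `\` ~` supp mu).
  by apply: measurableD => //; apply: open_measurableC; exact: supp_open_compl.
have h k : \int[jordan_part mu k]_x normc K.[x] <=
    a * \int[jordan_part mu k]_x normc p.[x] + b * \int[jordan_part mu k]_x normc q.[x].
  have cD : continuous (fun x => a * normc p.[x] + b * normc q.[x]).
    move=> x; apply: cvgD; apply: cvgM; try exact: cvg_cst;
      exact: horner_normc_continuous.
  rewrite -(RintegralZl a measurableT (iN p k)) -(RintegralZl b measurableT (iN q k)).
  rewrite -(RintegralD measurableT (iZ p k a) (iZ q k b)).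
  rewrite (Rintegral_supp _ cS (horner_normc_continuous (p := K))).
  rewrite (Rintegral_supp _ cS cD).
  apply: le_Rintegral => //.
  - exact: integrableS (iN K k).
  - apply: integrableS (continuous_integrableC k cS cD) => //.
  - by move=> x [_ /contrapT]; exact: hK.
rewrite /absint !mulrA !(mulrC _ 2) -!mulrA -mulrDr ler_pM2l//.
rewrite !mulr_sumr -big_split /=; apply: ler_sum => k _; exact: h.
Qed.

Lemma total_variation_ge0 mu A : (0 <= Defs.total_variation mu A)%E.
Proof.
apply: ereal_sup_ubound; exists (fun=> set0).
  by split => [//|i j _ _ [x []]//|x [i _]//].
rewrite eseries0 // => i _ _.
by rewrite charge0 -[fine _]/(0 : R[i]) normc0.
Qed.

Lemma total_variation_set0 mu : Defs.total_variation mu set0 = 0%E.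
Proof.
apply/eqP; rewrite eq_le total_variation_ge0 andbT.
apply: ge_ereal_sup => _ [F [_ _ F0] <-].
rewrite eseries0 // => i _ _.
have -> : F i = set0.
  by apply/seteqP; split => // x Fx; apply: F0; exists i.
by rewrite charge0 -[fine _]/(0 : R[i]) normc0.
Qed.

(** The integral against the set function [total_variation] is only a supremum
    over simple functions, which is enough for monotonicity. *)
Lemma integral_le_total_variation mu k (f : borelC R -> R) :
  (forall x, 0 <= f x) ->
  (\int[jordan_part mu k]_x (f x)%:E <= \int[Defs.total_variation mu]_x (f x)%:E)%E.
Proof.
move=> f0; rewrite /integral.
have sE (m : set (borelC R) -> \bar R) (h : {nnsfun (borelC R) >-> R}) : m set0 = 0%E ->
    sintegral m h = (\sum_(x \in range h) x%:E * m (h @^-1` [set x]))%E.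
  move=> m0; rewrite /sintegral (fsbig_widen (range h) setT)//=.
  move=> x [_ /= nhx]; rewrite (_ : h @^-1` [set x] = set0) ?m0 ?mule0//.
  by apply/seteqP; split => // y /= hy; apply: nhx; exists y.
apply: leeB.
  apply: ge_ereal_sup => _ [h hf <-].
  apply: le_trans (ereal_sup_ubound _); last by exists h; [exact: hf|].
  rewrite !sE ?total_variation_set0 ?measure0//.
  apply: lee_fsum => // x [y _ <-]; apply: lee_wpmul2l; first by rewrite lee_fin.
  exact: jordan_part_le.
apply: (@le_trans _ _ 0%E).
  apply: ge_ereal_sup => _ [h hf <-].
  rewrite sE ?total_variation_set0// fsbig1// => x [y _ <-].
  have -> : h y = 0; last by rewrite mul0e.
  apply/eqP; rewrite eq_le fun_ge0 andbT -lee_fin.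
  apply: le_trans (hf y) _; rewrite funenegE patch_setT.
  by rewrite ge_max lexx andbT -EFinN lee_fin oppr_le0 f0.
apply: ereal_sup_ubound; exists nnsfun0; last by rewrite sintegral0.
by move=> x; rewrite funeneg_ge0.
Qed.

(** Because a nonnegative number is at most 1 plus its square. *)
Lemma absint_square mu p (B : R) : compact (supp mu) ->
  (\int[Defs.total_variation mu]_x (normc (p.[x : R[i]] * p.[x : R[i]]))%:E <= B%:E)%E ->
  absint mu p <= absint mu 1 + 8 * B.
Proof.
move=> cS hB.
have iN r k := continuous_integrableC k cS (horner_normc_continuous (p := r)).
have h k : \int[jordan_part mu k]_x normc p.[x] <=
    \int[jordan_part mu k]_x normc (1 : {poly R[i]}).[x] + B.
  have hsq : \int[jordan_part mu k]_x normc (p * p).[x] <= B.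
    rewrite -lee_fin fineK; last by apply: integrable_fin_num => //; exact: iN.
    apply: le_trans hB.
    under eq_integral do rewrite hornerM.
    by apply: integral_le_total_variation => x; exact: normc_ge0.
  apply: le_trans (lerD (lexx _) hsq).
  rewrite -(RintegralD measurableT (iN 1 k) (iN (p * p) k)); apply: le_Rintegral => //.
  - exact: iN.
  - by have := integrableD measurableT (iN 1 k) (iN (p * p) k).
  move=> x _; rewrite hornerC normc1 hornerM normcM.
  by have := normc_ge0 p.[x]; have := sqr_ge0 (normc p.[x] - 1); rewrite -!expr2; nra.
rewrite /absint -lerBlDl -mulrBr -sumrB.
apply: le_trans (_ : 2 * \sum_(k < 4) B <= _).
  by rewrite ler_pM2l//; apply: ler_sum => k _; rewrite lerBlDl.
by rewrite sumr_const card_ord -mulr_natr; lra.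
Qed.

End ComplexMeasure.

(** * Orthonormal polynomials and the Christoffel--Darboux kernel *)

Section OrthonormalPolynomials.
Context {R : realType}.
Implicit Types (p r s P Q : {poly R[i]}) (z : R[i]) (n : nat).
Variables (I : {poly R[i]} -> R[i]) (n0 : nat) (q : nat -> {poly R[i]}).
Variables (alpha beta : nat -> R[i]).
Hypothesis ID : forall p r, I (p + r) = I p + I r.
Hypothesis IZ : forall a p, I (a *: p) = a * I p.
Hypothesis size_q : forall n, (n0 <= n)%N -> size (q n) = n.+1.
Hypothesis orth_q : forall n p, (n0 <= n)%N -> (size p <= n)%N -> I (p * q n) = 0.
Hypothesis norm_q : forall n, (n0 <= n)%N -> I (q n * q n) = 1.
Hypothesis rec_q : forall n, (n0 < n)%N ->
  'X * q n = alpha n.+1 *: q n.+1 + beta n *: q n + alpha n *: q n.-1.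

Lemma IN p : I (- p) = - I p.
Proof. by rewrite -scaleN1r IZ mulN1r. Qed.

Lemma q_neq0 n : (n0 <= n)%N -> q n != 0.
Proof. by move=> /size_q sq; rewrite -size_poly_eq0 sq. Qed.

Lemma lead_q n : (n0 <= n)%N -> (q n)`_n = lead_coef (q n).
Proof. by move=> /size_q sq; rewrite lead_coefE sq. Qed.

Lemma lead_q_neq0 n : (n0 <= n)%N -> lead_coef (q n) != 0.
Proof. by move=> /q_neq0; rewrite lead_coef_eq0. Qed.

Lemma size_sub_lead n (r s : {poly R[i]}) : size s = n.+1 -> (size r <= n.+1)%N ->
  (size (r - (r`_n / lead_coef s) *: s)%R <= n)%N.
Proof.
move=> ss sr; apply/leq_sizeP => j nj; rewrite coefB coefZ.
have [->|jn] := eqVneq j n.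
  have ls : lead_coef s = s`_n by rewrite lead_coefE ss.
  by rewrite ls divfK ?subrr// -ls lead_coef_eq0 -size_poly_eq0 ss.
have nj' : (n < j)%N by move: nj jn; lia.
by rewrite (nth_default _ (leq_trans sr nj')) (nth_default _ (_ : size s <= j)%N) ?mulr0 ?subr0 ?ss.
Qed.

(** Modulo lower degree, [r] is a multiple of [q n]. *)
Lemma I_mul_q n r : (n0 <= n)%N -> (size r <= n.+1)%N ->
  I (r * q n) = r`_n / lead_coef (q n).
Proof.
move=> nn sr; set a := r`_n / _.
rewrite -[r in LHS](subrK (a *: q n)) mulrDl ID orth_q// ?add0r.
  by rewrite -scalerAl IZ norm_q// mulr1.
exact: size_sub_lead (size_q nn) sr.
Qed.

Lemma alphaE n : (n0 < n)%N ->
  alpha n.+1 = lead_coef (q n) / lead_coef (q n.+1).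
Proof.
move=> nn; have n0n := ltnW nn.
have n0n1 : (n0 <= n.+1)%N by exact: leqW.
have n0p : (n0 <= n.-1)%N by lia.
have := congr1 (fun p : {poly R[i]} => p`_n.+1) (rec_q nn).
rewrite coefXM !coefD !coefZ /= !lead_q//.
have -> : (q n)`_n.+1 = 0 by rewrite nth_default// size_q.
have -> : (q n.-1)`_n.+1 = 0 by rewrite nth_default// size_q//; lia.
by rewrite !mulr0 !addr0 => ->; rewrite mulfK// lead_q_neq0.
Qed.

Lemma alpha_neq0 n : (n0 < n)%N -> alpha n.+1 != 0.
Proof.
move=> nn; rewrite alphaE// mulf_neq0 ?invr_eq0 ?lead_q_neq0 ?(ltnW nn)//.
exact/leqW/ltnW.
Qed.

(** A nonzero [p] of lower degree orthogonal to the polynomials of degree below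
    [n] would be orthogonal to every polynomial, as each [q m] with [m >= n] is
    orthogonal to it; multiplied up to degree [n] it would contradict the
    normalisation of [q n]. *)
Lemma I_nondegenerate n p : (n0 <= n)%N -> (size p <= n)%N ->
  (forall r, (size r <= n)%N -> I (r * p) = 0) -> p = 0.
Proof.
move=> nn sp orth; apply/eqP/negPn/negP => p0.
have all_orth r : I (r * p) = 0.
  have [k] := ubnP (size r); elim: k r => // k IH r; rewrite ltnS => rk.
  have [rn|nr] := leqP (size r) n; first exact: orth.
  set m := (size r).-1.
  have sr : size r = m.+1 by rewrite /m prednK// (leq_ltn_trans _ nr).
  have nm : (n <= m)%N by rewrite -ltnS -sr.
  have n0m := leq_trans nn nm.
  rewrite -(subrK ((r`_m / lead_coef (q m)) *: q m) r) mulrDl ID -scalerAl IZ.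
  rewrite [q m * p]mulrC orth_q ?(leq_trans sp)// mulr0 addr0; apply: IH.
  by rewrite (leq_ltn_trans (size_sub_lead (size_q n0m) _)) ?sr//= -sr.
have d0 : (0 < size p)%N by rewrite size_poly_gt0.
pose s := 'X^(n.+1 - size p) * p.
have ss : size s = n.+1.
  by rewrite /s mulrC size_Mmonic ?monicXn// size_polyXn; lia.
have := norm_q nn.
rewrite -{1}(subrK (((q n)`_n / lead_coef s) *: s) (q n)) mulrDl ID.
have sq : s * q n = ('X^(n.+1 - size p) * q n) * p by rewrite /s mulrAC.
rewrite orth_q ?size_sub_lead ?size_q// add0r -scalerAl IZ sq all_orth mulr0.
by move=> /eqP; rewrite eq_sym oner_eq0.
Qed.

(** The Christoffel--Darboux kernel, as a polynomial in its free variable; the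
    division is exact. *)
Definition cd_kernel n (z : R[i]) : {poly R[i]} :=
  alpha n.+1 *:
    (((q n).[z] *: q n.+1 - (q n.+1).[z] *: q n) %/ ('X - z%:P)).

Lemma cd_kernelE n z : cd_kernel n z * ('X - z%:P) =
  alpha n.+1 *: ((q n).[z] *: q n.+1 - (q n.+1).[z] *: q n).
Proof.
rewrite /cd_kernel -scalerAl divpK// dvdp_XsubCl /root.
by rewrite hornerD hornerN !hornerZ mulrC subrr.
Qed.

Lemma horner_cd_kernel n z x : (cd_kernel n z).[x] * (x - z) =
  alpha n.+1 * ((q n).[z] * (q n.+1).[x] - (q n.+1).[z] * (q n).[x]).
Proof.
have := congr1 (horner^~ x) (cd_kernelE n z).
by rewrite /= hornerM hornerXsubC => ->; rewrite hornerZ hornerD hornerN !hornerZ.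
Qed.

(** Christoffel--Darboux: the kernel is orthogonal to the multiples of
    ['X - z%:P] because its product with ['X - z%:P] is a combination of [q n.+1]
    and [q n]; its integral is 1 by comparison of leading coefficients. *)
Lemma I_cd_kernel n z p : (n0 < n)%N -> (size p <= n.+1)%N ->
  I (cd_kernel n z * p) = p.[z].
Proof.
move=> nn sp.
have divz (r : {poly R[i]}) : exists2 s, r = r.[z]%:P + ('X - z%:P) * s &
    size s = (size r).-1.
  have /factor_theorem[s sE] : root (r - r.[z]%:P) z.
    by rewrite /root hornerD hornerN hornerC subrr.
  exists s; first by rewrite mulrC -sE addrC subrK.
  have [s0|s0] := eqVneq s 0.
    move: sE; rewrite s0 mul0r => /eqP; rewrite subr_eq0 => /eqP ->.
    by rewrite size_poly0 size_polyC; case: (_ != 0).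
  have szs : size (r - r.[z]%:P) = (size s).+1.
    by rewrite sE size_Mmonic ?monicXsubC// size_XsubC addn2.
  have : size (r - r.[z]%:P) = size r; last by rewrite szs => <-.
  apply: size_polyDl; rewrite size_polyN size_polyC.
  have [sr|sr] := leqP (size r) 1; last by case: (_ != 0) => //; exact: ltnW.
  have rc := size1_polyC sr.
  by move: szs; rewrite rc hornerC subrr size_poly0.
have [P1 PE sP] := divz (q n); have [Q1 QE sQ] := divz (q n.+1).
have [p1 pE sp1] := divz p.
have nn' : (n0 <= n.+1)%N by rewrite ltnW// ltnS ltnW.
have n0n := ltnW nn.
have KE : cd_kernel n z = alpha n.+1 *: (Q1 * q n - P1 * q n.+1).
  have : 'X - z%:P != 0 by rewrite polyXsubC_eq0.
  move=> /mulIf; apply; rewrite cd_kernelE -scalerAl; congr (_ *: _).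
  rewrite -!mul_polyC.
  have hP : (q n).[z]%:P = q n - ('X - z%:P) * P1.
    by apply/eqP; rewrite eq_sym subr_eq -PE.
  have hQ : (q n.+1).[z]%:P = q n.+1 - ('X - z%:P) * Q1.
    by apply/eqP; rewrite eq_sym subr_eq -QE.
  by rewrite hP hQ; ring.
have IK : I (cd_kernel n z) = 1.
  rewrite KE IZ ID IN I_mul_q//; last by rewrite sQ size_q.
  rewrite orth_q ?subr0//; last by rewrite sP size_q.
  rewrite alphaE// (_ : Q1`_n = lead_coef (q n.+1)).
    by rewrite mulrA divfK ?divff ?lead_q_neq0.
  have lQ : lead_coef (q n.+1) = lead_coef Q1.
    rewrite QE addrC lead_coefDl.
      by rewrite lead_coefM lead_coefXsubC mul1r.
    rewrite size_polyC (leq_ltn_trans (leq_b1 _))//.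
    rewrite mulrC size_Mmonic ?monicXsubC// -?size_poly_eq0 ?sQ ?size_q//.
    by rewrite size_XsubC addn2.
  by rewrite lQ lead_coefE sQ size_q.
rewrite {1}pE mulrDr ID mulrC mul_polyC IZ IK mulr1 mulrA cd_kernelE.
rewrite -scalerAl IZ mulrBl ID IN -!scalerAl !IZ ![q _ * p1]mulrC.
have sp1' : (size p1 <= n)%N by rewrite sp1; case: (size p) sp.
by rewrite !orth_q ?(leqW sp1')// !mulr0 subr0 mulr0 addr0.
Qed.

(** Minimality bounds the degree of [P] from above, nondegeneracy from below. *)
Lemma monic_orthogonal_q n P : (n0 <= n)%N ->
  monic_orthogonal (fun p r => I (p * r)) n P -> P = (lead_coef (q n))^-1 *: q n.
Proof.
move=> nn [mP oP minP].
have sPq : (size P <= n.+1)%N.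
  rewrite -(size_q nn); apply: minP; first exact: q_neq0.
  by move=> p sp; exact: orth_q.
have [sPn|nsP] := leqP (size P) n.
  have P0 : P = 0 by apply: (I_nondegenerate nn sPn) => r sr; exact: oP.
  by move: mP; rewrite P0 monicE lead_coef0 eq_sym oner_eq0.
have sP : size P = n.+1 by apply/eqP; rewrite eqn_leq sPq.
have PEn : P`_n = 1 by have := monicP mP; rewrite lead_coefE sP.
apply/eqP; rewrite -subr_eq0; apply/eqP.
have -> : (lead_coef (q n))^-1 = P`_n / lead_coef (q n) by rewrite PEn mul1r.
apply: (I_nondegenerate nn); first exact: size_sub_lead (size_q nn) sPq.
move=> r sr; rewrite mulrBr ID IN -scalerAr IZ orth_q// mulr0 subr0.
exact: oP.
Qed.

End OrthonormalPolynomials.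

Section NoDecay.
Context {R : realType}.
Implicit Types (p r s P Q : {poly R[i]}) (z : R[i]) (n : nat).
Variables (mu : complex_measure R) (n0 : nat) (q : nat -> {poly R[i]}).
Variables (alpha beta : nat -> R[i]) (B : R).
Hypothesis cS : compact (supp mu).
Hypothesis size_q : forall n, (n0 <= n)%N -> size (q n) = n.+1.
Hypothesis orth_q : forall n p, (n0 <= n)%N -> (size p <= n)%N ->
  intp mu (p * q n) = 0.
Hypothesis norm_q : forall n, (n0 <= n)%N -> intp mu (q n * q n) = 1.
Hypothesis rec_q : forall n, (n0 < n)%N ->
  'X * q n = alpha n.+1 *: q n.+1 + beta n *: q n + alpha n *: q n.-1.
Hypothesis alpha_cvg : alpha @ \oo --> (2^-1 : R[i]).
Hypothesis q_bound : forall n, (n0 <= n)%N ->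
  (\int[Defs.total_variation mu]_x
     (normc ((q n).[x : R[i]] * (q n).[x : R[i]]))%:E <= B%:E)%E.

(** Since the kernel integrates to 1 while [x - z] stays away from 0 on the
    support, two consecutive values at [z] cannot both be small. *)
Lemma q_no_decay z : ~ supp mu z ->
  exists2 e : R, 0 < e & \forall n \near \oo,
    e <= normc (q n).[z] + normc (q n.+1).[z].
Proof.
move=> Sz.
have [d d0 hd] : exists2 d : R, 0 < d & forall x, supp mu x -> d <= normc (x - z).
  have : nbhs z (~` supp mu).
    by apply: open_nbhs_nbhs; split => //; exact: supp_open_compl.
  move=> /nbhs_normcP[d d0 hd]; exists d => // x Sx.
  by rewrite leNgt; apply/negP => /hd.
pose A := absint mu 1 + 8 * B.
have A0 n : (n0 <= n)%N -> absint mu (q n) <= A.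
  by move=> nn; apply: absint_square => //; exact: q_bound.
have absge p : 0 <= absint mu p by apply: le_trans (normc_intp p cS); exact: normc_ge0.
have A00 : 0 <= A by apply: le_trans (A0 n0 _) => //.
exists (d / (A + 1)); first by rewrite divr_gt0//; lra.
near=> n.
have nn : (n0 < n)%N by near: n; exact: nbhs_infty_gt.
have n0n := ltnW nn.
have n0n1 : (n0 <= n.+1)%N by exact: leqW.
have an : normc (alpha n.+1) <= 1.
  near: n; have := cvg_comp _ _ (cvg_addnr 1) alpha_cvg.
  move/cvg_normcP/(_ 2^-1 ltac:(lra)); apply: filterS => n /=.
  rewrite addn1 => /ltW h; have := normcD (alpha n.+1 - 2^-1) 2^-1.
  by rewrite subrK normcV normc_nat; lra.
set x := normc _; set y := normc _.
have IK := I_cd_kernel (fun p r => intpD p r cS) (fun a p => intpZ a p cS)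
  size_q orth_q norm_q rec_q (n := n) z nn (p := 1).
have {}IK : intp mu (cd_kernel q alpha n z) = 1.
  by rewrite -[cd_kernel _ _ _ _]mulr1 IK ?hornerC// size_poly1.
have hK : 1 <= x / d * absint mu (q n.+1) + y / d * absint mu (q n).
  rewrite -[leLHS](normc1 R) -IK; apply: le_trans (normc_intp _ cS) _.
  apply: absint_le => // w Sw.
  have dw := hd _ Sw.
  have wz : w - z != 0 by rewrite -normc_gt0; lra.
  have := horner_cd_kernel q alpha n z w.
  move=> /(congr1 (@normc R)); rewrite !normcM => hk.
  have {}hk : normc (cd_kernel q alpha n z).[w] * d <=
      x * normc (q n.+1).[w] + y * normc (q n).[w].
    apply: le_trans (_ : normc (cd_kernel q alpha n z).[w] * normc (w - z) <= _).
      by rewrite ler_wpM2l// normc_ge0.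
    rewrite hk; apply: le_trans (ler_wpM2r (normc_ge0 _) an) _.
    by rewrite mul1r; apply: le_trans (normcD _ _) _; rewrite normc_opp !normcM.
  by rewrite -ler_pdivlMr// mulrDl !(mulrAC _ _ d^-1) in hk.
have := A0 _ n0n; have := A0 _ n0n1 => h1 h2.
have x0 : 0 <= x / d by rewrite divr_ge0 ?normc_ge0// ltW.
have y0 : 0 <= y / d by rewrite divr_ge0 ?normc_ge0// ltW.
have h3 : 1 <= (x / d + y / d) * A.
  by apply: le_trans hK _; rewrite mulrDl lerD// ler_wpM2l.
rewrite ler_pdivrMr; last by lra.
rewrite -mulrDl mulrAC ler_pdivlMr// mul1r in h3.
apply: le_trans h3 _; rewrite ler_wpM2l ?addr_ge0 ?normc_ge0//; lra.
Unshelve. all: by end_near. Qed.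
End NoDecay.

(** * Local uniform convergence and the inverse Joukowski map *)

Section LocalUniform.
Context {R : realType}.
Implicit Types (z l : R[i]).

(** Convergence of [f n z] to a constant as [(z, n)] tends to [(z0, oo)]: for a
    continuous limit this is locally uniform convergence near [z0]. *)
Definition locf z0 : set_system (R[i] * nat) := filter_prod (nbhs z0) \oo.

#[global] Instance locf_filter z0 : ProperFilter (locf z0).
Proof. exact: filter_prod_proper. Qed.

Lemma locfP z0 (P : R[i] * nat -> Prop) :
  locf z0 P <-> exists (e : R) (N : nat), 0 < e /\
    forall z n, normc (z - z0) < e -> (N <= n)%N -> P (z, n).
Proof.
split.
  move=> [[A B] /= [/nbhs_normcP[e e0 hA] [N _ hB]] AB].
  by exists e, N; split => // z n ze Nn; apply: AB; split; [exact: hA|exact: hB].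
move=> [e [N [e0 h]]].
exists ([set z | normc (z - z0) < e], [set n | (N <= n)%N]) => /=.
  by split; [exact: nbhs_normc_ball|exists N].
by move=> [z n] [/= ze Nn]; exact: h.
Qed.

Lemma locf_fst z0 (P : R[i] -> Prop) :
  (\forall z \near z0, P z) -> \forall p \near locf z0, P p.1.
Proof. by move=> h; apply: cvg_fst h. Qed.

Lemma locf_snd z0 (P : nat -> Prop) :
  (\forall n \near \oo, P n) -> \forall p \near locf z0, P p.2.
Proof. by move=> h; apply: cvg_snd h. Qed.

Lemma locf_at z0 (P : R[i] * nat -> Prop) :
  locf z0 P -> \forall n \near \oo, P (z0, n).
Proof.
move=> /locfP[e [N [e0 h]]]; exists N => // n Nn; apply: h => //.
by rewrite subrr normc0.
Qed.

Lemma locf_cvg_at z0 (f : R[i] * nat -> R[i]) (l : R[i]) :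
  f @ locf z0 --> l -> (fun n => f (z0, n)) @ \oo --> l.
Proof.
move=> /cvg_normcP h; apply/cvg_normcP => e e0.
exact: (locf_at (h e e0)).
Qed.

Lemma locf_cvg_snd z0 (a : nat -> R[i]) (l : R[i]) :
  a @ \oo --> l -> (fun p => a p.2) @ locf z0 --> l.
Proof. by move=> h; apply: cvg_comp h; exact: cvg_snd. Qed.

Lemma locf_cvg_fst z0 (a : R[i] -> R[i]) (l : R[i]) :
  a @ z0 --> l -> (fun p => a p.1) @ locf z0 --> l.
Proof. by move=> h; apply: cvg_comp h; exact: cvg_fst. Qed.

Lemma locf_shift z0 (P : R[i] * nat -> Prop) :
  locf z0 P -> locf z0 (fun p => P (p.1, p.2.+1)).
Proof.
move=> /locfP[e [N [e0 h]]]; apply/locfP; exists e, N; split => // z n ze Nn /=.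
by apply: h => //; exact: leqW.
Qed.

Lemma locf_cvg_shift z0 (f : R[i] * nat -> R[i]) (l : R[i]) :
  f @ locf z0 --> l -> (fun p => f (p.1, p.2.+1)) @ locf z0 --> l.
Proof.
move=> /cvg_normcP h; apply/cvg_normcP => e e0; exact: (locf_shift (h e e0)).
Qed.

Lemma locf_near z0 (P : R[i] * nat -> Prop) :
  locf z0 P -> \forall z \near z0, locf z P.
Proof.
move=> /locfP[e [N [e0 h]]]; apply/nbhs_normcP; exists (e / 2); first by lra.
move=> z ze; apply/locfP; exists (e / 2), N; split; first by lra.
move=> w n wz Nn; apply: h => //.
have -> : w - z0 = (w - z) + (z - z0) by rewrite addrA subrK.
by apply: le_lt_trans (normcD _ _) _; lra.
Qed.

End LocalUniform.

Section InverseJoukowski.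
Context {R : realType} (s : R[i] -> R[i]).
Hypothesis sP : is_sqrt_branch s.
Implicit Types z : R[i].

Notation phi := (inv_joukowski s).
(** The other solution [w] of [w + 1 / w = 2 * z]. *)
Definition joukowski_inv z : R[i] := z - s z.
Notation u := joukowski_inv.

Lemma sqr_branch z : ~ segment11 z -> s z ^+ 2 = z ^+ 2 - 1.
Proof. by move=> /sP.1[]. Qed.

Lemma phi_mul_u z : ~ segment11 z -> phi z * u z = 1.
Proof.
move=> hz; rewrite /inv_joukowski /u mulrC -subr_sqr sqr_branch//.
by rewrite opprB addrC subrK.
Qed.

Lemma phi_add_u z : phi z + u z = 2 * z.
Proof. by rewrite /inv_joukowski /u addrACA subrr addr0 mulr2n mulrDl mul1r. Qed.

Lemma phi_neq0 z : ~ segment11 z -> phi z != 0.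
Proof.
by move=> /phi_mul_u h; apply: contra_eq_neq h => ->; rewrite mul0r eq_sym oner_neq0.
Qed.

Lemma uE z : ~ segment11 z -> u z = (phi z)^-1.
Proof.
move=> hz; apply: (mulfI (phi_neq0 hz)).
by rewrite phi_mul_u// mulfV// phi_neq0.
Qed.

Lemma branch_continuous z : ~ segment11 z -> {for z, continuous s}.
Proof.
move=> /sP.1[ds _].
by have /derivable1_diffP/differentiable_continuous := ds.
Qed.

Lemma phi_continuous z : ~ segment11 z -> {for z, continuous phi}.
Proof. by move=> hz; apply: cvgD; [exact: cvg_id|exact: branch_continuous]. Qed.

Lemma real_segment11 (x : R) : (segment11 x%:C : Prop) <-> -1 <= x <= 1.
Proof.
split=> [[y /= + [<-]]|hx]; first by rewrite in_itv.
by exists x => //=; rewrite in_itv.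
Qed.

(** On the unit circle [u] is the conjugate of [phi], so that [2 z] is twice a
    real part. *)
Lemma normc_phi_neq z : ~ segment11 z -> normc (phi z) != normc (u z).
Proof.
move=> hz; apply/eqP => h.
have n1 : normc (phi z) = 1.
  have := congr1 (@normc R) (phi_mul_u hz); rewrite normcM -h normc1 => /eqP.
  by rewrite -expr2 sqrf_eq1 => /orP[/eqP//|/eqP hm]; have := normc_ge0 (phi z); lra.
have ud : u z = (complex.Re (phi z)) -i* (complex.Im (phi z)).
  apply: (mulfI (phi_neq0 hz)); rewrite phi_mul_u//.
  have : normc (phi z) ^+ 2 = 1 by rewrite n1 expr1n.
  case: (phi z) => a b; rewrite /normc sqr_sqrtr ?addr_ge0 ?sqr_ge0// => ab.
  by apply/eqP; rewrite eq_complex /=; apply/andP; split; apply/eqP; rewrite -?ab; ring.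
apply: hz; have := phi_add_u z; rewrite ud.
have : `|complex.Re (phi z)| <= 1 by rewrite -n1 Re_normc.
case: (phi z) => a b /=; rewrite ler_norml => ha h2.
have -> : z = a%:C.
  have /mulfI : (2 : R[i]) != 0 by rewrite pnatr_eq0.
  apply; rewrite -h2; apply/eqP; rewrite eq_complex /=; apply/andP.
  by split; apply/eqP; ring.
by apply/real_segment11.
Qed.

Let g z : R := normc (phi z) - normc (u z).

Let g_continuous z : ~ segment11 z -> {for z, continuous g}.
Proof.
move=> hz; apply: cvgB.
  apply: (@continuous_comp R[i] R[i] R phi (@normc R)).
    exact: phi_continuous.
  exact: normc_continuous.
apply: (@continuous_comp R[i] R[i] R u (@normc R)).
  by apply: cvgB; [exact: cvg_id|exact: branch_continuous].
exact: normc_continuous.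
Qed.

Let g_path a b : (forall t : R, 0 <= t <= 1 -> ~ segment11 (a + t%:C * (b - a))) ->
  0 < g b -> 0 < g a.
Proof.
move=> hab gb; rewrite ltNge; apply/negP => ga.
pose h (t : R) := g (a + t%:C * (b - a)).
have hc : {within `[0, 1], continuous h}.
  apply: continuous_in_subspaceT => t; rewrite inE /= in_itv /= => ht.
  apply: (@continuous_comp R R[i] R (fun t : R => a + t%:C * (b - a)) g).
    apply/cvg_normcP => e e0.
    have [ba|ba] := eqVneq (b - a) 0; near=> x;
      rewrite opprD addrACA subrr add0r -mulrBl -rmorphB normcM normc_real.
      by rewrite ba normc0 mulr0.
    rewrite -ltr_pdivlMr ?normc_gt0//.
    near: x; apply: (cvgr_distC_lt (F := nbhs t)); [exact: cvg_id|].
    by rewrite divr_gt0// normc_gt0.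
  exact: g_continuous (hab _ ht).
have [|t] := @IVT R h 0 1 0 ler01 hc.
  have -> : h 0 = g a by rewrite /h mul0r addr0.
  have -> : h 1 = g b by rewrite /h mul1r subrKC.
  by rewrite ge_min ga /= le_max (ltW gb) orbT.
rewrite in_itv /= => ht /eqP; rewrite subr_eq0.
exact/negP/normc_phi_neq/hab.
Unshelve. all: by end_near. Qed.

Let g_big (x : R) : 1 < x -> 0 < g x%:C.
Proof.
move=> x1; have /posc_real[y y0 yE] := sP.2 _ x1.
rewrite /g /inv_joukowski /u yE -rmorphB -rmorphD !normc_real.
rewrite gtr0_norm; last by lra.
by rewrite subr_gt0 ltr_norml; lra.
Qed.

(** The difference of the moduli of [phi] and [u] does not vanish off the segment
    and is positive far out on the real axis, to which every point is joined by
    segments that avoid [[-1, 1]]. *)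
Lemma normc_phi_gt1 z : ~ segment11 z -> 1 < normc (phi z).
Proof.
move=> hz.
have hIm w : complex.Im w != 0 -> ~ segment11 w.
  by move=> + [x _ xw]; rewrite -xw /= eqxx.
suff gz : 0 < g z.
  have := congr1 (@normc R) (phi_mul_u hz); rewrite normcM normc1.
  move: gz; rewrite /g; have := normc_ge0 (u z); have := normc_ge0 (phi z).
  by nra.
have g2 : 0 < g 2%:C by apply: g_big; lra.
have gIm w : complex.Im w != 0 -> 0 < g w.
  move=> w0; apply: (g_path (b := 2%:C)) => // t ht.
  have [t1|t1] := eqVneq t 1.
    by rewrite t1 mul1r subrKC real_segment11; lra.
  apply: hIm.
  have -> : complex.Im (w + t%:C * (2%:C - w)) = (1 - t) * complex.Im w.
    by clear; case: w => a b /=; ring.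
  by rewrite mulf_neq0// subr_eq0 eq_sym.
have [z0|] := eqVneq (complex.Im z) 0; last exact: gIm.
have zE : z = (complex.Re z)%:C by case: (z) z0 => a b /= ->.
set x := complex.Re z in zE.
have hx : ~~ (-1 <= x <= 1) by apply/negP => /real_segment11; rewrite -zE.
apply: (g_path (b := 'i)); last by apply: gIm; rewrite /= oner_neq0.
move=> t ht; have [t0|t0] := eqVneq t 0; first by rewrite t0 mul0r addr0.
apply: hIm; rewrite zE (_ : complex.Im _ = t)//=.
by clear; ring.
Qed.

Lemma branch_neq0 z : ~ segment11 z -> s z != 0.
Proof.
move=> hz; apply: contraNneq (normc_phi_neq hz) => s0.
by rewrite /inv_joukowski /u s0 addr0 subr0.
Qed.

Lemma phi_sub_u z : phi z - u z = 2 * s z.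
Proof. by rewrite /inv_joukowski /u; ring. Qed.

End InverseJoukowski.

Section PoincareDichotomy.
Context {R : realType}.

(** The growth of a dominant and a recessive component under an almost diagonal
    recurrence with multipliers [l] and [1 / l]. *)
Definition almost_diagonal (l h : R) (N : nat) (A C : nat -> R) : Prop :=
  (1 < l /\ 0 <= h /\ 3 * h <= l - 1 /\ 3 * h <= 1 - l^-1) /\
  [/\ forall n, 0 <= A n, forall n, 0 <= C n,
     forall n, (N <= n)%N -> l * A n - h * (A n + C n) <= A n.+1 &
     forall n, (N <= n)%N -> C n.+1 <= l^-1 * C n + h * (A n + C n)].

(** In the cone [C < 2 A] the dominant component [A] grows and the ratio [C / A]
    is contracted by [l^-1] up to an error [3 h]. *)
Lemma cone_invariant l h N A C M : almost_diagonal l h N A C ->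
  (N <= M)%N -> C M < 2 * A M -> forall k,
  [/\ 0 < A (M + k)%N, C (M + k)%N < 2 * A (M + k)%N &
      C (M + k)%N <= (2 * l^-1 ^+ k + 3 * h / (1 - l^-1)) * A (M + k)%N].
Proof.
move=> [[l1 [h0 [hl hl']]] [A0 C0 stepA stepC]].
have l0 : 0 < l^-1 by rewrite invr_gt0; lra.
have l1' : l^-1 < 1 by rewrite invf_lt1//; lra.
move=> NM CM; elim=> [|k [Ak Ck rk]].
  rewrite addn0; split => //; first by have := C0 M; lra.
  rewrite expr0 mulr1; apply: le_trans (ltW CM) _.
  rewrite ler_wpM2r// lerDl divr_ge0 ?mulr_ge0//; lra.
rewrite addnS; set n := (M + k)%N in Ak Ck rk *.
have Nn : (N <= n)%N by rewrite (leq_trans NM) ?leq_addr.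
have sA := stepA _ Nn; have sC := stepC _ Nn.
have hAC : h * (A n + C n) <= 3 * h * A n by nra.
have AA : A n <= A n.+1 by nra.
have lC : l^-1 * C n <= l^-1 * (2 * A n) by rewrite ler_wpM2l ?(ltW l0)// ltW.
split; first by lra.
  by nra.
have : l^-1 * C n <= l^-1 * ((2 * l^-1 ^+ k + 3 * h / (1 - l^-1)) * A n).
  by rewrite ler_wpM2l// ltW.
set D := 3 * h / (1 - l^-1).
have DE : 3 * h = D * (1 - l^-1) by rewrite /D divfK// gt_eqF//; lra.
have D0 : 0 <= D by rewrite /D divr_ge0 ?mulr_ge0//; lra.
have lk : 0 <= l^-1 ^+ k by rewrite exprn_ge0// ltW.
rewrite exprS; set x := l^-1 ^+ k in lk * => h1.
apply: (@le_trans _ _ ((2 * (l^-1 * x) + D) * A n)).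
  apply: le_trans sC _; move: hAC; rewrite DE; lra.
by rewrite ler_wpM2l// addr_ge0// !mulr_ge0// ltW.
Qed.

(** Outside the cone the recessive component decays, and dominates [A]. *)
Lemma cone_avoiding l h N A C : almost_diagonal l h N A C ->
  (forall n, (N <= n)%N -> 2 * A n <= C n) ->
  C @ \oo --> (0 : R) /\ A @ \oo --> (0 : R).
Proof.
move=> [[l1 [h0 [hl hl']]] [A0 C0 stepA stepC]].
have l0 : 0 < l^-1 by rewrite invr_gt0; lra.
have l1' : l^-1 < 1 by rewrite invf_lt1//; lra.
move=> AC; set r := l^-1 + 2 * h.
have r1 : r < 1 by rewrite /r; lra.
have r0 : 0 <= r by rewrite /r; lra.
have Ck k : C (N + k)%N <= C N * r ^+ k.
  elim: k => [|k IH]; first by rewrite addn0 expr0 mulr1.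
  rewrite addnS exprSr mulrA; have Nn : (N <= N + k)%N by rewrite leq_addr.
  apply: le_trans (stepC _ Nn) _; apply: (@le_trans _ _ (C (N + k)%N * r)).
    by rewrite /r; have := AC _ Nn; have := C0 (N + k)%N; nra.
  by rewrite ler_wpM2r.
have Ccv : C @ \oo --> (0 : R).
  have : (fun k => C N * r ^+ k) @ \oo --> (0 : R).
    rewrite -(mulr0 (C N)); apply: cvgM; first exact: cvg_cst.
    by apply: cvg_expr; rewrite ger0_norm.
  move=> /cvgrPdist_lt hr; apply/cvgrPdist_lt => e e0.
  have [K _ hK] := hr e e0; exists (N + K)%N => // n /= Kn.
  have Nn : (N <= n)%N by rewrite (leq_trans _ Kn) ?leq_addr.
  rewrite sub0r normrN ger0_norm// -(subnKC Nn); apply: le_lt_trans (Ck _) _.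
  have := hK (n - N)%N; rewrite /= leq_subRL// => /(_ Kn).
  by rewrite sub0r normrN; apply: le_lt_trans; exact: ler_norm.
split => //; move/cvgrPdist_lt : Ccv => hC; apply/cvgrPdist_lt => e e0.
near=> n.
have : `|0 - C n| < e by near: n; exact: hC.
have : 2 * A n <= C n by near: n; exists N.
rewrite !sub0r !normrN !ger0_norm//.
by have := A0 n; lra.
Unshelve. all: by end_near. Qed.

End PoincareDichotomy.

(** * Limit theorems for local uniform convergence *)

Section LocfLimits.
Context {R : realType}.
Implicit Types (f g t : R[i] * nat -> R[i]).

Lemma locf_cvg_neq0 z0 f l : f @ locf z0 --> l -> l != 0 ->
  \forall p \near locf z0, f p != 0.
Proof.
move=> /cvg_normcP fl l0.
have /fl : 0 < normc l by rewrite normc_gt0.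
apply: filterS => p; apply: contraTneq => ->.
by rewrite sub0r normc_opp ltxx.
Qed.

Lemma locf_cvg_bounded z0 f l : f @ locf z0 --> l ->
  \forall p \near locf z0, normc (f p) <= normc l + 1.
Proof.
move=> /cvg_normcP/(_ 1 ltr01); apply: filterS => p h.
by have := normcB (f p) l; lra.
Qed.

(** A linear recurrence with a contracting multiplier converges to its fixed
    point, locally uniformly, from any locally bounded start. *)
Lemma locf_contraction z0 (d g t : R[i] * nat -> R[i]) (g0 t0 : R[i]) :
  normc t0 < 1 -> g @ locf z0 --> g0 -> t @ locf z0 --> t0 ->
  (\forall p \near locf z0, d (p.1, p.2.+1) = g p + t p * d p) ->
  (\forall n \near \oo, exists B : R, \forall z \near z0, normc (d (z, n)) <= B) ->
  d @ locf z0 --> g0 / (1 - t0).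
Proof.
move=> t01 gg0 tt0 dE dB; set L := g0 / (1 - t0).
have t1 : 1 - t0 != 0.
  by rewrite subr_eq0; apply: contraTneq t01 => <-; rewrite normc1 ltxx.
have LE : L = g0 + t0 * L.
  by apply/eqP; rewrite -subr_eq0 /L; apply/eqP; field.
apply/cvg_normcP => e e0.
pose r := (normc t0 + 1) / 2.
have r1 : r < 1 by rewrite /r; lra.
have r0 : 0 <= r by rewrite /r; have := normc_ge0 t0; lra.
pose h := e / 4 * (1 - r).
have h0 : 0 < h by rewrite /h mulr_gt0 ?divr_gt0//; lra.
have : \forall p \near locf z0, [/\ normc (t p) <= r,
    normc ((g p - g0) + (t p - t0) * L) <= h &
    d (p.1, p.2.+1) = g p + t p * d p].
  near=> p; split; last by near: p.
    near: p; move/cvg_normcP : tt0 => /(_ (r - normc t0)) h1.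
    have /h1 : 0 < r - normc t0 by rewrite /r; lra.
    by apply: filterS => p h2; have := normcB (t p) t0; lra.
  near: p.
  have : (fun p => (g p - g0) + (t p - t0) * L) @ locf z0 --> (g0 - g0) + (t0 - t0) * L.
    exact: (cvgD (cvgB gg0 (cvg_cst g0)) (cvgM (cvgB tt0 (cvg_cst t0)) (cvg_cst L))).
  rewrite !subrr mul0r addr0 => /cvg_normcP/(_ _ h0).
  by apply: filterS => p; rewrite subr0 => /ltW.
move=> /locfP[e1 [N1 [e10 H]]].
have [N [N1N [B hB]]] : exists N, (N1 <= N)%N /\ exists B : R,
    \forall z \near z0, normc (d (z, N)) <= B.
  case: dB => N2 _ hN2; exists (maxn N1 N2); split; first exact: leq_maxl.
  by apply: hN2 => /=; exact: leq_maxr.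
have B'0 : 0 <= `|B| + normc L by rewrite addr_ge0 ?normc_ge0.
have step z k : normc (z - z0) < e1 -> normc (d (z, N)) <= B ->
    normc (d (z, N + k)%N - L) <= r ^+ k * (`|B| + normc L) + e / 4.
  move=> ze zB; elim: k => [|k IH].
    rewrite addn0 expr0 mul1r; have := normcD (d (z, N)) (- L).
    by rewrite normc_opp; have := ler_norm B; lra.
  have [tr gh dd] := H z (N + k)%N ze (leq_trans N1N (leq_addr _ _)).
  rewrite addnS dd /= {1}LE.
  have -> : g (z, N + k)%N + t (z, N + k)%N * d (z, N + k)%N - (g0 + t0 * L) =
     ((g (z, N + k)%N - g0) + (t (z, N + k)%N - t0) * L) +
     t (z, N + k)%N * (d (z, N + k)%N - L) by ring.
  apply: le_trans (normcD _ _) _; rewrite normcM.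
  apply: le_trans (lerD gh (ler_pM (normc_ge0 _) (normc_ge0 _) tr IH)) _.
  by rewrite exprS /h; set x := r ^+ k; lra.
have : \forall k \near \oo, r ^+ k * (`|B| + normc L) < e / 4.
  have : (fun k => r ^+ k * (`|B| + normc L)) @ \oo --> (0 : R).
    rewrite -(mul0r (`|B| + normc L)); apply: cvgM; last exact: cvg_cst.
    by apply: cvg_expr; rewrite ger0_norm.
  have e40 : 0 < e / 4 by lra.
  move=> /cvgrPdist_lt/(_ _ e40); apply: filterS => k.
  by rewrite sub0r normrN; apply: le_lt_trans; exact: ler_norm.
move=> [K _ hK]; move/nbhs_normcP : hB => [e2 e20 hB].
apply/locfP; exists (Num.min e1 e2), (N + K)%N; split; first by rewrite lt_min e10.
move=> z n; rewrite lt_min => /andP[z1 z2] nK.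
have Nn : (N <= n)%N by rewrite (leq_trans _ nK) ?leq_addr.
rewrite -(subnKC Nn); apply: le_lt_trans (step _ _ z1 (hB _ z2)) _.
have := hK (n - N)%N; rewrite /= leq_subRL// => /(_ nK); lra.
Unshelve. all: by end_near. Qed.

(** The theorem on Cesaro means, uniformly near a point. *)
Lemma locf_cesaro z0 (x d : R[i] * nat -> R[i]) (l : R[i]) :
  d @ locf z0 --> l ->
  (\forall p \near locf z0, x (p.1, p.2.+1) = x p + d p) ->
  (\forall n \near \oo, exists B : R, \forall z \near z0, normc (x (z, n)) <= B) ->
  (fun p => x p / p.2%:R) @ locf z0 --> l.
Proof.
move=> dl xE xB; apply/cvg_normcP => e e0.
have e20 : 0 < e / 2 by lra.
have : \forall p \near locf z0, normc (d p - l) < e / 2 /\ x (p.1, p.2.+1) = x p + d p.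
  near=> p; split; near: p => //.
  by move/cvg_normcP : dl; apply.
move=> /locfP[e1 [N1 [e10 H]]].
have [N [N1N [B hB]]] : exists N, (N1 <= N)%N /\ exists B : R,
    \forall z \near z0, normc (x (z, N)) <= B.
  case: xB => N2 _ hN2; exists (maxn N1 N2); split; first exact: leq_maxl.
  by apply: hN2 => /=; exact: leq_maxr.
have step z k : normc (z - z0) < e1 -> normc (x (z, N)) <= B ->
    normc (x (z, N + k)%N - k%:R * l) <= `|B| + k%:R * (e / 2).
  move=> ze zB; elim: k => [|k IH].
    by rewrite addn0 !mul0r subr0 addr0 (le_trans zB)// ler_norm.
  have [dd xd] := H z (N + k)%N ze (leq_trans N1N (leq_addr _ _)).
  rewrite addnS xd /=.
  have -> : x (z, N + k)%N + d (z, N + k)%N - k.+1%:R * l =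
     (x (z, N + k)%N - k%:R * l) + (d (z, N + k)%N - l) by rewrite -natr1; ring.
  apply: le_trans (normcD _ _) _; rewrite -[k.+1%:R]natr1; lra.
pose C := `|B| + N%:R * normc l.
have C0 : 0 <= C by rewrite addr_ge0// mulr_ge0 ?ler0n ?normc_ge0.
have [K hK] : exists K : nat, C / (e / 2) < K%:R.
  by exists (Num.bound (C / (e / 2))); apply: archi_boundP; rewrite divr_ge0// ltW.
move/nbhs_normcP : hB => [e2 e20' hB].
apply/locfP; exists (Num.min e1 e2), (N + K).+1%N; split; first by rewrite lt_min e10.
move=> z n; rewrite lt_min => /andP[z1 z2] nK.
have Nn : (N <= n)%N by rewrite ltnW// (leq_ltn_trans (leq_addr K N) nK).
have n_gt0 : (0 < n)%N by exact: leq_ltn_trans (leq0n _) nK.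
have n0 : 0 < n%:R :> R by rewrite ltr0n.
have nC : (n%:R : R[i]) != 0 by rewrite pnatr_eq0 -lt0n.
have -> : x (z, n) / n%:R - l = (x (z, n) - n%:R * l) / n%:R by field.
rewrite normcM normcV normc_nat ltr_pdivrMr//.
have := step z (n - N)%N z1 (hB _ z2); rewrite subnKC// => hs.
have -> : x (z, n) - n%:R * l = (x (z, n) - (n - N)%:R * l) + (- (N%:R * l)).
  by rewrite natrB//; ring.
apply: le_lt_trans (normcD _ _) _; rewrite normc_opp normcM normc_nat.
have : (n - N)%:R <= n%:R :> R by rewrite ler_nat leq_subr.
have : K%:R < n%:R :> R by rewrite ltr_nat (leq_ltn_trans (leq_addl N K) nK).
move: hK; rewrite ltr_pdivrMr// /C; nra.
Unshelve. all: by end_near. Qed.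

(** Cauchy's estimate: a bounded quotient has a bounded derivative nearby. *)
Lemma locf_cauchy z0 (P Q : nat -> {poly R[i]}) (M : R) :
  (\forall p \near locf z0, (Q p.2).[p.1] != 0 /\ normc (quot (P p.2) (Q p.2) p.1) <= M) ->
  exists M' : R, \forall p \near locf z0,
    normc (((P p.2)^`().[p.1] * (Q p.2).[p.1] - (P p.2).[p.1] * (Q p.2)^`().[p.1]) /
      (Q p.2).[p.1] ^+ 2) <= M'.
Proof.
move=> /locfP[e [N [e0 h]]]; exists (2 * M / (e / 4)).
apply/locfP; exists (e / 4), N; split; first by lra.
move=> z n ze Nn /=.
have hz w : normc (w - z) <= e / 4 -> normc (w - z0) < e.
  move=> wz; have -> : w - z0 = (w - z) + (z - z0) by rewrite addrA subrK.
  by apply: le_lt_trans (normcD _ _) _; lra.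
have hQ w (wz : normc (w - z) <= e / 4) : (Q n).[w] != 0.
  exact: (h _ _ (hz _ wz) Nn).1.
have hM w (wz : normc (w - z) <= e / 4) : normc (quot (P n) (Q n) w) <= M.
  exact: (h _ _ (hz _ wz) Nn).2.
have e40 : 0 < e / 4 by lra.
have zz : normc (z - z) <= e / 4 by rewrite subrr normc0 ltW.
have := rshift_bound e40 hQ hM zz.
by rewrite quot_rshift_deriv// hQ.
Qed.

(** Local boundedness makes rational functions equicontinuous, so convergence at
    one point propagates to locally uniform convergence there. *)
Lemma locf_lipschitz z0 (P Q : nat -> {poly R[i]}) (M : R) (l : R[i]) :
  (\forall p \near locf z0, (Q p.2).[p.1] != 0 /\ normc (quot (P p.2) (Q p.2) p.1) <= M) ->
  (fun n => quot (P n) (Q n) z0) @ \oo --> l ->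
  (fun p => quot (P p.2) (Q p.2) p.1) @ locf z0 --> l.
Proof.
move=> /locfP[e [N [e0 h]]] /cvg_normcP hl; apply/cvg_normcP => d d0.
have e20 : 0 < e / 2 by lra.
have d20 : 0 < d / 2 by lra.
have [N' _ hN'] := hl _ d20.
pose K := 2 * `|M| / (e / 2) + 1.
have K0 : 0 < K by rewrite /K ltr_wpDl// divr_ge0 ?mulr_ge0// ltW.
apply/locfP; exists (Num.min (e / 2) (d / 2 / K)), (maxn N N'); split.
  by rewrite lt_min e20 divr_gt0.
move=> z n; rewrite lt_min geq_max => /andP[z1 z2] /andP[n1 n2] /=.
have hQ w : normc (w - z0) <= e / 2 -> (Q n).[w] != 0.
  by move=> we; apply: (h w n _ n1).1; lra.
have hM w : normc (w - z0) <= e / 2 -> normc (quot (P n) (Q n) w) <= `|M|.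
  move=> we; apply: le_trans (ler_norm M); apply: (h w n _ n1).2; lra.
have zz : normc (z0 - z0) <= e / 2 by rewrite subrr normc0 ltW.
rewrite (quot_rshift _ (hQ _ zz) (hQ _ (ltW z1))) addrAC.
apply: le_lt_trans (normcD _ _) _; rewrite normcM.
have h1 : normc (quot (P n) (Q n) z0 - l) < d / 2 by exact: hN'.
have h2 := rshift_bound e20 hQ hM (ltW z1).
have h3 : normc (quot (rshift z0 (Q n) (P n)) (Q n) z) * normc (z - z0) <= d / 2.
  apply: le_trans (ler_wpM2r (normc_ge0 _) h2) _.
  apply: (@le_trans _ _ (K * normc (z - z0))).
    by rewrite ler_wpM2r ?normc_ge0// /K lerDl.
  by rewrite mulrC -ler_pdivlMr// ltW.
by lra.
Qed.

End LocfLimits.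

(** * Ratio asymptotics of the orthonormal polynomials *)

Section RatioAsymptotics.
Context {R : realType}.
Implicit Types (q : nat -> {poly R[i]}) (alpha beta : nat -> R[i]).

(** A compact perturbation of the recurrence of the Chebyshev polynomials. *)
Definition perturbed_chebyshev n0 q alpha beta : Prop :=
  [/\ forall n, (n0 <= n)%N -> size (q n) = n.+1,
      forall n, (n0 < n)%N ->
        'X * q n = alpha n.+1 *: q n.+1 + beta n *: q n + alpha n *: q n.-1,
      forall n, (n0 < n)%N -> alpha n.+1 != 0,
      alpha @ \oo --> (2^-1 : R[i]) & beta @ \oo --> (0 : R[i])].

(** Two consecutive values determine a solution of the recurrence, so this is what
    excludes the recessive solution. *)
Definition no_decay q (z : R[i]) : Prop :=
  exists2 e : R, 0 < e & \forall n \near \oo,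
    e <= normc (q n).[z] + normc (q n.+1).[z].

Lemma cvgS (f : nat -> R[i]) (l : R[i]) : f @ \oo --> l ->
  (fun n => f n.+1) @ \oo --> l.
Proof. by rewrite -(cvg_shiftS f). Qed.

(** For constant coefficients, [q n.+1 - u * q n] and [q n.+1 - phi * q n] are the
    components along the powers of [phi] and of [u].  For the perturbed recurrence
    they satisfy an almost diagonal system.  If the first one never prevailed at
    [z0], both would tend to 0, which [no_decay] excludes; and once it prevails
    at [z0] it does so nearby, and forever. *)
Lemma dominant_component s n0 q alpha beta z0 : is_sqrt_branch s ->
  perturbed_chebyshev n0 q alpha beta -> ~ segment11 z0 -> no_decay q z0 ->
  forall k : R, 0 < k -> \forall p \near locf z0,
    0 < normc ((q p.2.+1).[p.1] - joukowski_inv s z0 * (q p.2).[p.1]) /\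
    normc ((q p.2.+1).[p.1] - inv_joukowski s z0 * (q p.2).[p.1]) <=
    k * normc ((q p.2.+1).[p.1] - joukowski_inv s z0 * (q p.2).[p.1]).
Proof.
move=> sP [_ rec an0 acv bcv] hz [d d0 nd] k k0.
set f := inv_joukowski s z0; set v := joukowski_inv s z0.
have fv : f * v = 1 := phi_mul_u sP hz.
have fDv : f + v = 2 * z0 := phi_add_u s z0.
have l1 : 1 < normc f := normc_phi_gt1 sP hz.
set l := normc f in l1.
have vl : normc v = l^-1.
  by rewrite /v uE// normcV.
have D0 : f - v != 0.
  rewrite subr_eq0; apply: contra_neq (normc_phi_neq sP hz) => h.
  by rewrite -/f -/v h.
have nD : 0 < normc (f - v) by rewrite normc_gt0.
pose a z n := (q n.+1).[z] - v * (q n).[z].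
pose c z n := (q n.+1).[z] - f * (q n).[z].
have q0E z n : (q n).[z] = (a z n - c z n) / (f - v).
  by rewrite /a /c; field.
have q1E z n : (q n.+1).[z] = (f * a z n - v * c z n) / (f - v).
  by rewrite /a /c; field.
pose k1 (p : R[i] * nat) := (p.1 - beta p.2.+1) / alpha p.2.+2 - 2 * z0.
pose k2 (p : R[i] * nat) := 1 - alpha p.2.+1 / alpha p.2.+2.
have half0 : (2^-1 : R[i]) != 0 by rewrite invr_eq0 pnatr_eq0.
have a1 : (fun p : R[i] * nat => alpha p.2.+1) @ locf z0 --> (2^-1 : R[i]).
  exact: (locf_cvg_snd z0 (cvgS acv)).
have a2 : (fun p : R[i] * nat => alpha p.2.+2) @ locf z0 --> (2^-1 : R[i]).
  exact: (locf_cvg_snd z0 (cvgS (cvgS acv))).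
have b1 : (fun p : R[i] * nat => beta p.2.+1) @ locf z0 --> (0 : R[i]).
  exact: (locf_cvg_snd z0 (cvgS bcv)).
have id1 : (fun p : R[i] * nat => p.1) @ locf z0 --> z0.
  exact: (locf_cvg_fst (a := id) cvg_id).
have k1cv : k1 @ locf z0 --> (0 : R[i]).
  have -> : 0 = (z0 - 0) / 2^-1 - 2 * z0 :> R[i] by rewrite invrK subr0 mulrC subrr.
  exact: (cvgB (cvgM (cvgB id1 b1) (cvgV half0 a2)) (cvg_cst _)).
have k2cv : k2 @ locf z0 --> (0 : R[i]).
  have -> : 0 = 1 - 2^-1 / 2^-1 :> R[i] by rewrite divff// subrr.
  exact: (cvgB (cvg_cst _) (cvgM a1 (cvgV half0 a2))).
have step z n : (n0 < n.+1)%N ->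
  (q n.+2).[z] = 2 * z0 * (q n.+1).[z] - (q n).[z] +
    (k1 (z, n) * (q n.+1).[z] + k2 (z, n) * (q n).[z]).
  move=> nn; have := congr1 (horner^~ z) (rec _ nn).
  rewrite /= mulrC hornerMX !hornerD !hornerZ => h.
  have al0 := an0 _ nn.
  apply: (mulfI al0); rewrite /k1 /k2 /=.
  have -> : alpha n.+2 * (q n.+2).[z] =
      (q n.+1).[z] * z - beta n.+1 * (q n.+1).[z] - alpha n.+1 * (q n).[z].
    by rewrite h; ring.
  by field.
have li : l^-1 < 1 by rewrite invf_lt1//; lra.
have li0 : 0 < l^-1 by rewrite invr_gt0; lra.
(* The cone estimate leaves the error [3 * h / (1 - l^-1)], to be at most
   [k / 2]. *)
pose h := (1 - l^-1) * Num.min (k / 2) 1 / 3.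
have m0 : 0 < Num.min (k / 2) 1 by rewrite lt_min ltr01 andbT divr_gt0.
have m1 : Num.min (k / 2) 1 <= 1 by rewrite ge_min lexx orbT.
have m2 : Num.min (k / 2) 1 <= k / 2 by rewrite ge_min lexx.
have h0 : 0 < h by rewrite /h divr_gt0 ?mulr_gt0//; lra.
have h3 : 3 * h = (1 - l^-1) * Num.min (k / 2) 1 by rewrite /h mulrC divfK// pnatr_eq0.
have ll : l * l^-1 = 1 by rewrite divff// gt_eqF//; lra.
have hl' : 3 * h <= 1 - l^-1 by rewrite h3 ger_pMr//; lra.
have hl : 3 * h <= l - 1.
  apply: le_trans hl' _.
  have : 0 <= (l - 1) * (1 - l^-1) by rewrite mulr_ge0//; lra.
  by rewrite mulrBl mulrBr mulr1 mul1r ll; lra.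
have hD : 0 < h * normc (f - v) by exact: mulr_gt0.
have e2' : 0 < h * normc (f - v) / 2 by lra.
have e1' : 0 < h * normc (f - v) / 2 / l by apply: divr_gt0 => //; lra.
have nearh : \forall p \near locf z0,
    (n0 < p.2.+1)%N /\ (l * normc (k1 p) + normc (k2 p)) / normc (f - v) <= h.
  near=> p; split.
    by near: p; apply: (@locf_snd _ z0 (fun n => (n0 < n.+1)%N)); exists n0.
  rewrite ler_pdivrMr//.
  have : normc (k1 p) <= h * normc (f - v) / 2 / l.
    near: p; move/cvg_normcP : k1cv => /(_ _ e1'); apply: filterS => p.
    by rewrite subr0 => /ltW.
  have : normc (k2 p) <= h * normc (f - v) / 2.
    near: p; move/cvg_normcP : k2cv => /(_ _ e2'); apply: filterS => p.
    by rewrite subr0 => /ltW.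
  have l0 : 0 < l by lra.
  by move=> h2; rewrite ler_pdivlMr// => h1; lra.
move/locfP : nearh => [e1 [N [e10 H]]].
have AD z : normc (z - z0) < e1 ->
    almost_diagonal l h N (fun n => normc (a z n)) (fun n => normc (c z n)).
  move=> ze; split; first by split => //; split; [exact: ltW|].
  have err n : (N <= n)%N ->
      normc (k1 (z, n) * (q n.+1).[z] + k2 (z, n) * (q n).[z]) <=
      h * (normc (a z n) + normc (c z n)).
    move=> Nn; have [_ hk] := H z n ze Nn.
    apply: le_trans (_ : (l * normc (k1 (z, n)) + normc (k2 (z, n))) / normc (f - v) *
      (normc (a z n) + normc (c z n)) <= _); last first.
      by rewrite ler_wpM2r// addr_ge0 ?normc_ge0.
    set x := normc (a z n); set y := normc (c z n).
    have x0 : 0 <= x by exact: normc_ge0.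
    have y0 : 0 <= y by exact: normc_ge0.
    have hq1 : normc (q n.+1).[z] <= l * (x + y) / normc (f - v).
      rewrite q1E normcM normcV ler_wpM2r ?invr_ge0 ?normc_ge0//.
      apply: le_trans (normcD _ _) _; rewrite normc_opp !normcM -/x -/y -/l vl.
      have : l^-1 * y <= l * y by rewrite ler_wpM2r//; lra.
      by lra.
    have hq0 : normc (q n).[z] <= (x + y) / normc (f - v).
      rewrite q0E normcM normcV ler_wpM2r ?invr_ge0 ?normc_ge0//.
      by apply: le_trans (normcD _ _) _; rewrite normc_opp.
    apply: le_trans (normcD _ _) _; rewrite !normcM.
    have := ler_wpM2l (normc_ge0 (k1 (z, n))) hq1.
    have := ler_wpM2l (normc_ge0 (k2 (z, n))) hq0.
    by lra.
  have stepD n : (N <= n)%N ->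
      a z n.+1 = f * a z n + (k1 (z, n) * (q n.+1).[z] + k2 (z, n) * (q n).[z]) /\
      c z n.+1 = v * c z n + (k1 (z, n) * (q n.+1).[z] + k2 (z, n) * (q n).[z]).
    move=> Nn; have [nn _] := H z n ze Nn; rewrite /a /c (step z n nn) -fDv.
    by split; [rewrite -[X in _ - X + _]mul1r -fv; ring|
               rewrite -[X in _ - X + _]mul1r -fv; ring].
  split.
  - by move=> n; exact: normc_ge0.
  - by move=> n; exact: normc_ge0.
  - move=> n Nn; have [-> _] := stepD _ Nn; have := err _ Nn.
    set e := _ + _ => he.
    have := normcB (f * a z n) (- e); rewrite normc_opp opprK normcM -/l; lra.
  - move=> n Nn; have [_ ->] := stepD _ Nn; have := err _ Nn.
    set e := _ + _ => he.
    by apply: le_trans (normcD _ _) _; rewrite normcM vl lerD2l.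
have [M [NM CM]] : exists M, (N <= M)%N /\ normc (c z0 M) < 2 * normc (a z0 M).
  apply: contrapT => /forallNP hno.
  have z00 : normc (z0 - z0) < e1 by rewrite subrr normc0.
  have av n : (N <= n)%N -> 2 * normc (a z0 n) <= normc (c z0 n).
    by move=> Nn; rewrite leNgt; apply/negP => ?; apply: (hno n).
  have [ccv0 acv0] := cone_avoiding (AD _ z00) av.
  pose C := (1 + l) / normc (f - v).
  have C0 : 0 < C by rewrite /C divr_gt0//; lra.
  have dC' : 0 < d / C by exact: divr_gt0.
  have dC : 0 < d / C / 2 by lra.
  have [n [h1 h2 h3']] : exists n, [/\ d <= normc (q n).[z0] + normc (q n.+1).[z0],
      normc (a z0 n) < d / C / 2 & normc (c z0 n) < d / C / 2].
    have : \forall n \near \oo, [/\ d <= normc (q n).[z0] + normc (q n.+1).[z0],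
      normc (a z0 n) < d / C / 2 & normc (c z0 n) < d / C / 2].
      near=> n; split; near: n => //.
        move/cvgrPdist_lt : acv0 => /(_ _ dC); apply: filterS => n.
        by rewrite sub0r normrN; apply: le_lt_trans; exact: ler_norm.
      move/cvgrPdist_lt : ccv0 => /(_ _ dC); apply: filterS => n.
      by rewrite sub0r normrN; apply: le_lt_trans; exact: ler_norm.
    by move=> [n _ hn]; exists n; apply: hn => /=.
  have hq1 : normc (q n.+1).[z0] <= l * (normc (a z0 n) + normc (c z0 n)) / normc (f - v).
    rewrite q1E normcM normcV ler_wpM2r ?invr_ge0 ?normc_ge0//.
    apply: le_trans (normcD _ _) _; rewrite normc_opp !normcM -/l vl.
    have : l^-1 * normc (c z0 n) <= l * normc (c z0 n).
      by rewrite ler_wpM2r ?normc_ge0//; lra.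
    by lra.
  have hq0 : normc (q n).[z0] <= (normc (a z0 n) + normc (c z0 n)) / normc (f - v).
    rewrite q0E normcM normcV ler_wpM2r ?invr_ge0 ?normc_ge0//.
    by apply: le_trans (normcD _ _) _; rewrite normc_opp.
  have h4 : d <= C * (normc (a z0 n) + normc (c z0 n)).
    apply: le_trans h1 _; apply: le_trans (lerD hq0 hq1) _.
    by rewrite /C; lra.
  have h5 : normc (a z0 n) + normc (c z0 n) < d / C by lra.
  by move: h5; rewrite ltr_pdivlMr// mulrC; lra.
have hcont (w : R[i]) n : continuous (fun z => normc ((q n.+1).[z] - w * (q n).[z])).
  have -> : (fun z => normc ((q n.+1).[z] - w * (q n).[z])) =
      (fun z => normc (q n.+1 - w *: q n).[z]).
    by apply/funext => z; rewrite hornerD hornerN hornerZ.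
  exact: horner_normc_continuous.
have : \forall z \near z0, normc (c z M) < 2 * normc (a z M).
  have : (fun z => 2 * normc (a z M) - normc (c z M)) @ z0 -->
      2 * normc (a z0 M) - normc (c z0 M).
    by apply: cvgB; [apply: cvgM; [exact: cvg_cst|exact: hcont]|exact: hcont].
  have hpos : 0 < 2 * normc (a z0 M) - normc (c z0 M) by lra.
  move=> /cvgrPdist_lt/(_ _ hpos); apply: filterS => z.
  by rewrite ltr_norml => /andP[_]; lra.
move=> /nbhs_normcP[e2 e20 H2].
have [K hK] : exists K, forall j, (K <= j)%N -> 2 * l^-1 ^+ j <= k / 2.
  have k4 : 0 < k / 4 by lra.
  have : (fun j => l^-1 ^+ j) @ \oo --> (0 : R) by apply: cvg_expr; rewrite gtr0_norm.
  move=> /cvgrPdist_lt/(_ _ k4)[K _ hK]; exists K => j /hK /=.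
  by rewrite sub0r normrN => /(le_lt_trans (ler_norm _)); lra.
apply/locfP; exists (Num.min e1 e2), (M + K)%N; split; first by rewrite lt_min e10.
move=> z n; rewrite lt_min => /andP[z1 z2] Kn /=.
have Mn : (M <= n)%N by rewrite (leq_trans _ Kn) ?leq_addr.
have [] := cone_invariant (AD _ z1) NM (H2 _ z2) (n - M)%N.
rewrite subnKC// => A0 _ CA; split => //.
apply: le_trans CA _; rewrite ler_wpM2r ?normc_ge0//.
have := hK (n - M)%N; rewrite leq_subRL// => /(_ Kn).
have -> : 3 * h / (1 - l^-1) = Num.min (k / 2) 1.
  by rewrite h3 mulrAC divff ?mul1r// gt_eqF//; lra.
by lra.
Unshelve. all: by end_near. Qed.

(** The component along the powers of [u] is negligible. *)
Lemma ratio_asymptotics s n0 q alpha beta z0 : is_sqrt_branch s ->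
  perturbed_chebyshev n0 q alpha beta -> ~ segment11 z0 -> no_decay q z0 ->
  (\forall p \near locf z0, (q p.2).[p.1] != 0) /\
  (fun p => (q p.2.+1).[p.1] / (q p.2).[p.1]) @ locf z0 --> inv_joukowski s z0.
Proof.
move=> sP qP hz nd; set f := inv_joukowski s z0; set v := joukowski_inv s z0.
have D0 : f - v != 0.
  rewrite subr_eq0; apply: contra_neq (normc_phi_neq sP hz) => h.
  by rewrite -/f -/v h.
have nD : 0 < normc (f - v) by rewrite normc_gt0.
have key k : 0 < k -> k <= 1 / 2 -> \forall p \near locf z0, (q p.2).[p.1] != 0 /\
    normc ((q p.2.+1).[p.1] / (q p.2).[p.1] - f) <= 2 * k * normc (f - v).
  move=> k0 k2; have := dominant_component sP qP hz nd k0.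
  rewrite -/f -/v; apply: filterS => -[z n] /=.
  set a := _ - v * _; set c := _ - f * _ => -[a0 ca].
  have qE : (q n).[z] * (f - v) = a - c by rewrite /a /c; ring.
  have hac : normc a / 2 <= normc (a - c).
    have := normcB a c; have : k * normc a <= 1 / 2 * normc a by rewrite ler_wpM2r// ltW.
    by lra.
  have q0 : (q n).[z] != 0.
    apply: contraTneq a0 => q0; move: hac; rewrite -qE q0 mul0r normc0.
    by rewrite -leNgt; lra.
  split => //.
  have -> : (q n.+1).[z] / (q n).[z] - f = c / (q n).[z] by rewrite /c; field.
  rewrite normcM normcV ler_pdivrMr ?normc_gt0//.
  have : normc (q n).[z] * normc (f - v) = normc (a - c) by rewrite -normcM qE.
  move=> h; apply: le_trans ca _.
  have -> : 2 * k * normc (f - v) * normc (q n).[z] = 2 * k * normc (a - c).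
    by rewrite -h; ring.
  by have := ler_wpM2l (ltW k0) hac; lra.
have h2 : 0 < 1 / 2 :> R by lra.
split; first by apply: filterS (key _ h2 (lexx _)) => p [].
apply/cvg_normcP => e e0.
pose k := Num.min (1 / 2) (e / (4 * normc (f - v))).
have k0 : 0 < k by rewrite /k lt_min !divr_gt0// mulr_gt0.
have k1 : k <= 1 / 2 by rewrite /k ge_min lexx.
have k2 : k <= e / (4 * normc (f - v)) by rewrite /k ge_min lexx orbT.
apply: filterS (key k k0 k1) => p [_]; move/le_lt_trans; apply.
by move: k2; rewrite ler_pdivlMr ?mulr_gt0//; lra.
Qed.

End RatioAsymptotics.

(** * Logarithmic derivatives of the orthonormal polynomials *)

Section DerivativeAsymptotics.
Context {R : realType}.
Implicit Types (alpha beta : nat -> R[i]).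

Lemma cvg_harmonicC : (fun n : nat => (n%:R : R[i])^-1) @ \oo --> (0 : R[i]).
Proof.
apply/cvg_normcP => e e0.
exists (Num.bound e^-1).+1 => // n /= hn; rewrite subr0 normcV normc_nat.
have : e^-1 < n%:R.
  apply: lt_trans (archi_boundP _) _; first by rewrite invr_ge0 ltW.
  by rewrite ltr_nat.
move=> h; rewrite -[e]invrK ltf_pV2// posrE ?invr_gt0//.
by apply: lt_trans h; rewrite invr_gt0.
Qed.

Lemma locf_bounded_div z0 (E : R[i] * nat -> R[i]) (M : R) :
  (\forall p \near locf z0, normc (E p) <= M) ->
  (fun p => E p / p.2%:R) @ locf z0 --> (0 : R[i]).
Proof.
move=> EM; apply/cvg_normcP => e e0.
have M1 : 0 < `|M| + 1 by have := normr_ge0 M; lra.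
have e1 : 0 < e / (`|M| + 1) by exact: divr_gt0.
have /cvg_normcP/(_ _ e1) := locf_cvg_snd z0 cvg_harmonicC.
apply: filterS2 EM => p EM; rewrite !subr0 normcM => h.
apply: (@le_lt_trans _ _ (`|M| * normc (p.2%:R^-1))).
  by rewrite ler_wpM2r ?normc_ge0// (le_trans EM)// ler_norm.
move: h; rewrite ltr_pdivlMr// mulrC; apply: le_lt_trans.
by rewrite ler_wpM2r ?normc_ge0// lerDl.
Qed.

Section AtPoint.
Variables (s : R[i] -> R[i]) (n0 : nat) (q : nat -> {poly R[i]}).
Variables (alpha beta : nat -> R[i]) (z0 : R[i]).
Hypothesis sP : is_sqrt_branch s.
Hypothesis qP : perturbed_chebyshev n0 q alpha beta.
Hypothesis hz : ~ segment11 z0.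
Hypothesis nd : no_decay q z0.

Let phi := inv_joukowski s z0.
Let hq0 := (ratio_asymptotics sP qP hz nd).1.
Let hr : (fun p => (q p.2.+1).[p.1] / (q p.2).[p.1]) @ locf z0 --> phi
  := (ratio_asymptotics sP qP hz nd).2.
Let phi0 : phi != 0 := phi_neq0 sP hz.

Lemma log_deriv_bounded : \forall n \near \oo, exists B : R, \forall z \near z0,
  normc ((q n)^`().[z] / (q n).[z]) <= B.
Proof.
have := locf_at hq0; apply: filterS => n /= qn.
have := quot_continuous (P := (q n)^`()) qn.
move=> /cvg_normcP/(_ 1 ltr01) h.
exists (normc (quot (q n)^`() (q n) z0) + 1); apply: filterS h => z.
rewrite /quot => h; have := normcB ((q n)^`().[z] / (q n).[z])
  ((q n)^`().[z0] / (q n).[z0]).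
by move=> h2; rewrite -lerBlDl (le_trans h2)// ltW.
Qed.

(** Differentiating the recurrence shows that the increments of the logarithmic
    derivative obey a linear recurrence contracting by the factor [phi ^- 2]. *)
Lemma log_deriv_increment :
  (fun p => (q p.2.+1)^`().[p.1] / (q p.2.+1).[p.1] -
    (q p.2)^`().[p.1] / (q p.2).[p.1]) @ locf z0 --> (s z0)^-1.
Proof.
have [_ rec an0 acv _] := qP.
have phi1 := normc_phi_gt1 sP hz.
pose r p := (q p.2.+1).[p.1] / (q p.2).[p.1].
have half0 : (2^-1 : R[i]) != 0 by rewrite invr_eq0 pnatr_eq0.
have a1 : (fun p : R[i] * nat => alpha p.2.+1) @ locf z0 --> (2^-1 : R[i]).
  exact: (locf_cvg_snd z0 (cvgS acv)).
have a2 : (fun p : R[i] * nat => alpha p.2.+2) @ locf z0 --> (2^-1 : R[i]).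
  exact: (locf_cvg_snd z0 (cvgS (cvgS acv))).
have r1 : (fun p => r (p.1, p.2.+1)) @ locf z0 --> phi by exact: locf_cvg_shift hr.
pose g (p : R[i] * nat) := (alpha p.2.+2 * r (p.1, p.2.+1))^-1.
pose t (p : R[i] * nat) := alpha p.2.+1 / (alpha p.2.+2 * (r (p.1, p.2.+1) * r p)).
have gcv : g @ locf z0 --> (2^-1 * phi)^-1.
  apply: cvgV; first by rewrite mulf_neq0.
  exact: cvgM a2 r1.
have tcv : t @ locf z0 --> 2^-1 / (2^-1 * (phi * phi)).
  apply: cvgM; first exact: a1.
  apply: cvgV; first by rewrite !mulf_neq0.
  exact: cvgM a2 (cvgM r1 hr).
have sz : s z0 != 0 := branch_neq0 sP hz.
have pu : phi - phi^-1 = 2 * s z0 by rewrite -phi_sub_u uE.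
have p20 : phi * phi - 1 != 0.
  have -> : phi * phi - 1 = phi * (phi - phi^-1) by field.
  by rewrite pu !mulf_neq0// pnatr_eq0.
have -> : (s z0)^-1 = (2^-1 * phi)^-1 / (1 - 2^-1 / (2^-1 * (phi * phi))).
  have -> : s z0 = (phi - phi^-1) / 2 by rewrite pu mulrC mulKf// pnatr_eq0.
  have pp : phi ^+ 2 - 1 != 0 by rewrite expr2.
  by field; rewrite phi0.
apply: (locf_contraction _ gcv tcv).
- have -> : 2^-1 / (2^-1 * (phi * phi)) = phi^-1 * phi^-1 by field.
  rewrite normcM normcV -invfM invf_lt1 ?mulr_gt0; try by lra.
  by nra.
- have hq1 := locf_shift hq0; have hq2 := locf_shift hq1.
  near=> p.
  have Q0 : (q p.2).[p.1] != 0 by near: p.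
  have Q1 : (q p.2.+1).[p.1] != 0 by near: p; exact: hq1.
  have Q2 : (q p.2.+2).[p.1] != 0 by near: p; exact: hq2.
  have nn : (n0 < p.2.+1)%N.
    by near: p; apply: (@locf_snd _ z0 (fun n => (n0 < n.+1)%N)); exists n0.
  have := rec _ nn => /= E.
  have := congr1 (horner^~ p.1) E; have := congr1 (fun P : {poly R[i]} => P^`().[p.1]) E.
  have al0 := an0 _ nn.
  rewrite /= derivM derivX !derivD !derivZ !hornerD !hornerZ !hornerM hornerX hornerC mul1r.
  rewrite /g /t /r /=.
  move: Q0 Q1 Q2 al0; set Q0 := (q p.2).[_]; set Q1 := (q p.2.+1).[_].
  set Q2 := (q p.2.+2).[_]; set D0 := (q p.2)^`().[_]; set D1 := (q p.2.+1)^`().[_].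
  set D2 := (q p.2.+2)^`().[_]; set A := alpha p.2.+2 => hQ0 hQ1 hQ2 hA h1 h2.
  have D2E : D2 = (Q1 + p.1 * D1 - beta p.2.+1 * D1 - alpha p.2.+1 * D0) / A.
    by apply: (mulIf hA); rewrite divfK// h1; ring.
  have z1 : p.1 = (A * Q2 + beta p.2.+1 * Q1 + alpha p.2.+1 * Q0) / Q1.
    by rewrite -h2 mulfK.
  by rewrite D2E z1; field; rewrite hQ0 hQ1 hQ2 hA.
have h2 : \forall n \near \oo, exists B : R, \forall z \near z0,
    normc ((q n.+1)^`().[z] / (q n.+1).[z]) <= B.
  by case: log_deriv_bounded => N _ h; exists N => // n Nn; apply: h; exact: leqW.
apply: filterS2 log_deriv_bounded h2 => n [B1 h1] [B2 h2]; exists (B2 + B1).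
apply: filterS2 h1 h2 => z h1 h2; apply: le_trans (normcD _ _) _.
by rewrite normc_opp lerD.
Unshelve. all: by end_near. Qed.

Lemma log_deriv_cvg :
  (fun p => (q p.2)^`().[p.1] / (q p.2).[p.1] / p.2%:R) @ locf z0 --> (s z0)^-1.
Proof.
apply: (@locf_cesaro _ _ (fun p => (q p.2)^`().[p.1] / (q p.2).[p.1])).
- exact: log_deriv_increment.
- by apply: nearW => p /=; rewrite addrC subrK.
- exact: log_deriv_bounded.
Qed.

(** Passing from [nu] to [nu.+1] adds the logarithmic derivative of a convergent
    quotient, which is bounded, divided by [n]. *)
Lemma derivn_ratio nu :
  (\forall p \near locf z0, (q p.2)^`(nu).[p.1] != 0) /\
  (fun p => (q p.2)^`(nu.+1).[p.1] / (p.2%:R * (q p.2)^`(nu).[p.1])) @ locf z0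
    --> (s z0)^-1.
Proof.
have sz : (s z0)^-1 != 0 by rewrite invr_eq0 (branch_neq0 sP hz).
have n_neq0 : \forall p \near locf z0, (p.2%:R : R[i]) != 0.
  apply: (@locf_snd _ z0 (fun n => (n%:R : R[i]) != 0)).
  by exists 1%N => // n /= n1; rewrite pnatr_eq0 -lt0n.
elim: nu => [|nu [IH1 IH2]].
  split; first exact: hq0.
  apply: cvg_trans log_deriv_cvg; apply: near_eq_cvg.
  apply: filterS2 hq0 n_neq0 => p Q0 n_0; rewrite derivn1 derivn0.
  by field; rewrite Q0.
have IH1' : \forall p \near locf z0, (q p.2)^`(nu.+1).[p.1] != 0.
  apply: filterS (locf_cvg_neq0 IH2 sz) => p; apply: contraNneq => ->.
  by rewrite mul0r.
split; first exact: IH1'.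
pose P n := (q n)^`(nu.+1); pose Q n := (n%:R : R[i]) *: (q n)^`(nu).
have [M hM] : exists M' : R, \forall p \near locf z0,
    normc (((P p.2)^`().[p.1] * (Q p.2).[p.1] - (P p.2).[p.1] * (Q p.2)^`().[p.1]) /
      (Q p.2).[p.1] ^+ 2) <= M'.
  apply: (@locf_cauchy _ _ _ _ (normc (s z0)^-1 + 1)).
  apply: filterS3 n_neq0 IH1 (locf_cvg_bounded IH2) => p n_0 A0 hb.
  by rewrite /quot /Q hornerZ mulf_neq0.
pose E (p : R[i] * nat) := ((P p.2)^`().[p.1] * (Q p.2).[p.1] -
  (P p.2).[p.1] * (Q p.2)^`().[p.1]) / (Q p.2).[p.1] ^+ 2.
pose l (p : R[i] * nat) :=
  (q p.2)^`(nu.+1).[p.1] / (p.2%:R * (q p.2)^`(nu).[p.1]).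
have h : (fun p => l p + E p / p.2%:R / l p) @ locf z0 -->
    (s z0)^-1 + 0 / (s z0)^-1.
  exact: (cvgD IH2 (cvgM (locf_bounded_div hM) (cvgV sz IH2))).
rewrite mul0r addr0 in h.
apply: cvg_trans h; apply: near_eq_cvg.
apply: filterS3 n_neq0 IH1 IH1' => p n_0 A0 A1.
rewrite /l /E /P /Q !derivZ !hornerZ -!derivnS.
by field; rewrite n_0 A0 A1.
Qed.

(** The quotient of two consecutive terms tends to [1 / phi], which has modulus below
    1. *)
Lemma power_over_q k :
  (fun p => (p.2%:R : R[i]) ^+ k / (q p.2).[p.1]) @ locf z0 --> (0 : R[i]).
Proof.
have phi1 := normc_phi_gt1 sP hz.
have hn : (fun n : nat => (n.+1%:R : R[i]) / n%:R) @ \oo --> (1 : R[i]).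
  have : (fun n : nat => 1 + (n%:R : R[i])^-1) @ \oo --> 1 + (0 : R[i]).
    exact: (cvgD (cvg_cst _) cvg_harmonicC).
  rewrite addr0 => h; apply: cvg_trans h; apply: near_eq_cvg.
  exists 1%N => // n /= n1; have n_0 : (n%:R : R[i]) != 0 by rewrite pnatr_eq0 -lt0n.
  by rewrite -natr1; field.
have hnk : (fun n : nat => ((n.+1%:R : R[i]) / n%:R) ^+ k) @ \oo --> (1 : R[i]).
  elim: k => [|k IH]; first exact: cvg_cst.
  have -> : (fun n : nat => ((n.+1%:R : R[i]) / n%:R) ^+ k.+1) =
      (fun n : nat => (n.+1%:R : R[i]) / n%:R * (n.+1%:R / n%:R) ^+ k).
    by apply/funext => n; rewrite exprS.
  have h : (fun n : nat => (n.+1%:R : R[i]) / n%:R * (n.+1%:R / n%:R) ^+ k) @ \oo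
      --> (1 * 1 : R[i]) by exact: (cvgM hn IH).
  by rewrite mulr1 in h.
have tcv : (fun p => ((p.2.+1%:R : R[i]) / p.2%:R) ^+ k *
    ((q p.2.+1).[p.1] / (q p.2).[p.1])^-1) @ locf z0 --> 1 * phi^-1.
  exact: (cvgM (locf_cvg_snd z0 hnk) (cvgV phi0 hr)).
have -> : 0 = 0 / (1 - 1 * phi^-1) :> R[i] by rewrite mul0r.
apply: (locf_contraction _ (g := fun=> 0) _ tcv).
- by rewrite mul1r normcV invf_lt1//; lra.
- exact: cvg_cst.
- have n_neq0 : \forall p \near locf z0, (p.2%:R : R[i]) != 0.
    apply: (@locf_snd _ z0 (fun n => (n%:R : R[i]) != 0)).
    by exists 1%N => // n /= n1; rewrite pnatr_eq0 -lt0n.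
  apply: filterS3 n_neq0 hq0 (locf_shift hq0) => p /= n_0 Q0 Q1.
  by rewrite add0r exprMn exprVn; field; rewrite Q0 Q1 expf_neq0.
have := locf_at hq0; apply: filterS => n /= qn.
have := quot_continuous (P := ((n%:R : R[i]) ^+ k)%:P) qn.
move=> /cvg_normcP/(_ 1 ltr01) h.
exists (normc (quot ((n%:R : R[i]) ^+ k)%:P (q n) z0) + 1); apply: filterS h => z.
rewrite /quot !hornerC => h; have := normcB ((n%:R : R[i]) ^+ k / (q n).[z])
  ((n%:R : R[i]) ^+ k / (q n).[z0]).
by move=> h2; rewrite -lerBlDl (le_trans h2)// ltW.
Qed.

End AtPoint.
End DerivativeAsymptotics.

(** * Taylor jets of quotients, and the Sobolev polynomials in terms of the kernel *)

Section Jets.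
Context {R : realType}.
Implicit Types (P Q S : {poly R[i]}) (c z : R[i]).

Definition taylor_coef c P k : R[i] := (P \Po ('X + c%:P))`_k.

Lemma derivn_horner c P k : P^`(k).[c] = k`!%:R * taylor_coef c P k.
Proof.
have E : (P \Po ('X + c%:P))^`(k) = P^`(k) \Po ('X + c%:P).
  elim: k => [|k IH]; first by rewrite !derivn0.
  by rewrite !derivnS IH deriv_comp derivD derivX derivC addr0 mulr1.
have := congr1 (horner^~ 0) E.
rewrite /= horner_comp hornerD hornerX hornerC add0r => <-.
by rewrite horner_coef0 coef_derivn addn0 ffactnn mulr_natl.
Qed.

Lemma taylor_coef0 c P : taylor_coef c P 0 = P.[c].
Proof. by have := derivn_horner c P 0; rewrite derivn0 fact0 mul1r. Qed.

(** The numerator, over [Q], of the remainder of order [s] in the Taylor expansion of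
    [P / Q] at [c]; its value at [c] is the next Taylor coefficient [jet]. *)
Definition jetnum c Q P s : {poly R[i]} := iter s (rshift c Q) P.
Definition jet c Q P s : R[i] := quot (jetnum c Q P s) Q c.

Lemma jetnum_expansion c Q P s : Q.[c] != 0 ->
  P = Q * (\sum_(r < s) jet c Q P r *: ('X - c%:P) ^+ r) +
      jetnum c Q P s * ('X - c%:P) ^+ s.
Proof.
move=> Qc; elim: s => [|s IH].
  by rewrite big_ord0 mulr0 add0r expr0 mulr1.
rewrite {1}IH big_ord_recr /= mulrDr -addrA; congr (_ + _).
rewrite {1}(rshiftE (jetnum c Q P s) Qc) -/(jet c Q P s) mulrDl exprS mulrA.
by rewrite -scalerAl -scalerAr.
Qed.

Lemma taylor_coefM_jet c Q P k : Q.[c] != 0 ->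
  taylor_coef c P k = \sum_(s < k.+1) taylor_coef c Q (k - s) * jet c Q P s.
Proof.
move=> Qc; rewrite /taylor_coef {1}(jetnum_expansion P k.+1 Qc).
have XE r : (('X - c%:P) ^+ r) \Po ('X + c%:P) = 'X^r.
  by rewrite rmorphXn /= comp_polyB comp_polyX comp_polyC addrK.
rewrite comp_polyD !comp_polyM XE coefD coefMXn ltnSn addr0.
rewrite linear_sum /= coefMr; apply: eq_bigr => s _; congr (_ * _).
under eq_bigr do rewrite linearZ /= XE.
by rewrite -poly_def coef_poly ltn_ord.
Qed.

Lemma jet0 c Q P : jet c Q P 0 = quot P Q c. Proof. by []. Qed.

Lemma quot_jetnumS c Q P s z : Q.[c] != 0 -> Q.[z] != 0 ->
  quot (jetnum c Q P s) Q z =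
  jet c Q P s + quot (jetnum c Q P s.+1) Q z * (z - c).
Proof. by move=> Qc Qz; rewrite {1}(quot_rshift _ Qc Qz). Qed.

(** The kernel divided by [q_n(z)] is, in its free variable, the generating
    function of the remainders at [z] of the Taylor expansion of [P / Q]. *)
Lemma taylor_coef_kernel c z Q P K (a : R[i]) k : Q.[c] != 0 -> Q.[z] != 0 -> z != c ->
  K * ('X - z%:P) = a *: (P.[z] *: Q - Q.[z] *: P) ->
  taylor_coef c K k = - (a * Q.[z]) *
    \sum_(s < k.+1) taylor_coef c Q (k - s) * quot (jetnum c Q P s.+1) Q z.
Proof.
move=> Qc Qz zc KE.
pose T j := - (a * Q.[z]) *
    \sum_(s < j.+1) taylor_coef c Q (j - s) * quot (jetnum c Q P s.+1) Q z.
have rec j : taylor_coef c K j * (c - z) =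
    a * Q.[z] * (quot P Q z * taylor_coef c Q j - taylor_coef c P j) -
    (if j is j'.+1 then taylor_coef c K j' else 0).
  have := congr1 (fun S => (S \Po ('X + c%:P))`_j) KE.
  rewrite /= comp_polyM comp_polyB comp_polyX comp_polyC -addrA -polyCB.
  rewrite mulrDr coefD coefMX coefMC comp_polyZ comp_polyB !comp_polyZ.
  rewrite coefZ coefB !coefZ -/(taylor_coef c Q j) -/(taylor_coef c P j).
  rewrite -/(taylor_coef c K j) => h.
  have -> : a * Q.[z] * (quot P Q z * taylor_coef c Q j - taylor_coef c P j) =
     a * (P.[z] * taylor_coef c Q j - Q.[z] * taylor_coef c P j).
    by rewrite /quot; field.
  rewrite -h /taylor_coef; case: (j) => [|j'] /=. by ring.
  by ring.
have recT j : T j * (c - z) =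
    a * Q.[z] * (quot P Q z * taylor_coef c Q j - taylor_coef c P j) -
    (if j is j'.+1 then T j' else 0).
  have -> : T j * (c - z) = a * Q.[z] *
      \sum_(s < j.+1) taylor_coef c Q (j - s) * (quot (jetnum c Q P s) Q z - jet c Q P s).
    rewrite /T mulNr mulNr -mulrN opprB -mulrA mulr_suml; congr (_ * _).
    apply: eq_bigr => s _; rewrite -mulrA; congr (_ * _).
    by rewrite (quot_jetnumS P s Qc Qz); ring.
  have -> : \sum_(s < j.+1) taylor_coef c Q (j - s) *
       (quot (jetnum c Q P s) Q z - jet c Q P s) =
     \sum_(s < j.+1) taylor_coef c Q (j - s) * quot (jetnum c Q P s) Q z -
     taylor_coef c P j.
    rewrite (taylor_coefM_jet P j Qc) -sumrB; apply: eq_bigr => s _; exact: mulrBr.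
  rewrite big_ord_recl subn0 /= {1}/jetnum /=.
  case: j => [|j]; first by rewrite big_ord0 addr0 subr0 mulrC [_ * taylor_coef _ _ _]mulrC mulrC.
  by rewrite /T /bump /=; under eq_bigr do rewrite add1n subSS; ring.
have cz : c - z != 0 by rewrite subr_eq0 eq_sym.
elim: k => [|k IH]; apply: (mulIf cz); rewrite -/(T _) rec recT//.
by rewrite IH.
Qed.

Lemma poly_eq_cofinite P Q S : S != 0 ->
  (forall z, S.[z] != 0 -> P.[z] = Q.[z]) -> P = Q.
Proof.
move=> S0 PQ; apply/eqP; rewrite -subr_eq0; apply/negPn/negP => D0.
have D1 : (P - Q) * S != 0 by rewrite mulf_neq0.
have [C C0 [T T1 hT]] := poly_lower_growth D1.
have T0 : 0 <= T by lra.
have := hT T%:C; rewrite normc_real ger0_norm// => /(_ (lexx _)).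
have -> : ((P - Q) * S).[T%:C] = 0.
  rewrite hornerM hornerD hornerN; have [->|/PQ ->] := eqVneq S.[T%:C] 0.
    by rewrite mulr0.
  by rewrite subrr mul0r.
rewrite normc0 leNgt; apply/negP; rewrite negbK mulr_gt0// exprn_gt0//; lra.
Qed.

End Jets.

Section SobolevRepresentation.
Context {R : realType}.
Variables (mu : complex_measure R) (n0 : nat) (q : nat -> {poly R[i]}).
Variables (alpha beta : nat -> R[i]).
Hypothesis cS : compact (supp mu).
Hypothesis size_q : forall n, (n0 <= n)%N -> size (q n) = n.+1.
Hypothesis orth_q : forall n (p : {poly R[i]}), (n0 <= n)%N -> (size p <= n)%N ->
  intp mu (p * q n) = 0.
Hypothesis norm_q : forall n, (n0 <= n)%N -> intp mu (q n * q n) = 1.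
Hypothesis rec_q : forall n, (n0 < n)%N ->
  'X * q n = alpha n.+1 *: q n.+1 + beta n *: q n + alpha n *: q n.-1.
Variables (m : nat) (c : 'I_m -> R[i]) (N : 'I_m -> nat).
Variable L : forall j : 'I_m, 'I_(N j).+1 -> {poly R[i]}.

Definition sobolev_data (S : {poly R[i]}) (j : 'I_m) (i : 'I_(N j).+1) : R[i] :=
  (diffop (L i) S).[c j].

(** The coefficient which the data of [S] at [c j] give to the remainder of order
    [s.+1] when the kernel is expanded. *)
Definition sobolev_weight n (S : {poly R[i]}) (j : 'I_m) (s : nat) : R[i] :=
  alpha n.+1 * \sum_(i < (N j).+1)
    (if (s <= i)%N then
       sobolev_data S i * i`!%:R * taylor_coef (c j) (q n.+1) (i - s) else 0).

Lemma size_cd_kernel n z : (n0 <= n)%N -> (size (cd_kernel q alpha n z) <= n.+1)%N.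
Proof.
move=> nn; rewrite /cd_kernel (leq_trans (size_scale_leq _ _))//.
rewrite size_divp ?polyXsubC_eq0// size_XsubC /= leq_subLR add1n.
rewrite (leq_trans (size_polyD _ _))// size_polyN geq_max.
by rewrite !(leq_trans (size_scale_leq _ _)) ?size_q// ltnW.
Qed.

(** Testing the orthogonality of [S] against the kernel expresses [S] through its
    data at the points [c j]; the kernel is then expanded at each of them. *)
Lemma sobolev_representation n (S : {poly R[i]}) : (n0 < n)%N ->
  (forall j, (q n.+1).[c j] != 0) -> (size S <= n.+2)%N ->
  orthogonal_poly (sobolev_form mu c L) n.+1 S ->
  S = (S`_n.+1 / lead_coef (q n.+1)) *: q n.+1 +
    \sum_(j < m) \sum_(s < (N j).+1)
      sobolev_weight n S j s *: jetnum (c j) (q n.+1) (q n) s.+1.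
Proof.
move=> nn qc sS oS; set lam := S`_n.+1 / _.
have n0n1 : (n0 <= n.+1)%N by exact/leqW/ltnW.
apply: (@poly_eq_cofinite _ _ _ (q n.+1 * \prod_(j < m) ('X - (c j)%:P))).
  rewrite mulf_neq0//; first by rewrite -size_poly_eq0 size_q.
  by apply/prodf_neq0 => j _; rewrite polyXsubC_eq0.
move=> z; rewrite hornerM horner_prod mulf_eq0 negb_or => /andP[qz /prodf_neq0 zc].
have {}zc j : z != c j.
  by have := zc j isT; rewrite hornerXsubC subr_eq0.
set K := cd_kernel q alpha n z.
have sK : (size K <= n.+1)%N by apply: size_cd_kernel; exact: ltnW.
have ID p r : intp mu (p + r) = intp mu p + intp mu r by exact: intpD.
have IZ a p : intp mu (a *: p) = a * intp mu p by exact: intpZ.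
have hS1 : S.[z] - lam * (q n.+1).[z] = intp mu (K * S).
  have -> : S.[z] - lam * (q n.+1).[z] = (S - lam *: q n.+1).[z].
    by rewrite hornerD hornerN hornerZ.
  rewrite -(I_cd_kernel ID IZ size_q orth_q norm_q rec_q z nn); last first.
    exact: size_sub_lead (size_q n0n1) sS.
  rewrite mulrBr ID -scaleN1r IZ -scalerAr IZ orth_q// !mulr0 addr0//.
have := oS K sK; rewrite /sobolev_form integral_formE -hS1 => /eqP.
rewrite addrAC subr_eq0 => /eqP SE.
have {}SE : S.[z] = lam * (q n.+1).[z] -
    \sum_(j < m) \sum_(i < (N j).+1) K^`(i).[c j] * (diffop (L i) S).[c j].
  by rewrite -SE addrK.
rewrite SE hornerD hornerZ; congr (_ + _).
rewrite horner_sum -sumrN; apply: eq_bigr => j _.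
rewrite horner_sum -sumrN.
have KE i : taylor_coef (c j) K i = - (alpha n.+1 * (q n.+1).[z]) *
    \sum_(s < i.+1) taylor_coef (c j) (q n.+1) (i - s) *
       quot (jetnum (c j) (q n.+1) (q n) s.+1) (q n.+1) z.
  by apply: taylor_coef_kernel => //; exact: cd_kernelE.
have jE s : (jetnum (c j) (q n.+1) (q n) s).[z] =
    quot (jetnum (c j) (q n.+1) (q n) s) (q n.+1) z * (q n.+1).[z].
  by rewrite /quot divfK.
rewrite /sobolev_weight; under [RHS]eq_bigr do rewrite hornerZ jE mulr_sumr mulr_suml.
rewrite exchange_big /=; apply: eq_bigr => i _.
rewrite derivn_horner KE -/(sobolev_data S i).
rewrite (big_ord_widen_cond _ xpredT (fun s => taylor_coef (c j) (q n.+1) (i - s) *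
       quot (jetnum (c j) (q n.+1) (q n) s.+1) (q n.+1) z) (ltn_ord i)) big_mkcond /=.
rewrite !mulr_sumr mulr_suml -sumrN; apply: eq_bigr => s _.
rewrite ltnS; case: ifP => _; last by rewrite !(mulr0, mul0r) oppr0.
by ring.
Qed.

End SobolevRepresentation.

(** * Domination between weights and jets at one node *)

Section FallingFactorialMatrix.
Context {R : realType}.

Lemma ffact_poly_eval n k :
  (\prod_(j < n) ('X - (j%:R : R[i])%:P)).[k%:R] = (k ^_ n)%:R.
Proof.
elim: n => [|n IH]; first by rewrite big_ord0 hornerC ffactn0.
rewrite big_ord_recr /= hornerM IH hornerXsubC ffactnSr natrM.
have [nk|kn] := leqP n k; first by rewrite natrB.
by rewrite ffact_small// !mul0r.
Qed.

(** A combination of falling factorials of order below [p] is a polynomial of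
    degree below [p]; it cannot vanish at [p] distinct integers. *)
Lemma ffact_kernel p (f : 'I_p -> nat) (x : 'I_p -> R[i]) : injective f ->
  (forall i, \sum_(s < p) (f i ^_ s)%:R * x s = 0) -> forall s, x s = 0.
Proof.
move=> finj fx.
pose P := \sum_(s < p) x s *: \prod_(j < s) ('X - (j%:R : R[i])%:P).
have Pf k : P.[k%:R] = \sum_(s < p) (k ^_ s)%:R * x s.
  rewrite horner_sum; apply: eq_bigr => s _.
  by rewrite hornerZ ffact_poly_eval mulrC.
have sP : (size P <= p)%N.
  rewrite (leq_trans (size_sum _ _ _))//; apply/bigmax_leqP => s _.
  rewrite (leq_trans (size_scale_leq _ _))// size_prod_XsubC.
  by rewrite /index_enum -enumT size_enum_ord.
have P0 : P = 0.
  apply: (roots_geq_poly_eq0 (rs := [seq ((f i)%:R : R[i]) | i <- enum 'I_p])).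
  - by apply/allP => _ /mapP[i _ ->]; rewrite /root Pf fx.
  - rewrite map_inj_uniq ?enum_uniq// => i j /eqP.
    by rewrite eqr_nat => /eqP/finj.
  - by rewrite size_map size_enum_ord.
suff h k : forall s : 'I_p, (s < k)%N -> x s = 0 by move=> s; exact: (h s.+1).
elim: k => // k IH s; rewrite ltnS leq_eqVlt => /orP[/eqP sk|]; last exact: IH.
have := Pf s; rewrite P0 horner0 (bigD1 s)//= big1 ?addr0.
  rewrite ffactnn => /esym/eqP; rewrite mulf_eq0 pnatr_eq0 => /orP[|/eqP//].
  by rewrite -leqn0 leqNgt fact_gt0.
move=> r rs; have [rk|kr] := ltnP r s; first by rewrite IH -?sk ?mulr0.
by rewrite ffact_small ?mul0r// ltn_neqAle eq_sym val_eqE rs.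
Qed.

(** The limit of the matrices of scaled Taylor coefficients. *)
Definition ffact_mx p (f : 'I_p -> nat) : 'M[R[i]]_p :=
  \matrix_(i, s) ((f i ^_ s)%:R / (f i)`!%:R).

Lemma ffact_mx_unit p (f : 'I_p -> nat) : injective f -> ffact_mx f \in unitmx.
Proof.
move=> finj; rewrite -unitmx_tr -row_free_unit -kermx_eq0.
apply/eqP/row_matrixP => i; rewrite row0.
have : row i (kermx (ffact_mx f)^T) *m (ffact_mx f)^T = 0.
  by rewrite -row_mul mulmx_ker row0.
set v := row i _ => hv; apply/rowP => s; rewrite [RHS]mxE.
apply: (ffact_kernel (x := fun s => v 0 s) finj) => k.
have := congr1 (fun M : 'rV[R[i]]_p => M 0 k) hv; rewrite !mxE => h.
have fk : ((f k)`!%:R : R[i]) != 0 by rewrite pnatr_eq0 -lt0n fact_gt0.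
apply: (mulfI (invr_neq0 fk)); rewrite mulr0 -[RHS]h [LHS]mulr_sumr.
by apply: eq_bigr => r _; rewrite !mxE; ring.
Qed.

Definition norm1 p (x : 'cV[R[i]]_p) : R := \sum_i normc (x i 0).

Lemma norm1_ge0 p (x : 'cV[R[i]]_p) : 0 <= norm1 x.
Proof. by apply: sumr_ge0 => i _; exact: normc_ge0. Qed.

Definition mxnorm p (A : 'M[R[i]]_p) : R := \sum_i \sum_j normc (A i j).

Lemma norm1_mulmx p (A : 'M[R[i]]_p) x : norm1 (A *m x) <= mxnorm A * norm1 x.
Proof.
rewrite /mxnorm mulr_suml; apply: ler_sum => i _; rewrite mxE.
apply: le_trans (normc_sum _ _ _) _; rewrite mulr_suml; apply: ler_sum => j _.
rewrite normcM ler_wpM2l ?normc_ge0// /norm1 (bigD1 j)//= lerDl.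
by apply: sumr_ge0 => k _; exact: normc_ge0.
Qed.

Lemma norm1D p (x y : 'cV[R[i]]_p) : norm1 (x + y) <= norm1 x + norm1 y.
Proof.
by rewrite /norm1 -big_split; apply: ler_sum => i _; rewrite mxE; exact: normcD.
Qed.

(** Matrices close to an invertible one have uniformly bounded inverses. *)
Lemma bounded_inverse p (M : nat -> 'M[R[i]]_p) (V : 'M[R[i]]_p) : V \in unitmx ->
  (forall i j, (fun n => M n i j) @ \oo --> V i j) ->
  exists2 C : R, 0 < C & \forall n \near \oo, forall x, norm1 x <= C * norm1 (M n *m x).
Proof.
move=> uV MV; pose w := mxnorm (invmx V).
have w0 : 0 <= w by apply: sumr_ge0 => i _; apply: sumr_ge0 => j _; exact: normc_ge0.
exists (2 * w + 1); first by lra.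
have e0 : 0 < (2 * (w + 1))^-1 by rewrite invr_gt0; lra.
have hd : (fun n => mxnorm (V - M n)) @ \oo --> (0 : R).
  have -> : 0 = \sum_(i < p) \sum_(j < p) 0 :> R.
    by rewrite big1// => i _; rewrite big1.
  apply: cvg_big => [|i _]; first exact: add_continuous.
  apply: cvg_big => [|j _]; first exact: add_continuous.
  apply/cvgrPdist_lt => e he; move/cvg_normcP : (MV i j) => /(_ _ he).
  apply: filterS => n; rewrite !mxE sub0r normrN ger0_norm ?normc_ge0//.
  by rewrite normc_sub.
move/cvgrPdist_lt : hd => /(_ _ e0); apply: filterS => n hn x.
have {}hn : mxnorm (V - M n) * (2 * (w + 1)) <= 1.
  rewrite -ler_pdivlMr; last by lra.
  rewrite mul1r; move: hn; rewrite sub0r normrN => /ltW; apply: le_trans; exact: ler_norm.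
have xE : x = invmx V *m (M n *m x + (V - M n) *m x).
  by rewrite -mulmxDl addrC subrK mulKmx.
have h1 : norm1 x <= w * (norm1 (M n *m x) + mxnorm (V - M n) * norm1 x).
  rewrite {1}xE; apply: le_trans (norm1_mulmx _ _) _; rewrite ler_wpM2l//.
  by apply: le_trans (norm1D _ _) _; rewrite lerD2l; exact: norm1_mulmx.
have x0 := norm1_ge0 x; have y0 := norm1_ge0 (M n *m x).
have d0 : 0 <= mxnorm (V - M n).
  by apply: sumr_ge0 => i _; apply: sumr_ge0 => j _; exact: normc_ge0.
have h2 : w * (mxnorm (V - M n) * norm1 x) <= norm1 x / 2.
  have : (w * mxnorm (V - M n)) * 2 <= 1.
    by apply: le_trans hn; have := mulr_ge0 w0 d0; lra.
  move=> /(ler_wpM2r x0); lra.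
by move: h1; rewrite mulrDr; lra.
Qed.

End FallingFactorialMatrix.

Section PointAsymptotics.
Context {R : realType}.
Variables (theta : nat -> nat -> R[i]) (t a : nat -> R[i]).
Hypothesis theta_cvg : forall r,
  (fun n => theta r n / (theta 0 n * t n ^+ r)) @ \oo --> ((r`!%:R)^-1 : R[i]).
Hypothesis t_neq0 : \forall n \near \oo, t n != 0.
Hypothesis theta_neq0 : \forall n \near \oo, theta 0 n != 0.
Hypothesis t_infty : (fun n => (t n)^-1) @ \oo --> (0 : R[i]).
Hypothesis theta_infty : forall k, (fun n => t n ^+ k / theta 0 n) @ \oo --> (0 : R[i]).
Hypothesis a_cvg : a @ \oo --> (2^-1 : R[i]).

(** Here [theta r n] stands for the Taylor coefficient of order [r] at a node of a
    polynomial of index [n], and [t n] for its logarithmic derivative, of order [n]: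
    after scaling, the coefficients converge. *)
Definition scaled_coef k s n : R[i] :=
  if (s <= k)%N then theta (k - s) n / (theta 0 n * t n ^+ (k - s)) else 0.

Lemma scaled_coef_cvg k s :
  scaled_coef k s @ \oo --> ((k ^_ s)%:R / k`!%:R : R[i]).
Proof.
rewrite /scaled_coef; have [sk|ks] := leqP s k; last first.
  by rewrite (ffact_small ks) mul0r; exact: cvg_cst.
have -> : (k ^_ s)%:R / k`!%:R = ((k - s)`!%:R)^-1 :> R[i].
  rewrite -(ffact_fact sk) natrM invfM mulrA divff ?mul1r//.
  by rewrite pnatr_eq0 -lt0n ffact_gt0.
exact: theta_cvg.
Qed.

Lemma scaled_coef_le2 K : \forall n \near \oo, forall k s,
  (k < K)%N -> (s < K)%N -> normc (scaled_coef k s n) <= 2.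
Proof.
have h k s : \forall n \near \oo, normc (scaled_coef k s n) <= 2.
  move/cvg_normcP : (@scaled_coef_cvg k s) => /(_ 1 ltr01); apply: filterS => n hn.
  have := normcB (scaled_coef k s n) ((k ^_ s)%:R / k`!%:R).
  rewrite normcM normcV !normc_nat.
  have : (k ^_ s)%:R / k`!%:R <= 1 :> R.
    rewrite ler_pdivrMr ?ltr0n ?fact_gt0// mul1r ler_nat.
    have [sk|ks] := leqP s k; last by rewrite ffact_small.
    by rewrite -(ffact_fact sk) leq_pmulr// fact_gt0.
  by lra.
have : \forall n \near \oo, forall (k s : 'I_K), normc (scaled_coef k s n) <= 2.
  by apply: filter_forall => k; apply: filter_forall => s.
by apply: filterS => n hn k s kK sK; exact: (hn (Ordinal kK) (Ordinal sK)).
Qed.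

Lemma t_ge1 : \forall n \near \oo, 1 <= normc (t n).
Proof.
move/cvg_normcP : t_infty => /(_ 1 ltr01); apply: filterS2 t_neq0 => n t0.
rewrite subr0 normcV => h; rewrite -[leRHS]invrK invf_ge1 ?invr_gt0 ?normc_gt0//.
exact: ltW.
Qed.

Lemma a_ge : \forall n \near \oo, 1 / 4 <= normc (a n).
Proof.
have e4 : 0 < 1 / 4 :> R by lra.
move/cvg_normcP : a_cvg => /(_ _ e4); apply: filterS => n.
rewrite normc_sub => h; have := normcB (2^-1) (a n); rewrite normcV normc_nat; lra.
Qed.

Definition weight K n (d : 'I_K -> R[i]) (s : nat) : R[i] :=
  a n * \sum_(i < K) (if (s <= i)%N then d i * i`!%:R * theta (i - s) n else 0).

Lemma enum_val_ord_inj K (A : {set 'I_K}) :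
  injective (fun i : 'I_#|A| => val (enum_val i)).
Proof. by move=> i j /val_inj/enum_val_inj. Qed.

Lemma sum_enum_val K (A : {set 'I_K}) (F : 'I_K -> R[i]) :
  (forall i, i \notin A -> F i = 0) -> \sum_i F i = \sum_(i < #|A|) F (enum_val i).
Proof.
move=> FA; rewrite (bigID (mem A)) /= [X in _ + X]big1 ?addr0 => [|i]; last exact: FA.
by rewrite big_enum_val.
Qed.

(** The weights of order at least [#|A|] are dominated by the [#|A|] first ones:
    the powers of [t] make the coefficients of low order win. *)
Lemma weight_domination K (A : {set 'I_K}) :
  exists2 C : R, 0 < C & \forall n \near \oo, forall d : 'I_K -> R[i],
    (forall i, i \notin A -> d i = 0) ->
    let B := \sum_(s < #|A|) normc (weight n d s) in
    (forall i, normc (d i) * normc (theta 0 n) <= C * normc (t n) ^+ #|A| * B) /\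
    (forall s, (#|A| <= s < K)%N -> normc (weight n d s) * normc (t n) <= C * B).
Proof.
set p := #|A|; pose f (i : 'I_p) := val (enum_val i).
have uV : (@ffact_mx R _ f)^T \in unitmx.
  by rewrite unitmx_tr ffact_mx_unit//; exact: enum_val_ord_inj.
have MV : forall i j, (fun n => (\matrix_(s < p, i < p) scaled_coef (f i) s n) i j)
     @ \oo --> (@ffact_mx R _ f)^T i j.
  move=> i j; rewrite !mxE.
  have -> : (fun n => (\matrix_(s < p, i < p) scaled_coef (f i) s n) i j) =
      scaled_coef (f j) i by apply/funext => n; rewrite mxE.
  exact: scaled_coef_cvg.
have [C C0 hC] := bounded_inverse uV MV.
exists (4 * C); first by lra.
near=> n.
have hCn : forall x, norm1 x <= C * norm1 ((\matrix_(s < p, i < p) scaled_coef (f i) s n) *m x).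
  by near: n; exact: hC.
have tn0 : t n != 0 by near: n.
have th0 : theta 0 n != 0 by near: n.
have t1 : 1 <= normc (t n) by near: n; exact: t_ge1.
have an : 1 / 4 <= normc (a n) by near: n; exact: a_ge.
have c2 : forall k s, (k < K)%N -> (s < K)%N -> normc (scaled_coef k s n) <= 2.
  by near: n; exact: scaled_coef_le2.
have tpos : 0 < normc (t n) by lra.
have thpos : 0 < normc (theta 0 n) by rewrite normc_gt0.
move=> d dA; set B := \sum_(s < p) normc (weight n d s).
have B0 : 0 <= B by apply: sumr_ge0 => s _; exact: normc_ge0.
pose e (i : 'I_K) := a n * d i * i`!%:R * theta 0 n * t n ^+ i.
pose x : 'cV[R[i]]_p := \col_i e (enum_val i).
have bE s : weight n d s * t n ^+ s = \sum_(i < p) scaled_coef (f i) s n * x i 0.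
  rewrite /weight -mulrA mulr_suml mulr_sumr.
  rewrite (@sum_enum_val _ A); last first.
    by move=> i /dA ->; case: ifP => _; rewrite ?mul0r ?mulr0.
  apply: eq_bigr => i _; rewrite mxE /scaled_coef /f /e.
  case: ifP => si; last by rewrite !(mul0r, mulr0).
  have -> : t n ^+ enum_val i = t n ^+ (enum_val i - s) * t n ^+ s.
    by rewrite -exprD subnK.
  by field; rewrite th0 expf_neq0.
have xB : norm1 x <= C * (normc (t n) ^+ p.-1 * B).
  apply: le_trans (hCn x) _; rewrite ler_wpM2l ?(ltW C0)// /norm1 /B mulr_sumr.
  apply: ler_sum => s _; rewrite mxE.
  have -> : \sum_j (\matrix_(s, i) scaled_coef (f i) s n) s j * x j 0 =
      weight n d s * t n ^+ s.
    by rewrite bE; apply: eq_bigr => j _; rewrite !mxE.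
  rewrite normcM normcX mulrC ler_wpM2r ?normc_ge0//.
  by apply: ler_weXn2l => //; rewrite -ltnS prednK// (leq_ltn_trans _ (ltn_ord s)).
have xe (i : 'I_p) : normc (e (enum_val i)) <= norm1 x.
  rewrite /norm1 (bigD1 i)//= mxE lerDl.
  by apply: sumr_ge0 => k _; exact: normc_ge0.
have tp : normc (t n) ^+ p.-1 <= normc (t n) ^+ p.
  by apply: ler_weXn2l => //; exact: leq_pred.
split=> [i|s /andP[ps sK]].
  have [iA|/dA ->] := boolP (i \in A); last first.
    by rewrite normc0 mul0r !mulr_ge0// ?exprn_ge0// ltW//; lra.
  have [j jE] : exists j : 'I_p, enum_val j = i.
    by exists (enum_rank_in iA i); rewrite enum_rankK_in.
  have h1 := le_trans (xe j) xB; rewrite jE /e !normcM normcX normc_nat in h1.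
  have h2 : 1 <= (i`!%:R : R) by rewrite ler1n fact_gt0.
  have h3 : 1 <= normc (t n) ^+ i by rewrite exprn_ege1.
  have h4 : normc (d i) * normc (theta 0 n) / 4 <=
     normc (a n) * normc (d i) * i`!%:R * normc (theta 0 n) * normc (t n) ^+ i.
    have -> : normc (a n) * normc (d i) * i`!%:R * normc (theta 0 n) * normc (t n) ^+ i
      = (normc (d i) * normc (theta 0 n)) * (normc (a n) * (i`!%:R * normc (t n) ^+ i)) by ring.
    rewrite ler_wpM2l ?mulr_ge0 ?normc_ge0//.
    have a4 : 0 <= 1 / 4 :> R by lra.
    by have := ler_pM a4 ler01 an (mulr_ege1 h2 h3); lra.
  have h5 := ler_wpM2r B0 tp.
  have h6 := ler_wpM2l (ltW C0) h5.
  by lra.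
have := bE s => /(congr1 (@normc R)); rewrite normcM normcX => hs.
have hs2 : normc (weight n d s) * normc (t n) ^+ s <= 2 * norm1 x.
  rewrite hs; apply: le_trans (normc_sum _ _ _) _; rewrite /norm1 mulr_sumr.
  apply: ler_sum => i _; rewrite normcM ler_wpM2r ?normc_ge0//.
  by apply: c2 => //; rewrite /f ltn_ord.
have hs3 : normc (weight n d s) * normc (t n) ^+ s <= 2 * C * (normc (t n) ^+ p.-1 * B) by lra.
have [p0|p0] := posnP p.
  have Bz : B = 0 by rewrite /B; move: (weight n d) => W; rewrite p0 big_ord0.
  move: hs3; rewrite Bz !mulr0; have : 0 < normc (t n) ^+ s by rewrite exprn_gt0.
  move=> ts h; have : normc (weight n d s) <= 0 by rewrite -(pmulr_lle0 _ ts).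
  by rewrite pmulr_lle0.
have hts : normc (t n) ^+ p <= normc (t n) ^+ s by exact: ler_weXn2l.
have tpp : 0 < normc (t n) ^+ p.-1 by rewrite exprn_gt0.
have hs4 : normc (weight n d s) * normc (t n) * normc (t n) ^+ p.-1 <=
    2 * C * B * normc (t n) ^+ p.-1.
  have -> : normc (weight n d s) * normc (t n) * normc (t n) ^+ p.-1 =
      normc (weight n d s) * normc (t n) ^+ p by rewrite -mulrA -exprS prednK.
  apply: le_trans (ler_wpM2l (normc_ge0 _) hts) _; lra.
move: hs4; rewrite ler_pM2r// => hs4; apply: le_trans hs4 _.
by rewrite -!mulrA ler_wpM2r ?mulr_ge0// ?(ltW C0)//; lra.
Unshelve. all: by end_near. Qed.

Definition jet_convolution n (sg : nat -> R[i]) k : R[i] :=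
  \sum_(s < k.+1) theta (k - s) n * sg s.

(** The linear system which gives the scaled convolutions in terms of the scaled
    jets is asymptotically invertible on [#|B|] unknowns; the jets of higher order
    enter with at least one factor [1 / t n]. *)
Lemma jet_domination K (B : {set 'I_K}) :
  exists2 C : R, 0 < C & \forall n \near \oo, forall sg : nat -> R[i],
    forall s, (s < #|B|)%N -> normc (sg s) <=
      C * (normc (t n) ^+ #|B| *
             (\sum_(k in B) normc (jet_convolution n sg k)) / normc (theta 0 n) +
           (\sum_(r < K) normc (sg r)) / normc (t n)).
Proof.
set p := #|B|; pose f (i : 'I_p) := val (enum_val i).
have pK : (p <= K)%N by rewrite /p -[leqRHS]card_ord max_card.
have uV : @ffact_mx R _ f \in unitmx by rewrite ffact_mx_unit//; exact: enum_val_ord_inj.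
have MV : forall i j, (fun n => (\matrix_(i < p, s < p) scaled_coef (f i) s n) i j)
     @ \oo --> @ffact_mx R _ f i j.
  move=> i j; rewrite !mxE.
  have -> : (fun n => (\matrix_(i < p, s < p) scaled_coef (f i) s n) i j) =
      scaled_coef (f i) j by apply/funext => n; rewrite mxE.
  exact: scaled_coef_cvg.
have [C C0 hC] := bounded_inverse uV MV.
have p0 : 0 <= p%:R :> R by [].
exists (C * (2 * p%:R + 1)); first by rewrite mulr_gt0//; lra.
near=> n.
have hCn : forall x, norm1 x <=
    C * norm1 ((\matrix_(i < p, s < p) scaled_coef (f i) s n) *m x).
  by near: n; exact: hC.
have tn0 : t n != 0 by near: n.
have th0 : theta 0 n != 0 by near: n.
have t1 : 1 <= normc (t n) by near: n; exact: t_ge1.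
have c2 : forall k s, (k < K)%N -> (s < K)%N -> normc (scaled_coef k s n) <= 2.
  by near: n; exact: scaled_coef_le2.
have tpos : 0 < normc (t n) by lra.
have thpos : 0 < normc (theta 0 n) by rewrite normc_gt0.
move=> sg s sp; set D := \sum_(k in B) _; set Sg := \sum_(r < K) _.
have D0 : 0 <= D by apply: sumr_ge0 => k _; exact: normc_ge0.
have Sg0 : 0 <= Sg by apply: sumr_ge0 => k _; exact: normc_ge0.
pose y r := sg r / t n ^+ r.
pose x : 'cV[R[i]]_p := \col_(r < p) y r.
have DE k : (k < K)%N -> jet_convolution n sg k / (theta 0 n * t n ^+ k) =
    \sum_(r < K) scaled_coef k r n * y r.
  move=> kK; rewrite /jet_convolution mulr_suml.
  rewrite (big_ord_widen _ (fun r => theta (k - r) n * sg r / (theta 0 n * t n ^+ k)) kK).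
  rewrite big_mkcond /=; apply: eq_bigr => r _; rewrite ltnS /scaled_coef /y.
  case: ifP => rk; last by rewrite mul0r.
  have -> : t n ^+ k = t n ^+ (k - r) * t n ^+ r by rewrite -exprD subnK.
  by field; rewrite th0 !expf_neq0.
have hy r : (p <= r)%N -> normc (y r) <= normc (sg r) / normc (t n) ^+ p.
  move=> pr; rewrite /y normcM normcV normcX ler_wpM2l ?normc_ge0//.
  by rewrite lef_pV2 ?posrE ?exprn_gt0//; exact: ler_weXn2l.
have Mx i : normc (((\matrix_(i < p, s < p) scaled_coef (f i) s n) *m x) i 0) <=
    normc (jet_convolution n sg (f i)) / normc (theta 0 n) + 2 * (Sg / normc (t n) ^+ p).
  have fK : (f i < K)%N by rewrite /f ltn_ord.
  have -> : ((\matrix_(i < p, s < p) scaled_coef (f i) s n) *m x) i 0 =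
      jet_convolution n sg (f i) / (theta 0 n * t n ^+ f i) -
      \sum_(p <= r < K) scaled_coef (f i) r n * y r.
    rewrite DE// !mxE -(big_mkord xpredT (fun r => scaled_coef (f i) r n * y r)).
    rewrite (big_cat_nat (leq0n p) pK) /= addrK big_mkord.
    by apply: eq_bigr => r _; rewrite !mxE.
  apply: le_trans (normcD _ _) _; rewrite normc_opp; apply: lerD.
    rewrite normcM normcV normcM normcX ler_wpM2l ?normc_ge0//.
    rewrite lef_pV2 ?posrE ?mulr_gt0 ?exprn_gt0// ler_peMr// ?exprn_ege1//.
    exact: ltW.
  apply: le_trans (normc_sum _ _ _) _.
  rewrite /Sg -(big_mkord xpredT (fun r => normc (sg r))) (big_cat_nat (leq0n p) pK) /=.
  set S1 := \sum_(0 <= r < p) _; set S2 := \sum_(p <= r < K) normc (sg r).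
  have S10 : 0 <= S1 by apply: sumr_ge0 => r _; exact: normc_ge0.
  have -> : 2 * ((S1 + S2) / normc (t n) ^+ p) =
      2 * (S1 / normc (t n) ^+ p) + 2 * (S2 / normc (t n) ^+ p) by ring.
  rewrite ler_wpDl//; first by rewrite mulr_ge0// divr_ge0 ?exprn_ge0 ?(ltW tpos).
  rewrite /S2 mulr_suml mulr_sumr big_nat [leRHS]big_nat; apply: ler_sum => r /andP[pr rK].
  by rewrite normcM; apply: ler_pM; rewrite ?normc_ge0 ?c2 ?hy.
have hx : norm1 x <= C * (D / normc (theta 0 n) + 2 * p%:R * (Sg / normc (t n) ^+ p)).
  apply: le_trans (hCn x) _; rewrite ler_wpM2l ?(ltW C0)// /norm1.
  apply: le_trans (ler_sum _ (fun i _ => Mx i)) _.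
  rewrite big_split /= -mulr_suml sumr_const card_ord -[_ *+ p]mulr_natr.
  have -> : \sum_(i < p) normc (jet_convolution n sg (f i)) = D.
    by rewrite /D [RHS]big_enum_val.
  have -> : 2 * (Sg / normc (t n) ^+ p) * p%:R = 2 * p%:R * (Sg / normc (t n) ^+ p) by ring.
  exact: lexx.
have sy : normc (sg s) <= normc (t n) ^+ p.-1 * norm1 x.
  have -> : sg s = t n ^+ s * y s by rewrite /y mulrCA divff ?mulr1// expf_neq0.
  rewrite normcM normcX; apply: ler_pM; rewrite ?exprn_ge0 ?normc_ge0//.
    by apply: ler_weXn2l => //; rewrite -ltnS prednK// (leq_ltn_trans _ sp).
  rewrite /norm1 (bigD1 (Ordinal sp))//= mxE lerDl.
  by apply: sumr_ge0 => k _; exact: normc_ge0.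
apply: le_trans sy _.
have pgt : (0 < p)%N by exact: leq_ltn_trans sp.
have tpE : normc (t n) ^+ p = normc (t n) * normc (t n) ^+ p.-1 by rewrite -exprS prednK.
have tpp : 0 < normc (t n) ^+ p.-1 by rewrite exprn_gt0.
have tp1 : normc (t n) ^+ p.-1 <= normc (t n) ^+ p.
  by apply: ler_weXn2l => //; exact: leq_pred.
have -> : C * (2 * p%:R + 1) * (normc (t n) ^+ p * D / normc (theta 0 n) + Sg / normc (t n)) =
    C * ((2 * p%:R + 1) * (normc (t n) ^+ p * D / normc (theta 0 n)) +
     (2 * p%:R + 1) * (Sg / normc (t n))) by ring.
apply: le_trans (ler_wpM2l (ltW tpp) hx) _.
rewrite mulrCA ler_wpM2l ?(ltW C0)// mulrDr; apply: lerD.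
  have h0 : 0 <= D / normc (theta 0 n) by rewrite divr_ge0 ?normc_ge0.
  apply: (@le_trans _ _ (normc (t n) ^+ p * D / normc (theta 0 n))).
    by rewrite -mulrA ler_wpM2r.
  by rewrite ler_peMl ?mulr_ge0 ?exprn_ge0 ?normc_ge0 ?invr_ge0 ?normc_ge0//; lra.
rewrite tpE invfM.
have -> : normc (t n) ^+ p.-1 *
   (2 * p%:R * (Sg * ((normc (t n))^-1 * (normc (t n) ^+ p.-1)^-1))) =
   2 * p%:R * (Sg / normc (t n)) by field; rewrite !gt_eqF.
rewrite ler_wpM2r ?divr_ge0 ?normc_ge0//; lra.
Unshelve. all: by end_near. Qed.

(** The regularity of [G] ties the two dominations together: the jets of low
    order are exponentially small because the data [d] are. *)
Lemma point_domination K1 K2 (G : 'M[R[i]]_(K1, K2)) : prune_regular G ->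
  forall e : R, 0 < e -> \forall n \near \oo, forall (sg : nat -> R[i]) (d : 'I_K1 -> R[i]),
    (forall i, d i = \sum_k G i k * (k`!%:R * jet_convolution n sg k)) ->
    let B := \sum_(s < #|nz_rows G|) normc (weight n d s) in
    (forall s, (#|nz_rows G| <= s < K1)%N -> normc (weight n d s) <= e * B) /\
    (forall s, (s < #|nz_rows G|)%N ->
       normc (sg s) <= e * (B + \sum_(r < K2) normc (sg r))).
Proof.
move=> [eG dG] e e0; set p := #|nz_rows G|.
pose Gs := castmx (erefl p, eG) (prune G).
have uG : Gs \in unitmx by rewrite unitmxE unitfE.
have [C C0 hC] := weight_domination (nz_rows G).
have [C' C'0 hC'] := jet_domination (nz_cols G).
pose w := mxnorm (invmx Gs).
have w0 : 0 <= w by apply: sumr_ge0 => i _; apply: sumr_ge0 => j _; exact: normc_ge0.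
have eC : 0 < e / C by exact: divr_gt0.
have eC' : 0 < e / C' by exact: divr_gt0.
pose c1 := w * (K1%:R * C) + 1.
have c10 : 0 < c1 by rewrite /c1 ltr_wpDl// !mulr_ge0// ltW.
have ec : 0 < Num.min 1 (e / C' / c1) by rewrite lt_min ltr01 divr_gt0.
near=> n.
have tn0 : t n != 0 by near: n.
have th0 : theta 0 n != 0 by near: n.
have tpos : 0 < normc (t n) by rewrite normc_gt0.
have thpos : 0 < normc (theta 0 n) by rewrite normc_gt0.
have hCn : forall d : 'I_K1 -> R[i], (forall i, i \notin nz_rows G -> d i = 0) ->
    let B := \sum_(s < p) normc (weight n d s) in
    (forall i, normc (d i) * normc (theta 0 n) <= C * normc (t n) ^+ p * B) /\
    (forall s, (p <= s < K1)%N -> normc (weight n d s) * normc (t n) <= C * B).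
  by near: n; exact: hC.
have hC'n : forall sg s, (s < #|nz_cols G|)%N -> normc (sg s) <=
      C' * (normc (t n) ^+ #|nz_cols G| *
             (\sum_(k in nz_cols G) normc (jet_convolution n sg k)) / normc (theta 0 n) +
           (\sum_(r < K2) normc (sg r)) / normc (t n)).
  by near: n; exact: hC'.
have te : (normc (t n))^-1 <= e / C.
  near: n; move/cvg_normcP : t_infty => /(_ _ eC); apply: filterS => n.
  by rewrite subr0 normcV => /ltW.
have te' : (normc (t n))^-1 <= e / C'.
  near: n; move/cvg_normcP : t_infty => /(_ _ eC'); apply: filterS => n.
  by rewrite subr0 normcV => /ltW.
have the : normc (t n) ^+ p / normc (theta 0 n) <= Num.min 1 (e / C' / c1).
  near: n; move/cvg_normcP : (theta_infty p) => /(_ _ ec); apply: filterS => n.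
  by rewrite subr0 normcM normcV normcX => /ltW.
move=> sg d dE; set B := \sum_(s < p) _.
have dA i : i \notin nz_rows G -> d i = 0.
  rewrite inE negbK => /eqP Gi; rewrite dE big1// => k _.
  by have := congr1 (fun M : 'rV[R[i]]_K2 => M 0 k) Gi; rewrite !mxE => ->; rewrite mul0r.
have [h1 h2] := hCn d dA.
have B0 : 0 <= B by apply: sumr_ge0 => s _; exact: normc_ge0.
split=> [s ps|s sp].
  have := h2 _ ps; rewrite -ler_pdivlMr// => /le_trans; apply.
  rewrite mulrAC ler_wpM2r//.
  by move: te; rewrite ler_pdivlMr// mulrC.
have := hC'n sg s; rewrite eG => /(_ sp) /le_trans; apply.
set D := \sum_(k in _) _; set Sg := \sum_(r < K2) _.
have Sg0 : 0 <= Sg by apply: sumr_ge0 => r _; exact: normc_ge0.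
pose F (k : 'I_K2) := k`!%:R * jet_convolution n sg k.
pose x : 'cV[R[i]]_p := \col_i F (enum_val (cast_ord (esym eG) i)).
have Dx : D <= norm1 x.
  rewrite /D [leLHS]big_enum_val /= /norm1 (reindex (cast_ord (esym eG))) /=; last first.
    by exists (cast_ord eG) => i _; rewrite ?cast_ordK ?cast_ordKV.
  apply: ler_sum => i _; rewrite mxE /F normcM normc_nat ler_peMl ?normc_ge0//.
  by rewrite ler1n fact_gt0.
have Gx : Gs *m x = \col_i d (enum_val i).
  apply/matrixP => i j; rewrite !mxE dE.
  transitivity (\sum_(k in nz_cols G) G (enum_val i) k * F k).
    rewrite [RHS]big_enum_val /= [RHS](reindex (cast_ord (esym eG))) /=; last first.
      by exists (cast_ord eG) => r _; rewrite ?cast_ordK ?cast_ordKV.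
    by apply: eq_bigr => k _; rewrite mxE castmxE /= cast_ord_id /prune mxE.
  rewrite [RHS](bigID (mem (nz_cols G))) /= [X in _ = _ + X]big1 ?addr0// => k.
  rewrite inE negbK => /eqP Gk.
  have := congr1 (fun M : 'cV[R[i]]_K1 => M (enum_val i) 0) Gk.
  by rewrite !mxE => ->; rewrite mul0r.
have hx : norm1 x <= w * norm1 (\col_(i < p) d (enum_val i)).
  by rewrite -Gx -{1}(mulKmx uG x); exact: norm1_mulmx.
have hd : norm1 (\col_(i < p) d (enum_val i)) * normc (theta 0 n) <=
    K1%:R * (C * normc (t n) ^+ p * B).
  rewrite /norm1 mulr_suml; apply: (@le_trans _ _ (\sum_(i < p) C * normc (t n) ^+ p * B)).
    by apply: ler_sum => i _; rewrite mxE; exact: h1.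
  rewrite sumr_const card_ord -[_ *+ p]mulr_natl ler_wpM2r//.
    by rewrite !mulr_ge0 ?exprn_ge0 ?normc_ge0// ltW.
  by rewrite ler_nat /p -[leqRHS]card_ord max_card.
rewrite mulrDr [leRHS]mulrDr; apply: lerD; last first.
  rewrite mulrCA [leRHS]mulrC ler_wpM2l//.
  by move: te'; rewrite ler_pdivlMr// mulrC.
set T := normc (t n) ^+ p in the h1 hd *; set th := normc (theta 0 n) in the hd thpos *.
have T0 : 0 <= T by rewrite exprn_ge0// ltW.
have hD : D * th <= w * (K1%:R * (C * T * B)).
  apply: le_trans (ler_wpM2r (ltW thpos) (le_trans Dx hx)) _.
  by rewrite -[leLHS]mulrA ler_wpM2l.
have r0 : 0 <= T / th by rewrite divr_ge0// ltW.
have r1 : T / th <= 1 by apply: le_trans the _; rewrite ge_min lexx.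
have r2 : T / th <= e / C' / c1 by apply: le_trans the _; rewrite ge_min lexx orbT.
have thn : th != 0 by rewrite gt_eqF.
have hD2 : T * D / th <= w * (K1%:R * C) * (T / th * (T / th)) * B.
  have -> : w * (K1%:R * C) * (T / th * (T / th)) * B =
      T / th * (w * (K1%:R * (C * T * B)) / th) by field.
  have -> : T * D / th = T / th * D by rewrite mulrAC.
  by rewrite ler_wpM2l// ler_pdivlMr.
have hr : T / th * (T / th) <= e / C' / c1.
  by apply: le_trans r2; rewrite ler_piMl.
rewrite -ler_pdivlMl//; apply: le_trans hD2 _.
have -> : C'^-1 * (e * B) = e / C' * B by ring.
rewrite ler_wpM2r//.
have wc0 : 0 <= w * (K1%:R * C) by rewrite !mulr_ge0// ltW.
apply: le_trans (ler_wpM2l wc0 hr) _.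
apply: (@le_trans _ _ (c1 * (e / C' / c1))).
  by rewrite ler_wpM2r ?divr_ge0 ?(ltW c10) ?(ltW C'0) ?(ltW e0)// /c1 lerDl.
by rewrite mulrC divfK// gt_eqF.
Unshelve. all: by end_near. Qed.

End PointAsymptotics.

(** * The limit problem *)

Section VanishingOrder.
Context {R : realType}.
Implicit Types (D X Y : {poly R[i]}) (c z : R[i]) (k l n : nat) (f g : R[i] -> R[i]).

Lemma near_all c (P : R[i] -> Prop) : (forall z, P z) -> \forall z \near c, P z.
Proof. by move=> h; apply: (@nearW _ (nbhs c) P (complex_nbhs_filter c)). Qed.

(** A bound off the point itself, so that it does not depend on the value there. *)
Definition vanishes_to (c : R[i]) (k : nat) (f : R[i] -> R[i]) : Prop :=
  exists M : R, \forall z \near c, z != c -> normc (f z) <= M * normc (z - c) ^+ k.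

Lemma vanishes_toM c k l f g : vanishes_to c k f -> vanishes_to c l g ->
  vanishes_to c (k + l) (fun z => f z * g z).
Proof.
move=> [M hM] [M' hM']; exists (M * M'); apply: filterS2 hM hM' => z h h' zc.
rewrite normcM exprD mulrACA; apply: ler_pM; rewrite ?normc_ge0//; [exact: h|exact: h'].
Qed.

Lemma vanishes_toD c k f g : vanishes_to c k f -> vanishes_to c k g ->
  vanishes_to c k (fun z => f z + g z).
Proof.
move=> [M hM] [M' hM']; exists (M + M'); apply: filterS2 hM hM' => z h h' zc.
apply: le_trans (normcD _ _) _; rewrite mulrDl; apply: lerD; [exact: h|exact: h'].
Qed.

Lemma vanishes_to0 c f : {for c, continuous f} -> vanishes_to c 0 f.
Proof.
move=> /cvg_normcP/(_ 1 ltr01) h; exists (normc (f c) + 1).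
apply: filterS h => z h _; rewrite expr0 mulr1.
by have := normcB (f z) (f c); lra.
Qed.

Lemma vanishes_toZ c k (a : R[i]) f : vanishes_to c k f ->
  vanishes_to c k (fun z => a * f z).
Proof.
move=> h; have := vanishes_toM (vanishes_to0 (f := fun=> a) _) h.
by rewrite add0n; apply; exact: cvg_cst.
Qed.

Lemma vanishes_to_near c k f g : (\forall z \near c, z != c -> f z = g z) ->
  vanishes_to c k f -> vanishes_to c k g.
Proof.
move=> fg [M hM]; exists M; apply: filterS2 fg hM => z h h' zc.
by rewrite -h// h'.
Qed.

Lemma vanishes_toX c k f n : vanishes_to c k f -> vanishes_to c (k * n) (fun z => f z ^+ n).
Proof.
move=> h; elim: n => [|n IH].
  by rewrite muln0; apply: vanishes_to0; exact: cvg_cst.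
rewrite mulnS; apply: vanishes_to_near (vanishes_toM h IH).
by apply: near_all => z _; rewrite exprS.
Qed.

Lemma punctured_point (c : R[i]) (e : R) : 0 < e ->
  exists2 z, z != c & normc (z - c) < e.
Proof.
move=> e0; exists (c + (e / 2)%:C); last first.
  by rewrite addrAC subrr add0r normc_real gtr0_norm; lra.
rewrite -subr_eq0 addrAC subrr add0r -normc_eq0 normc_real gtr0_norm; lra.
Qed.

Lemma vanishes_to_dvdp c k D : vanishes_to c k (horner D) ->
  ('X - c%:P) ^+ k %| D.
Proof.
move=> [M hM]; have [->|D0] := eqVneq D 0; first exact: dvdp0.
have [r [H]] := multiplicity_XsubC D c; rewrite D0 /= => Hc DE.
have [kr|rk] := leqP k r.
  by rewrite DE dvdp_mull// dvdp_exp2l.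
exfalso; move: Hc; rewrite /root -normc_gt0 => Hc.
have Hcont : \forall z \near c, normc H.[c] / 2 < normc H.[z].
  have h2 : 0 < normc H.[c] / 2 by lra.
  have /cvg_normcP/(_ _ h2) := @horner_continuous R H c.
  by apply: filterS => z h; have := normcB H.[c] H.[z]; rewrite normc_sub; lra.
pose d := normc H.[c] / 2 / (`|M| + 1).
have M1 : 0 < `|M| + 1 by have := normr_ge0 M; lra.
have d0 : 0 < d by rewrite /d !divr_gt0.
have : \forall z \near c, [/\ normc (z - c) < Num.min 1 d,
    normc H.[c] / 2 < normc H.[z] &
    z != c -> normc D.[z] <= M * normc (z - c) ^+ k].
  near=> z; split; near: z => //.
  by apply: nbhs_normc_ball; rewrite lt_min ltr01.
move=> /nbhs_normcP[e e0 he].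
have [z zc ze] := punctured_point c e0.
have [] := he z ze; rewrite lt_min => /andP[z1 zd] hH /(_ zc).
have zpos : 0 < normc (z - c) by rewrite normc_gt0 subr_eq0.
rewrite DE hornerM horner_exp hornerXsubC normcM normcX.
have -> : (k = (k - r.+1) + 1 + r)%N by move: rk; clear; lia.
rewrite !exprD expr1 mulrA ler_pM2r ?exprn_gt0// => h.
have h2 : M * (normc (z - c) ^+ (k - r.+1) * normc (z - c)) <= (`|M| + 1) * normc (z - c).
  have zk : 0 <= normc (z - c) ^+ (k - r.+1) <= 1.
    by rewrite exprn_ge0 ?normc_ge0//= exprn_ile1 ?normc_ge0// ltW.
  have := ler_norm M; have := normr_ge0 M; case/andP: zk; set x := _ ^+ _.
  move=> x0 x1 m0 mM; rewrite mulrA ler_wpM2r ?normc_ge0//.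
  apply: (@le_trans _ _ (`|M| * x)); first by rewrite ler_wpM2r.
  by apply: (@le_trans _ _ `|M|); [rewrite ler_piMr|lra].
have : (`|M| + 1) * normc (z - c) < normc H.[c] / 2.
  by rewrite mulrC -ltr_pdivlMr.
by lra.
Unshelve. all: by end_near. Qed.

End VanishingOrder.

Section LimitProblem.
Context {R : realType} (sq : R[i] -> R[i]).
Hypothesis sP : is_sqrt_branch sq.
Variables (m : nat) (c : 'I_m -> R[i]) (p : 'I_m -> nat).
Hypothesis c_inj : injective c.
Hypothesis c_out : forall j, ~ segment11 (c j).
Notation phi := (inv_joukowski sq).
Notation u := (joukowski_inv sq).
Implicit Types (X Y D : {poly R[i]}).

Definition total := \sum_(j < m) p j.
Definition node_poly : {poly R[i]} := \prod_(j < m) ('X - (c j)%:P) ^+ p j.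
Definition conode_poly (j : 'I_m) : {poly R[i]} :=
  \prod_(l < m | l != j) ('X - (c l)%:P) ^+ p l.

Lemma node_polyE j : node_poly = ('X - (c j)%:P) ^+ p j * conode_poly j.
Proof. by rewrite /node_poly (bigD1 j). Qed.

Lemma coprime_nodes (A : pred 'I_m) (k : 'I_m -> nat) j n : ~~ A j ->
  coprimep (('X - (c j)%:P) ^+ n) (\prod_(l < m | A l) ('X - (c l)%:P) ^+ k l).
Proof.
move=> Aj; elim/big_rec: _ => [|l D Al IH]; first exact: coprimep1.
rewrite coprimepMr IH andbT; apply: coprimep_expl; apply: coprimep_expr.
rewrite coprimep_XsubC root_XsubC; apply: contraNneq Aj => /c_inj e.
by have <- : A l = A j by rewrite e.
Qed.

Lemma prod_dvdp D (k : 'I_m -> nat) : (forall j, ('X - (c j)%:P) ^+ k j %| D) ->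
  \prod_(j < m) ('X - (c j)%:P) ^+ k j %| D.
Proof.
move=> h.
suff: forall r : seq 'I_m, uniq r -> \prod_(j <- r) ('X - (c j)%:P) ^+ k j %| D.
  by apply; exact: index_enum_uniq.
elim=> [|j r IH] /=; first by rewrite big_nil dvd1p.
move=> /andP[jr ur]; rewrite big_cons Gauss_dvdp ?h ?IH//.
have {ur IH}: {subset r <= r} by [].
elim: {-2}r => [|l r' IH] sr; first by rewrite big_nil coprimep1.
rewrite big_cons coprimepMr IH ?andbT; last first.
  by move=> x xr; apply: sr; rewrite inE xr orbT.
apply: coprimep_expl; apply: coprimep_expr.
rewrite coprimep_XsubC root_XsubC; apply: contraNneq jr => /c_inj e.
by have : l \in r by [apply: sr; rewrite inE eqxx]; rewrite e.
Qed.

(** The polynomial ['X ^+ 2 - 1] is not the square of a rational function, by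
    infinite descent: ['X - 1] divides [Y], hence [X], and can be cancelled. *)
Lemma no_rational_sqrt X Y : Y ^+ 2 = ('X ^+ 2 - 1) * X ^+ 2 -> X = 0.
Proof.
have [n] := ubnP (size X); elim: n X Y => // n IH X Y sX YX.
apply/eqP/negPn/negP => X0.
have f1 : ('X ^+ 2 - 1 : {poly R[i]}) = ('X - 1%:P) * ('X + 1%:P).
  by rewrite -subr_sqr expr1n.
have a0 : ('X - 1%:P : {poly R[i]}) != 0 by rewrite polyXsubC_eq0.
have /factor_theorem[Y1 Y1E] : root Y 1.
  rewrite /root -sqrf_eq0 -horner_exp YX f1 !hornerM hornerXsubC subrr.
  by rewrite !mul0r.
have h1 : Y1 ^+ 2 * ('X - 1%:P) = ('X + 1%:P) * X ^+ 2.
  apply: (mulIf a0); rewrite -[LHS]mulrA -expr2 -exprMn -Y1E YX f1.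
  by ring.
have /factor_theorem[X1 X1E] : root X 1.
  have := congr1 (horner^~ 1) h1; rewrite /= hornerM hornerXsubC subrr mulr0.
  rewrite hornerM hornerD hornerX hornerC horner_exp => /esym/eqP.
  rewrite mulf_eq0 sqrf_eq0 => /orP[|//].
  by rewrite -[1 + 1]/(2%:R : R[i]) pnatr_eq0.
have X10 : X1 != 0 by apply: contraNneq X0 => X1z; rewrite X1E X1z mul0r.
have : X1 = 0.
  apply: (IH X1 Y1).
    move: sX; rewrite X1E size_Mmonic ?monicXsubC// size_XsubC addn2 /=.
    by rewrite ltnS.
  apply: (mulIf a0); rewrite h1 X1E f1; ring.
by move/eqP; exact/negP.
Qed.

Lemma size_combination X Y n : (size X <= n)%N -> (size Y <= n)%N ->
  (size (X ^+ 2 + 2%:P * 'X * X * Y + Y ^+ 2)%R <= n * 2)%N.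
Proof.
case: n => [|n] sX sY.
  have -> : X = 0 by apply/eqP; rewrite -size_poly_leq0.
  have -> : Y = 0 by apply/eqP; rewrite -size_poly_leq0.
  by rewrite mulr0 expr0n /= !addr0 size_poly0.
have hs (A B : {poly R[i]}) a b : (size A <= a)%N -> (size B <= b)%N ->
    (size (A * B)%R <= (a + b).-1)%N.
  move=> hA hB; apply: leq_trans (size_polyMleq _ _) _; lia.
have s2X : (size (2%:P * 'X : {poly R[i]})%R <= 2)%N.
  by rewrite (leq_trans (hs _ _ 1%N 2 _ _))// ?size_polyX// size_polyC leq_b1.
have h1 := hs _ _ _ _ sX sX; have h2 := hs _ _ _ _ sY sY.
have h3 := hs _ _ _ _ (hs _ _ _ _ s2X sX) sY.
rewrite (leq_trans (size_polyD _ _))// geq_max !expr2; apply/andP; split.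
  rewrite (leq_trans (size_polyD _ _))// geq_max; apply/andP; split.
    by apply: leq_trans h1 _; lia.
  by apply: leq_trans h3 _; lia.
by apply: leq_trans h2 _; lia.
Qed.

Lemma u_continuous z : ~ segment11 z -> {for z, continuous u}.
Proof. by move=> hz; apply: cvgB; [exact: cvg_id|exact: branch_continuous]. Qed.

Lemma segment11_compl_near (z : R[i]) : ~ segment11 z -> \forall w \near z, ~ segment11 w.
Proof.
move=> hz; have cS : closed (@segment11 R).
  have : compact (@segment11 R).
    apply: continuous_compact; last exact: segment_compact.
    apply: continuous_subspaceT => x; apply/cvg_normcP => e e0.
    apply: filterS (nbhsx_ballx x e e0) => y; rewrite /ball/= => xy.
    change (normc (y%:C - x%:C : R[i]) < e).
    by rewrite -rmorphB normc_real distrC.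
  by apply: compact_closed; exact: norm_hausdorff.
by have := open_nbhs_nbhs (conj (closed_openC cS) hz).
Qed.

Lemma segment11_compl_node j : \forall z \near c j, ~ segment11 z.
Proof. exact: segment11_compl_near (c_out (j := j)). Qed.

(** Uniqueness in the limit problem: multiplying by the conjugate branch turns
    [X u + Y] into the polynomial [X ^ 2 + 2 z X Y + Y ^ 2], of degree below that
    of the square of the node polynomial, which divides it. *)
Lemma limit_problem_unique X Y : (size X <= total)%N -> (size Y <= total)%N ->
  (forall j, vanishes_to (c j) (p j * 2) (fun z => X.[z] * u z + Y.[z])) ->
  X = 0 /\ Y = 0.
Proof.
move=> sX sY hv; pose D := X ^+ 2 + 2%:P * 'X * X * Y + Y ^+ 2.
have DE z : ~ segment11 z -> D.[z] = (X.[z] * u z + Y.[z]) * (X.[z] * phi z + Y.[z]).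
  move=> hz; rewrite /D !(hornerD, hornerM, horner_exp, hornerX, hornerC).
  have h1 := phi_mul_u sP hz; have h2 := phi_add_u sq z.
  have -> : (X.[z] * u z + Y.[z]) * (X.[z] * phi z + Y.[z]) =
     X.[z] ^+ 2 * (phi z * u z) + X.[z] * Y.[z] * (phi z + u z) + Y.[z] ^+ 2 by ring.
  by rewrite h1 h2; ring.
have D0 : D = 0.
  apply/eqP/negPn/negP => D0.
  have /(dvdp_leq D0) : \prod_(j < m) ('X - (c j)%:P) ^+ (p j * 2) %| D.
    apply: prod_dvdp => j; apply: vanishes_to_dvdp.
    have hc : vanishes_to (c j) 0 (fun z => X.[z] * phi z + Y.[z]).
      apply: vanishes_to0; apply: cvgD; last exact: horner_continuous.
      apply: cvgM; first exact: horner_continuous.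
      exact: phi_continuous (c_out (j := j)).
    have := vanishes_toM (hv j) hc; rewrite addn0; apply: vanishes_to_near.
    by apply: filterS (segment11_compl_node j) => z hz _; rewrite DE.
  rewrite size_prod => [|j _]; last by rewrite expf_neq0// polyXsubC_eq0.
  under eq_bigr do rewrite size_exp_XsubC -addn1.
  rewrite big_split /= sum1_card card_ord -addSn addnK -big_distrl /= -/total.
  by rewrite ltnNge => /negP; apply; exact: size_combination.
(* Completing the square in [D = 0]. *)
have YX : (Y + 'X * X) ^+ 2 = ('X ^+ 2 - 1) * X ^+ 2.
  have -> : (Y + 'X * X) ^+ 2 = D + ('X ^+ 2 - 1) * X ^+ 2.
    by rewrite /D polyC_natr; ring.
  by rewrite D0 add0r.
have X0 := no_rational_sqrt YX; split => //.
move: YX; rewrite X0 mulr0 addr0 expr0n /= mulr0 => /eqP.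
by rewrite sqrf_eq0 => /eqP.
Qed.

(** Products of [N] factors [z - a + k u z] stay in the form [X u + Y], because
    [u ^ 2 = 2 z u - 1]. *)
Definition affine_in_u N (g : R[i] -> R[i]) : Prop := exists X Y,
  [/\ (size X <= N)%N, Y \is monic, size Y = N.+1 &
      forall z, ~ segment11 z -> g z = X.[z] * u z + Y.[z]].

Lemma affine_in_uM N g (a k : R[i]) : affine_in_u N g ->
  affine_in_u N.+1 (fun z => g z * (z - a + k * u z)).
Proof.
move=> [X [Y [sX mY sY gE]]].
exists (X * ('X - a%:P) + k *: Y + (2 * k) *: (X * 'X)), (Y * ('X - a%:P) - k *: X).
have sY' : size (Y * ('X - a%:P)) = N.+2.
  by rewrite size_Mmonic ?monicXsubC ?monic_neq0// size_XsubC sY addn2.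
have sk : (size (- (k *: X))%R < N.+2)%N.
  by rewrite size_polyN (leq_ltn_trans (size_scale_leq _ _))// ltnS ltnW// ltnS.
split.
- have hX (b : {poly R[i]}) : (size b <= 2)%N -> (size (X * b)%R <= N.+1)%N.
    move=> sb; apply: leq_trans (size_polyMleq _ _) _.
    by move: sX sb; clear; lia.
  rewrite (leq_trans (size_polyD _ _))// geq_max; apply/andP; split.
    rewrite (leq_trans (size_polyD _ _))// geq_max hX ?size_XsubC//=.
    by rewrite (leq_trans (size_scale_leq _ _))// sY.
  by rewrite (leq_trans (size_scale_leq _ _))// hX// size_polyX.
- rewrite monicE lead_coefDl ?sY'// -monicE.
  by rewrite monicMl ?monicXsubC.
- by rewrite size_polyDl ?sY'.
move=> z hz; rewrite gE//.
rewrite !(hornerD, hornerN, hornerM, hornerZ, hornerX, hornerC).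
have h1 := phi_mul_u sP hz; have h2 := phi_add_u sq z.
have uu : u z * u z = 2 * z * u z - 1.
  by rewrite -h2 -h1; ring.
have -> : (X.[z] * u z + Y.[z]) * (z - a + k * u z) =
   X.[z] * (z - a) * u z + k * X.[z] * (u z * u z) + Y.[z] * (z - a) + k * Y.[z] * u z.
  by ring.
by rewrite uu; ring.
Qed.

(** The numerator of a factor of the limit function, affine in [u]. *)
Definition zero_factor (j : 'I_m) (z : R[i]) : R[i] :=
  z - phi (c j) + (phi (c j) ^+ 2 - 1) / 2 * u z.

Lemma zero_factorE j z : ~ segment11 z ->
  zero_factor j z = (phi z - phi (c j)) ^+ 2 / (2 * phi z).
Proof.
move=> hz; have p0 := phi_neq0 sP hz.
rewrite /zero_factor uE//.
have h2 := phi_add_u sq z; rewrite uE// in h2.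
have zE : z = (phi z + (phi z)^-1) / 2.
  by rewrite h2 mulrC mulKf// pnatr_eq0.
by rewrite {1}zE; field.
Qed.

(** The explicit solution of the limit problem. *)
Definition zero_product z := \prod_(j < m) zero_factor j z ^+ p j.

Lemma zero_product_affine : affine_in_u total zero_product.
Proof.
have hexp N g j k : affine_in_u N g ->
    affine_in_u (k + N) (fun z => zero_factor j z ^+ k * g z).
  move=> hg; elim: k => [|k [X [Y [sX mY sY gE]]]].
    case: hg => X [Y [sX mY sY gE]]; exists X, Y; split => // z hz.
    by rewrite expr0 mul1r gE.
  have [|X' [Y' [sX' mY' sY' gE']]] := @affine_in_uM (k + N)
      (fun z => zero_factor j z ^+ k * g z) (phi (c j)) ((phi (c j) ^+ 2 - 1) / 2).
    by exists X, Y.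
  exists X', Y'; split => // z hz; rewrite -gE'// exprS -/(zero_factor j z); ring.
rewrite /total /zero_product.
elim: (index_enum _) => [|j r IH].
  exists 0, 1; split; rewrite ?big_nil ?size_poly0 ?monic1 ?size_poly1//.
  by move=> z _; rewrite big_nil horner0 mul0r add0r hornerC.
rewrite big_cons; have [X [Y [sX mY sY gE]]] := hexp _ _ j (p j) IH.
by exists X, Y; split => // z hz; rewrite -gE// big_cons.
Qed.

Lemma phi_sub_vanishes j : vanishes_to (c j) 1 (fun z => phi z - phi (c j)).
Proof.
have hc := c_out (j := j).
have f1 := normc_phi_gt1 sP hc.
pose l := normc (phi (c j)).
have l0 : 0 < l by rewrite /l; lra.
have li : l^-1 < 1 by rewrite invf_lt1.
exists (2 / (1 - l^-1)); apply: filterS (segment11_compl_node j) => z hz _.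
have p0 := phi_neq0 sP hz; have p0' := phi_neq0 sP hc.
have h2 := phi_add_u sq z; rewrite uE// in h2.
have h2' := phi_add_u sq (c j); rewrite uE// in h2'.
have E : 2 * (z - c j) = (phi z - phi (c j)) * (1 - (phi z)^-1 * (phi (c j))^-1).
  by rewrite mulrBr -h2 -h2'; field; rewrite p0 p0'.
have n1 : 1 - l^-1 <= normc (1 - (phi z)^-1 * (phi (c j))^-1).
  have := normcB 1 ((phi z)^-1 * (phi (c j))^-1); rewrite normc1 normcM !normcV -/l.
  have := normc_phi_gt1 sP hz => f2.
  have : (normc (phi z))^-1 <= 1 by rewrite invf_le1; lra.
  move=> h; have : (normc (phi z))^-1 * l^-1 <= l^-1.
    by rewrite ler_piMl// invr_ge0 ltW.
  by lra.
have := congr1 (@normc R) E; rewrite !normcM normc_nat => En.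
rewrite expr1 mulrAC ler_pdivlMr; last by lra.
by rewrite En ler_wpM2l ?normc_ge0.
Qed.

Lemma zero_factor_continuous l z : ~ segment11 z -> {for z, continuous (zero_factor l)}.
Proof.
move=> hz; apply: cvgD; first by apply: cvgB; [exact: cvg_id|exact: cvg_cst].
by apply: cvgM; [exact: cvg_cst|exact: u_continuous].
Qed.

Lemma zero_factor_vanishes j : vanishes_to (c j) 2 (zero_factor j).
Proof.
have h := vanishes_toM (phi_sub_vanishes j) (phi_sub_vanishes j).
have hc := c_out (j := j).
have hi : vanishes_to (c j) 0 (fun z => (2 * phi z)^-1).
  apply: vanishes_to0; apply: cvgV; first by rewrite mulf_neq0 ?pnatr_eq0// phi_neq0.
  by apply: cvgM; [exact: cvg_cst|exact: phi_continuous].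
have := vanishes_toM h hi; apply: vanishes_to_near.
by apply: filterS (segment11_compl_node j) => z hz _; rewrite zero_factorE// expr2.
Qed.

Lemma zero_product_vanishes j : vanishes_to (c j) (p j * 2) zero_product.
Proof.
have hc := c_out (j := j).
have h0 (r : seq 'I_m) : vanishes_to (c j) 0
    (fun z => \prod_(l <- r | l != j) zero_factor l z ^+ p l).
  elim: r => [|l r IH].
    by exists 1; apply: near_all => z _; rewrite big_nil normc1 expr0 mul1r.
  have hl := vanishes_toM (vanishes_toX (p l)
    (vanishes_to0 (zero_factor_continuous (l := l) hc))) IH.
  rewrite mul0n add0n in hl; have [lj|lj] := eqVneq l j.
    by apply: vanishes_to_near IH; apply: near_all => z _; rewrite big_cons lj eqxx.
  by apply: vanishes_to_near hl; apply: near_all => z _; rewrite big_cons lj.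
have := vanishes_toM (vanishes_toX (p j) (zero_factor_vanishes j)) (h0 (index_enum _)).
rewrite addn0 mulnC; apply: vanishes_to_near; apply: near_all => z _.
by rewrite /zero_product [RHS](bigD1 j).
Qed.

Lemma node_leq_total j : (p j <= total)%N.
Proof. by rewrite /total (bigD1 j)//= leq_addr. Qed.

Lemma size_node_power j n : (n <= p j)%N ->
  size (('X - (c j)%:P) ^+ (p j - n) * conode_poly j) = (total - n).+1.
Proof.
move=> np; have : size (('X - (c j)%:P) ^+ n * (('X - (c j)%:P) ^+ (p j - n) * conode_poly j)) = total.+1.
  rewrite mulrA -exprD subnKC// -node_polyE size_prod => [|l _]; last first.
    by rewrite expf_neq0// polyXsubC_eq0.
  under eq_bigr do rewrite size_exp_XsubC -addn1.
  by rewrite big_split /= sum1_card card_ord -addSn addnK.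
rewrite size_monicM ?rpredX ?monicXsubC//.
  by rewrite size_exp_XsubC /= => h; have := node_leq_total j; move: h np; lia.
rewrite mulf_neq0 ?expf_neq0 ?polyXsubC_eq0//.
by apply/prodf_neq0 => l _; rewrite expf_neq0// polyXsubC_eq0.
Qed.

Lemma size_node_poly : size node_poly = total.+1.
Proof.
rewrite size_prod => [|l _]; last by rewrite expf_neq0// polyXsubC_eq0.
under eq_bigr do rewrite size_exp_XsubC -addn1.
by rewrite big_split /= sum1_card card_ord -addSn addnK.
Qed.

Lemma node_poly_monic : node_poly \is monic.
Proof. by apply: rpred_prod => l _; rewrite rpredX// monicXsubC. Qed.

(** The polynomial with principal parts [b j s / (z - c j) ^ s.+1] over the node
    polynomial. *)
Definition pole_poly (b : 'I_m -> nat -> R[i]) : {poly R[i]} :=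
  \sum_(j < m) \sum_(s < p j)
    b j s *: (('X - (c j)%:P) ^+ (p j - s.+1) * conode_poly j).

Lemma pole_poly_eq0 b : pole_poly b = 0 -> forall j s, (s < p j)%N -> b j s = 0.
Proof.
move=> b0 j; pose B := \sum_(s < p j) b j s *: ('X - (c j)%:P) ^+ (p j - s.+1).
have : ('X - (c j)%:P) ^+ p j %| B * conode_poly j.
  have -> : B * conode_poly j = pole_poly b - \sum_(l < m | l != j)
      \sum_(s < p l) b l s *: (('X - (c l)%:P) ^+ (p l - s.+1) * conode_poly l).
    rewrite /pole_poly (bigD1 j)//= addrK mulr_suml.
    by apply: eq_bigr => s _; rewrite scalerAl.
  rewrite b0 sub0r dvdpNr; apply: (big_ind (fun D => _ %| D)); first exact: dvdp0.
    by move=> D D'; exact: dvdp_add.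
  move=> l lj; apply: (big_ind (fun D => _ %| D)); first exact: dvdp0.
    by move=> D D'; exact: dvdp_add.
  move=> s _; rewrite -mul_polyC !dvdp_mull//.
  by rewrite /conode_poly (bigD1 j) 1?eq_sym//= dvdp_mulr.
rewrite Gauss_dvdpl; last by apply: coprime_nodes; rewrite negbK.
move=> hB; have B0 : B = 0.
  apply/eqP/negPn/negP => /dvdp_leq/(_ hB); rewrite size_exp_XsubC leqNgt => /negP; apply.
  rewrite ltnS (leq_trans (size_sum _ _ _))//; apply/bigmax_leqP => s _.
  by rewrite (leq_trans (size_scale_leq _ _))// size_exp_XsubC; have := ltn_ord s; lia.
have := congr1 (fun D => D \Po ('X + (c j)%:P)) B0.
rewrite /= comp_poly0 /B linear_sum /=.
have XE r : (('X - (c j)%:P) ^+ r) \Po ('X + (c j)%:P) = 'X^r.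
  by rewrite rmorphXn /= comp_polyB comp_polyX comp_polyC addrK.
under eq_bigr do rewrite linearZ /= XE.
rewrite (reindex_inj rev_ord_inj) /=.
have -> : \sum_(i < p j) b j (p j - i.+1)%N *: 'X^(p j - (p j - i.+1).+1) =
    \poly_(i < p j) b j (p j - i.+1)%N :> {poly R[i]}.
  rewrite poly_def; apply: eq_bigr => i _; congr (_ *: 'X^_).
  by have := ltn_ord i; lia.
move=> P0 s sp; have := congr1 (fun D : {poly R[i]} => D`_(p j - s.+1)) P0.
rewrite coef_poly coef0 /=; have -> : (p j - s.+1 < p j)%N by lia.
by have -> : (p j - (p j - s.+1).+1 = s)%N by lia.
Qed.

(** With the Taylor coefficients [t] of [u] at [a], the limit of the quotients of
    [jetnum a (q k.+1) (q k) n] by [q k.+1] as [k] tends to infinity. *)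
Definition remainder (t : nat -> R[i]) (a : R[i]) (n : nat) (z : R[i]) : R[i] :=
  (u z - \sum_(r < n) t r * (z - a) ^+ r) / (z - a) ^+ n.

(** The limit of the Sobolev polynomials of degree [n.+1], normalised, over [q n.+1]. *)
Definition limit_fun (lam : R[i]) (b t : 'I_m -> nat -> R[i]) (z : R[i]) : R[i] :=
  lam + \sum_(j < m) \sum_(s < p j) b j s * remainder (t j) (c j) s.+1 z.

Lemma limit_fun_affine lam b t : exists2 Y, (size (Y - lam *: node_poly)%R <= total)%N &
  forall z, (forall j, z != c j) ->
    limit_fun lam b t z * node_poly.[z] = (pole_poly b).[z] * u z + Y.[z].
Proof.
pose T j s : {poly R[i]} := \sum_(r < s.+1) t j r *: ('X - (c j)%:P) ^+ r.
pose Y0 := \sum_(j < m) \sum_(s < p j)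
    b j s *: (('X - (c j)%:P) ^+ (p j - s.+1) * conode_poly j * T j s).
exists (lam *: node_poly - Y0).
  rewrite addrAC subrr add0r size_polyN.
  rewrite (leq_trans (size_sum _ _ _))//; apply/bigmax_leqP => j _.
  rewrite (leq_trans (size_sum _ _ _))//; apply/bigmax_leqP => s _.
  rewrite (leq_trans (size_scale_leq _ _))//.
  rewrite (leq_trans (size_polyMleq _ _))// size_node_power//.
  have sT : (size (T j s) <= s.+1)%N.
    rewrite (leq_trans (size_sum _ _ _))//; apply/bigmax_leqP => r _.
    by rewrite (leq_trans (size_scale_leq _ _))// size_exp_XsubC.
  have sp := ltn_ord s; have pt := node_leq_total j.
  move: sT pt sp; clear; set a := size _; lia.
move=> z zc; rewrite /limit_fun hornerD hornerN hornerZ.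
have h j (s : 'I_(p j)) : b j s * remainder (t j) (c j) s.+1 z * node_poly.[z] =
    (b j s *: (('X - (c j)%:P) ^+ (p j - s.+1) * conode_poly j)).[z] * u z -
    (b j s *: (('X - (c j)%:P) ^+ (p j - s.+1) * conode_poly j * T j s)).[z].
  rewrite (node_polyE j) !hornerZ !hornerM !horner_exp !hornerXsubC.
  have -> : (T j s).[z] = \sum_(r < s.+1) t j r * (z - c j) ^+ r.
    rewrite horner_sum; apply: eq_bigr => r _.
    by rewrite hornerZ horner_exp hornerXsubC.
  have -> : (z - c j) ^+ p j = (z - c j) ^+ (p j - s.+1) * (z - c j) ^+ s.+1.
    by rewrite -exprD subnK.
  rewrite /remainder; set x := (z - c j) ^+ s.+1.
  have x0 : x != 0 by rewrite expf_neq0// subr_eq0.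
  by field.
have -> : (lam + \sum_(j < m) \sum_(s < p j) b j s * remainder (t j) (c j) s.+1 z) *
    node_poly.[z] = lam * node_poly.[z] +
    \sum_(j < m) \sum_(s < p j) b j s * remainder (t j) (c j) s.+1 z * node_poly.[z].
  rewrite mulrDl mulr_suml; congr (_ + _); apply: eq_bigr => j _.
  by rewrite mulr_suml.
under eq_bigr do under eq_bigr do rewrite h.
under eq_bigr do rewrite sumrB.
rewrite sumrB addrCA; congr (_ + _).
  rewrite /pole_poly horner_sum mulr_suml; apply: eq_bigr => j _.
  by rewrite horner_sum mulr_suml.
congr (_ - _); rewrite /Y0 horner_sum; apply: eq_bigr => j _.
by rewrite horner_sum.
Qed.

Lemma near_other_nodes j : \forall z \near c j, z != c j -> forall l, z != c l.
Proof.
have : \forall z \near c j, forall l : 'I_m, l != j -> z != c l.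
  have FF : Filter (nbhs (c j)) by exact: complex_nbhs_filter.
  apply: (@filter_forall _ _ (fun l z => l != j -> z != c l) (nbhs (c j)) FF) => l.
  have [->|lj] := eqVneq l j; first by apply: near_all => z /eqP.
  have d0 : 0 < normc (c j - c l).
    by rewrite normc_gt0 subr_eq0; apply: contraNneq lj => /c_inj ->.
  apply: filterS (nbhs_normc_ball (c j) d0) => z hz _.
  by apply: contraTneq hz => ->; rewrite normc_sub ltxx.
apply: filterS => z h zc l; have [->//|] := eqVneq l j; exact: h.
Qed.

(** Times the node polynomial, the difference between [limit_fun] and [lam] times
    the explicit solution falls under [limit_problem_unique]: the terms of highest
    degree cancel, so that its degrees are below [total]. *)
Lemma limit_fun_unique lam b t :
  (forall j, vanishes_to (c j) (p j) (limit_fun lam b t)) ->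
  (lam = 0 -> forall j s, (s < p j)%N -> b j s = 0) /\
  (forall z, ~ segment11 z -> (forall j, z != c j) ->
     limit_fun lam b t z * node_poly.[z] = lam * zero_product z).
Proof.
move=> hv; have [Y sY hY] := limit_fun_affine lam b t.
have [X0 [Y0 [sX0 mY0 sY0 hG]]] := zero_product_affine.
have hlim j : vanishes_to (c j) (p j * 2) (fun z => limit_fun lam b t z * node_poly.[z]).
  have hN : vanishes_to (c j) (p j) (horner node_poly).
    have hc : vanishes_to (c j) 0 (horner (conode_poly j)).
      by apply: vanishes_to0; exact: horner_continuous.
    have h1 : vanishes_to (c j) (p j) (fun z => (z - c j) ^+ p j).
      by exists 1; apply: near_all => z _; rewrite normcX mul1r.
    have := vanishes_toM h1 hc; rewrite addn0; apply: vanishes_to_near.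
    apply: near_all => z _.
    by rewrite (node_polyE j) hornerM horner_exp hornerXsubC.
  have := vanishes_toM (hv j) hN; rewrite addnn -muln2; exact.
have sX : (size (pole_poly b) <= total)%N.
  rewrite (leq_trans (size_sum _ _ _))//; apply/bigmax_leqP => j _.
  rewrite (leq_trans (size_sum _ _ _))//; apply/bigmax_leqP => s _.
  rewrite (leq_trans (size_scale_leq _ _))// size_node_power//.
  by have := node_leq_total j; have := ltn_ord s; lia.
pose X1 := pole_poly b - lam *: X0; pose Y1 := Y - lam *: Y0.
have sX1 : (size X1 <= total)%N.
  rewrite (leq_trans (size_polyD _ _))// geq_max sX size_polyN.
  by rewrite (leq_trans (size_scale_leq _ _)).
have sY1 : (size Y1 <= total)%N.
  have -> : Y1 = (Y - lam *: node_poly) - lam *: (Y0 - node_poly).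
    by rewrite /Y1 scalerBr opprB addrA subrK.
  rewrite (leq_trans (size_polyD _ _))// geq_max sY size_polyN.
  rewrite (leq_trans (size_scale_leq _ _))//.
  apply/leq_sizeP => k tk; rewrite coefB.
  have [->|kt] := eqVneq k total.
    have := monicP mY0; rewrite lead_coefE sY0 /= => ->.
    by have := monicP node_poly_monic; rewrite lead_coefE size_node_poly /= => ->; rewrite subrr.
  have kt' : (total < k)%N by rewrite ltn_neqAle eq_sym kt.
  by rewrite !nth_default ?sY0 ?size_node_poly// subrr.
have hXY j : vanishes_to (c j) (p j * 2) (fun z => X1.[z] * u z + Y1.[z]).
  have := vanishes_toD (hlim j) (vanishes_toZ (- lam) (zero_product_vanishes j)).
  apply: vanishes_to_near; apply: filterS2 (segment11_compl_node j) (near_other_nodes j).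
  move=> z hz hn /hn zc; rewrite hY// hG// /X1 /Y1.
  by rewrite !hornerD !hornerN !hornerZ; ring.
have [X10 Y10] := limit_problem_unique sX1 sY1 hXY.
split=> [l0 j s sp|z hz zc].
  apply: pole_poly_eq0 sp; move: X10; rewrite /X1 l0 scale0r subr0//.
rewrite hY// hG//.
have -> : pole_poly b = lam *: X0 by apply/eqP; rewrite -subr_eq0 -/X1 X10.
have -> : Y = lam *: Y0 by apply/eqP; rewrite -subr_eq0 -/Y1 Y10.
by rewrite !hornerZ; ring.
Qed.

End LimitProblem.

(** * Limits of normalised Sobolev polynomials along ultrafilters *)

Section Ultra.
Context {R : realType}.

Lemma ultra_fmap (T T' : Type) (f : T -> T') (U : set_system T) :
  UltraFilter U -> UltraFilter (f @ U).
Proof.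
move=> UU; have UP := ultra_proper; apply: Build_UltraFilter => G PG UG.
apply/seteqP; split=> [A GA|A]; last exact: UG.
have [//|nA] := in_ultra_setVsetC (f @^-1` A) UU.
have /UG GnA : (f @ U) (~` A) by exact: nA.
have := @filterI _ G _ _ _ GA GnA; rewrite setICr => G0.
by case: (@filter_not_empty _ G PG (G0 _)).
Qed.

Lemma bounded_ultra_cvg (x : nat -> R[i]) (U : set_system nat) (M : R) :
  UltraFilter U -> (\forall n \near U, normc (x n) <= M) ->
  exists l : R[i], x @ U --> l.
Proof.
move=> UU xM.
have := @closed_disc_compact R 0 M; rewrite compact_ultra => /(_ (x @ U) (ultra_fmap _ UU)).
have xM' : (x @ U) [set w | normc (w - 0) <= M].
  by apply: filterS xM => n; rewrite /= subr0.
by move=> /(_ xM')[l [_ xl]]; exists l.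
Qed.

(** If the sequence stayed off a neighbourhood of [l] infinitely often, some
    ultrafilter would contain these indices. *)
Lemma cvg_ultra (x : nat -> R[i]) (l : R[i]) :
  (forall U : set_system nat, UltraFilter U -> \oo `<=` U -> x @ U --> l) ->
  x @ \oo --> l.
Proof.
move=> h A lA; apply: contrapT => nA.
pose G : set_system nat := [set B | \oo [set n | ~ A (x n) -> B n]].
have GF : Filter G.
  split; rewrite /G /=.
  - by exists 0%N.
  - move=> B C [k _ hB] [k' _ hC]; exists (maxn k k') => // n /=.
    by rewrite geq_max => /andP[kn k'n] nAn; split; [exact: hB kn nAn|exact: hC k'n nAn].
  - by move=> B C BC; apply: filterS => n h1 nAn; exact: BC (h1 nAn).
have GP : ProperFilter G.
  apply: (@Build_ProperFilter_ex _ G _ GF).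
    move=> B; rewrite /G /= => GB; apply: contrapT => /forallNP nB; apply: nA.
    change (\oo [set n | A (x n)]).
    by apply: filterS GB => n h1; apply: contrapT => /h1; exact: nB.
have [U [UU GU]] := ultraFilterLemma GP.
have UP := @ultra_proper.
have ooU : \oo `<=` U by move=> B oB; apply: GU; rewrite /G /=; apply: filterS oB => n Bn _; exact: Bn.
have UA : U [set n | A (x n)] by exact: (h U UU ooU A lA).
have UnA : U [set n | ~ A (x n)] by apply: GU; exists 0%N => // n _ nA'; exact: nA'.
have [n [An nAn]] := @filter_ex _ U (UP _ _ UU) _ (filterI UA UnA); exact: nAn An.
Qed.

(** A sequence that is not bounded away from 0 tends to 0 along some ultrafilter. *)
Lemma ultra_bounded_below (x : nat -> R[i]) :
  (forall U : set_system nat, UltraFilter U -> \oo `<=` U -> ~ (x @ U --> (0 : R[i]))) ->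
  exists2 d : R, 0 < d & \forall n \near \oo, d <= normc (x n).
Proof.
move=> h; apply: contrapT => hno.
pose G : set_system nat := [set B | exists2 d : R, 0 < d &
  \oo [set n | normc (x n) < d -> B n]].
have GP : ProperFilter G.
  apply: Build_ProperFilter_ex.
    move=> B [d d0 GB]; apply: contrapT => /forallNP nB; apply: hno; exists d => //.
    by apply: filterS GB => n h1; rewrite leNgt; apply/negP => /h1; exact: nB.
  split.
  - by exists 1 => //; exists 0%N.
  - move=> B C [d d0 GB] [d' d'0 GC]; exists (Num.min d d'); first by rewrite lt_min d0.
    by apply: filterS2 GB GC => n hB hC /=; rewrite lt_min => /andP[h1 h2]; split; [exact: hB|exact: hC].
  - by move=> B C BC [d d0 GB]; exists d => //; apply: filterS GB => n h1 nd; exact: BC (h1 nd).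
have [U [UU GU]] := ultraFilterLemma GP.
have UP := @ultra_proper _ _ UU.
have ooU : \oo `<=` U.
  by move=> B oB; apply: GU; exists 1 => //; apply: filterS oB => n Bn _; exact: Bn.
apply: (h U UU ooU); apply/cvg_normcP => e e0; apply: GU; exists e => //.
by exists 0%N => // n _; rewrite /= subr0.
Qed.

Lemma ultra_cvg_sum (I : Type) (r : seq I) (U : set_system nat) (x : I -> nat -> R[i])
    (l : I -> R[i]) : Filter U -> (forall i, x i @ U --> l i) ->
  (fun n => \sum_(i <- r) x i n) @ U --> \sum_(i <- r) l i.
Proof.
move=> FU h; elim: r => [|i r IH].
  have -> : (fun n => \sum_(i <- [::]) x i n) = fun=> 0.
    by apply/funext => n; rewrite big_nil.
  rewrite big_nil; exact: cvg_cst.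
have -> : (fun n => \sum_(i <- i :: r) x i n) =
    (fun n => x i n + \sum_(i <- r) x i n).
  by apply/funext => n; rewrite big_cons.
rewrite big_cons; exact: (cvgD (h i) IH).
Qed.

Lemma cvg_normc_le (U : set_system nat) (x : nat -> R[i]) (l : R[i]) (M : R) :
  ProperFilter U -> x @ U --> l -> (\forall n \near U, normc (x n) <= M) ->
  normc l <= M.
Proof.
move=> PU /cvg_normcP xl xM; rewrite leNgt; apply/negP => Ml.
have e0 : 0 < normc l - M by lra.
have [n [h1 h2]] := filter_ex (filterI xM (xl _ e0)).
by have := normcB l (x n); rewrite normc_sub; move: h1 h2; rewrite /=; lra.
Qed.

End Ultra.

Section SobolevAsymptotics.
Context {R : realType}.
Variables (sq : R[i] -> R[i]) (S0 : set R[i]) (n0 : nat).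
Variables (q : nat -> {poly R[i]}) (alpha beta : nat -> R[i]).
Variables (m : nat) (c : 'I_m -> R[i]) (N : 'I_m -> nat).
Variable L : forall j : 'I_m, 'I_(N j).+1 -> {poly R[i]}.
Hypothesis sP : is_sqrt_branch sq.
Hypothesis qP : perturbed_chebyshev n0 q alpha beta.
Hypothesis segS : forall z, ~ S0 z -> ~ segment11 z.
Hypothesis ndS : forall z, ~ S0 z -> no_decay q z.
Hypothesis openS : forall z, ~ S0 z -> \forall w \near z, ~ S0 w.
Hypothesis c_inj : injective c.
Hypothesis c_out : forall j, ~ S0 (c j).
Hypothesis regL : regular_form L.
Implicit Types (P T S : nat -> {poly R[i]}) (z : R[i]).

Notation u := (joukowski_inv sq).
Notation p := (pruned_dim L).
Notation w n S j s := (sobolev_weight q alpha c L n S j s).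

Let q_neq0 z : ~ S0 z -> \forall a \near locf z, (q a.2.+1).[a.1] != 0.
Proof.
by move=> hz; have := locf_shift (ratio_asymptotics sP qP (segS hz) (ndS hz)).1.
Qed.

Let rho_cvg z : ~ S0 z ->
  (fun a => quot (q a.2) (q a.2.+1) a.1) @ locf z --> u z.
Proof.
move=> hz; have hs := segS hz.
have h := (ratio_asymptotics sP qP hs (ndS hz)).2.
rewrite (uE sP hs); have h' := cvgV (phi_neq0 sP hs) h.
have -> : (fun a => quot (q a.2) (q a.2.+1) a.1) =
    (fun a => ((q a.2.+1).[a.1] / (q a.2).[a.1])^-1).
  by apply/funext => a; rewrite invf_div.
exact: h'.
Qed.

(** This local boundedness is what [locf_lipschitz] asks for; the jets at the nodes
    preserve it. *)
Definition bounded_quotient P z : Prop := exists M : R, \forall a \near locf z,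
  (q a.2.+1).[a.1] != 0 /\ normc (quot (P a.2) (q a.2.+1) a.1) <= M.

Let bnd_q z : ~ S0 z -> bounded_quotient q z.
Proof.
move=> hz; exists (normc (u z) + 1).
exact: (filterI (q_neq0 hz) (locf_cvg_bounded (rho_cvg hz))).
Qed.

Let bnd_1 z : ~ S0 z -> bounded_quotient (fun n => q n.+1) z.
Proof.
move=> hz; exists 1; apply: filterS (q_neq0 hz) => a qa; split => //.
by rewrite /quot divff// normc1.
Qed.

Let bndZ P z (a : nat -> R[i]) (C : R) : (\forall n \near \oo, normc (a n) <= C) ->
  bounded_quotient P z -> bounded_quotient (fun n => a n *: P n) z.
Proof.
move=> aC [M hM]; exists (C * M); apply: filterS2 (locf_snd z aC) hM => b hb [qb Pb].
split => //; rewrite /quot hornerZ -mulrA normcM.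
by apply: ler_pM; rewrite ?normc_ge0.
Qed.

Let bndD P T z : bounded_quotient P z -> bounded_quotient T z ->
  bounded_quotient (fun n => P n + T n) z.
Proof.
move=> [M hM] [M' hM']; exists (M + M'); apply: filterS2 hM hM' => b [qb Pb] [_ Tb].
split => //; rewrite /quot hornerD mulrDl (le_trans (normcD _ _))//.
exact: lerD.
Qed.

Let bnd_sum (I : Type) (r : seq I) (F : I -> nat -> {poly R[i]}) z : ~ S0 z ->
  (forall i, bounded_quotient (F i) z) ->
  bounded_quotient (fun n => \sum_(i <- r) F i n) z.
Proof.
move=> hz hF; elim: r => [|i r IH].
  exists 0; apply: filterS (q_neq0 hz) => b qb; split => //.
  by rewrite big_nil /quot horner0 mul0r normc0.
have [M' hM'] := bndD (hF i) IH; exists M'.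
by apply: filterS hM' => b; rewrite big_cons.
Qed.

Let bnd_near P T z : (\forall n \near \oo, P n = T n) -> bounded_quotient P z ->
  bounded_quotient T z.
Proof.
by move=> PT [M hM]; exists M; apply: filterS2 (locf_snd z PT) hM => b ->.
Qed.

(** Near [d] this is the Schwarz lemma; elsewhere the denominator of the difference
    quotient is bounded below. *)
Let bnd_rshift P d z : bounded_quotient P d -> bounded_quotient P z ->
  bounded_quotient (fun n => rshift d (q n.+1) (P n)) z.
Proof.
move=> [M hM] [M' hM']; have [->|zd] := eqVneq z d.
  have /locfP[e [K [e0 h]]] := hM.
  exists (2 * M / (e / 2)); apply/locfP; exists (e / 2), K; split; first by lra.
  move=> w n we Kn; have hw x : normc (x - d) <= e / 2 -> normc (x - d) < e by lra.
  split; first by apply: (h w n _ Kn).1; lra.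
  apply: (@rshift_bound R d _ _ (e / 2) M) => //.
  - by lra.
  - by move=> x /hw xe; exact: (h x n xe Kn).1.
  - by move=> x /hw xe; exact: (h x n xe Kn).2.
  - exact: ltW.
have d0 : 0 < normc (z - d) / 2 by rewrite divr_gt0// normc_gt0 subr_eq0.
exists ((M + M') / (normc (z - d) / 2)).
have h1 := locf_snd z (locf_at hM).
have h2 := locf_fst (nbhs_normc_ball z d0).
apply: filterS2 (filterI h1 h2) hM' => -[w n] /= [[qd Pd] wz] [qw Pw]; split => //.
rewrite ler_pdivlMr//.
have wd : normc (z - d) / 2 <= normc (w - d).
  have -> : w - d = (z - d) - (z - w) by ring.
  by have := normcB (z - d) (z - w); rewrite (normc_sub z w); lra.
apply: le_trans (ler_wpM2l (normc_ge0 _) wd) _; rewrite -normcM.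
have -> : quot (rshift d (q n.+1) (P n)) (q n.+1) w * (w - d) =
    quot (P n) (q n.+1) w - quot (P n) (q n.+1) d.
  by rewrite (quot_rshift (P n) qd qw) addrAC subrr add0r.
apply: le_trans (normcD _ _) _; rewrite normc_opp; lra.
Qed.

Let bnd_jetnum P j s : (forall z, ~ S0 z -> bounded_quotient P z) ->
  forall z, ~ S0 z -> bounded_quotient (fun n => jetnum (c j) (q n.+1) (P n) s) z.
Proof.
move=> hP; elim: s => [|s IH] z hz; first exact: hP.
by apply: bnd_rshift; apply: IH.
Qed.

Let theta_cvg j r : (fun n => taylor_coef (c j) (q n.+1) r /
    (taylor_coef (c j) (q n.+1) 0 * (n.+1%:R * (sq (c j))^-1) ^+ r)) @ \oo -->
  ((r`!%:R)^-1 : R[i]).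
Proof.
have hj := segS (c_out (j := j)); have nd := ndS (c_out (j := j)).
have s0 := branch_neq0 sP hj.
have h : (fun n => (q n)^`(r).[c j] / (n%:R ^+ r * (q n).[c j])) @ \oo --> (sq (c j))^-1 ^+ r.
  elim: r => [|r IH].
    rewrite expr0; have h1 : (fun=> (1 : R[i])) @ \oo --> (1 : R[i]).
      exact: cvg_cst.
    apply: cvg_trans h1; apply: near_eq_cvg.
    have := locf_at (derivn_ratio sP qP hj nd 0).1; apply: filterS => n /=.
    by rewrite expr0 mul1r => h; rewrite divff.
  have [d0 dr] := derivn_ratio sP qP hj nd r.
  have h : (fun n => (q n)^`(r.+1).[c j] / (n%:R * (q n)^`(r).[c j]) *
      ((q n)^`(r).[c j] / (n%:R ^+ r * (q n).[c j]))) @ \oo --> (sq (c j))^-1 ^+ r.+1.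
    by rewrite exprS; exact: (cvgM (locf_cvg_at dr) IH).
  apply: cvg_trans h; apply: near_eq_cvg.
  have := locf_at d0; apply: filterS => n dn; rewrite exprS.
  set a := _^`(r).[_] in dn *; set b := _^`(r.+1).[_]; set x := (n%:R : R[i]).
  rewrite [LHS](_ : _ = b * (x * x ^+ r * (q n).[c j])^-1 * (a / a)); last first.
    by rewrite !invfM; ring.
  by rewrite divff// mulr1.
have h' := cvgS h.
have sr : ((sq (c j))^-1 ^+ r) != 0 by rewrite expf_neq0// invr_eq0.
have hc : (fun n => (q n.+1)^`(r).[c j] / (n.+1%:R ^+ r * (q n.+1).[c j]) *
    ((sq (c j))^-1 ^+ r * r`!%:R)^-1) @ \oo --> (sq (c j))^-1 ^+ r *
       ((sq (c j))^-1 ^+ r * r`!%:R)^-1.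
  exact: (cvgM h' (cvg_cst _)).
have E : (sq (c j))^-1 ^+ r * ((sq (c j))^-1 ^+ r * r`!%:R)^-1 = (r`!%:R)^-1.
  by rewrite invfM mulrA (divff sr) mul1r.
rewrite E in hc.
have -> : (fun n => taylor_coef (c j) (q n.+1) r /
    (taylor_coef (c j) (q n.+1) 0 * (n.+1%:R * (sq (c j))^-1) ^+ r)) =
  (fun n => (q n.+1)^`(r).[c j] / (n.+1%:R ^+ r * (q n.+1).[c j]) *
    ((sq (c j))^-1 ^+ r * r`!%:R)^-1).
  apply/funext => n; rewrite derivn_horner taylor_coef0 exprMn !invfM.
  have f0 : (r`!%:R : R[i]) != 0 by rewrite pnatr_eq0 -lt0n fact_gt0.
  set F := r`!%:R in f0 *; set A := taylor_coef _ _ _; set B := (_ ^+ r)^-1.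
  set D := (_ ^+ r)^-1.
  rewrite [RHS](_ : _ = (F / F) * (A * ((q n.+1).[c j]^-1 * (B * D)))); last first.

    by ring.
  by rewrite divff// mul1r.
exact: hc.
Qed.

Lemma weights_dominated j (e : R) : 0 < e -> \forall n \near \oo, forall T : {poly R[i]},
  let B := \sum_(s < p j) normc (w n T j s) in
  (forall s, (p j <= s < (N j).+1)%N -> normc (w n T j s) <= e * B) /\
  (forall s, (s < p j)%N -> normc (jet (c j) (q n.+1) T s) <=
     e * (B + \sum_(r < (max_order L j).+1) normc (jet (c j) (q n.+1) T r))).
Proof.
move=> e0; have hj := segS (c_out (j := j)); have nd := ndS (c_out (j := j)).
have s0 := branch_neq0 sP hj; have [_ _ _ acv _] := qP.
have qn := locf_at (q_neq0 (c_out (j := j))).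
have h := @point_domination R (fun r n => taylor_coef (c j) (q n.+1) r)
  (fun n => n.+1%:R * (sq (c j))^-1) (fun n => alpha n.+1) (theta_cvg j).
have {}h := h _ _ _ _ (cvgS acv) _ _ (Gamma L j) (regL j) e e0.
have {}h : \forall n \near \oo, forall (sg : nat -> R[i]) (d : 'I_(N j).+1 -> R[i]),
    (forall i, d i = \sum_k Gamma L j i k * (k`!%:R *
       jet_convolution (fun r n => taylor_coef (c j) (q n.+1) r) n sg k)) ->
    let B := \sum_(s < p j) normc (weight (fun r n => taylor_coef (c j) (q n.+1) r)
      (fun n => alpha n.+1) n d s) in
    (forall s, (p j <= s < (N j).+1)%N -> normc (weight (fun r n => taylor_coef (c j) (q n.+1) r)
      (fun n => alpha n.+1) n d s) <= e * B) /\
    (forall s, (s < p j)%N ->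
       normc (sg s) <= e * (B + \sum_(r < (max_order L j).+1) normc (sg r))).
  apply: h.
  - by apply: filterS filterT => n _; rewrite mulf_neq0 ?invr_eq0// pnatr_eq0.
  - by apply: filterS qn => n; rewrite taylor_coef0.
  - have hc : (fun n => (n.+1%:R : R[i])^-1 * sq (c j)) @ \oo --> (0 * sq (c j) : R[i]).
      exact: (cvgM (cvgS cvg_harmonicC) (cvg_cst _)).
    rewrite mul0r in hc.
    have -> : (fun n : nat => (n.+1%:R * (sq (c j))^-1)^-1) =
        (fun n => (n.+1%:R : R[i])^-1 * sq (c j)).
      by apply/funext => n; rewrite invfM invrK.
    exact: hc.
  - move=> k; have hk := cvgS (locf_cvg_at (power_over_q sP qP hj nd k)).
    have hc : (fun n => (n.+1%:R : R[i]) ^+ k / (q n.+1).[c j] * (sq (c j))^-1 ^+ k) @ \oo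
        --> (0 * (sq (c j))^-1 ^+ k : R[i]).
      exact: (cvgM hk (cvg_cst _)).
    rewrite mul0r in hc.
    have -> : (fun n => (n.+1%:R * (sq (c j))^-1) ^+ k / taylor_coef (c j) (q n.+1) 0) =
        (fun n => (n.+1%:R : R[i]) ^+ k / (q n.+1).[c j] * (sq (c j))^-1 ^+ k).
      by apply/funext => n; rewrite taylor_coef0 exprMn mulrAC.
    exact: hc.
apply: filterS2 qn h => n qn h T; apply: (h (jet (c j) (q n.+1) T)).
move=> i; rewrite /sobolev_data /diffop horner_sum.
have sM : (size (L (j := j) i) <= (max_order L j).+1)%N.
  apply: leq_trans (leqSpred _) _; rewrite ltnS.
  exact: (leq_bigmax (F := fun i : 'I_(N j).+1 => (size (L i)).-1) i).
transitivity (\sum_(k < size (L (j := j) i)) (L i)`_k * (T^`(k)).[c j]).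
  by apply: eq_bigr => k _; rewrite hornerZ.
rewrite (big_ord_widen _ (fun k => (L (j := j) i)`_k * (T^`(k)).[c j]) sM) big_mkcond /=.
apply: eq_bigr => k _; rewrite mxE derivn_horner.
rewrite /jet_convolution -(taylor_coefM_jet T k qn); case: ltnP => // sk.
by rewrite nth_default// mul0r.
Qed.

Definition lead_ratio n (T : {poly R[i]}) : R[i] := T`_n.+1 / lead_coef (q n.+1).

(** The conclusion of [sobolev_representation], which is homogeneous in [T]. *)
Definition represented n (T : {poly R[i]}) : Prop :=
  T = lead_ratio n T *: q n.+1 + \sum_(j < m) \sum_(s < (N j).+1)
    w n T j s *: jetnum (c j) (q n.+1) (q n) s.+1.

(** The size of [T] measured by the weights that can survive in the limit. *)
Definition mass n (T : {poly R[i]}) : R :=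
  normc (lead_ratio n T) + \sum_(j < m) \sum_(s < p j) normc (w n T j s).

Let dim_le j : (p j <= (N j).+1)%N.
Proof. by rewrite -[leqRHS]card_ord max_card. Qed.

Let mass_ge n (T : {poly R[i]}) j s : (s < p j)%N -> normc (w n T j s) <= mass n T.
Proof.
move=> sp; rewrite /mass (bigD1 j)//= (bigD1 (Ordinal sp))//=.
have h1 : 0 <= \sum_(i < p j | i != Ordinal sp) normc (w n T j i).
  by apply: sumr_ge0 => i _; exact: normc_ge0.
have h2 : 0 <= \sum_(i < m | i != j) \sum_(s < p i) normc (w n T i s).
  by apply: sumr_ge0 => i _; apply: sumr_ge0 => k _; exact: normc_ge0.
have := normc_ge0 (lead_ratio n T); lra.
Qed.

Let mass_ge_node n (T : {poly R[i]}) j : \sum_(s < p j) normc (w n T j s) <= mass n T.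
Proof.
rewrite /mass (bigD1 j)//=.
have h2 : 0 <= \sum_(i < m | i != j) \sum_(s < p i) normc (w n T i s).
  by apply: sumr_ge0 => i _; apply: sumr_ge0 => k _; exact: normc_ge0.
have := normc_ge0 (lead_ratio n T); lra.
Qed.

Let mass_ge_lead n (T : {poly R[i]}) : normc (lead_ratio n T) <= mass n T.
Proof.
rewrite /mass lerDl; apply: sumr_ge0 => i _; apply: sumr_ge0 => k _; exact: normc_ge0.
Qed.

Section Normalized.
Variable T : nat -> {poly R[i]}.
Hypothesis T_rep : \forall n \near \oo, represented n (T n).
Hypothesis T_mass : \forall n \near \oo, mass n (T n) = 1.
Hypothesis p_gt0 : forall j, (0 < p j)%N.

Let lam n := lead_ratio n (T n).
Let W j s n := w n (T n) j s.

Let lam_le1 : \forall n \near \oo, normc (lam n) <= 1.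
Proof. by apply: filterS T_mass => n <-; exact: mass_ge_lead. Qed.

Let W_vanish j s : (p j <= s < (N j).+1)%N -> W j s @ \oo --> (0 : R[i]).
Proof.
move=> hs; apply/cvg_normcP => e e0; have e20 : 0 < e / 2 by lra.
apply: filterS2 T_mass (weights_dominated j e20) => n m1 h.
rewrite subr0; have [/(_ s hs) h1 _] := h (T n).
have := mass_ge_node n (T n) j; rewrite m1 => h2.
have : e / 2 * \sum_(s < p j) normc (w n (T n) j s) <= e / 2 * 1.
  by rewrite ler_wpM2l// ltW.
by rewrite /W; lra.
Qed.

Let W_le1 j s : (s < (N j).+1)%N -> \forall n \near \oo, normc (W j s n) <= 1.
Proof.
move=> sN; have [sp|ps] := ltnP s (p j).
  by apply: filterS T_mass => n <-; exact: mass_ge.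
have /W_vanish/cvg_normcP/(_ 1 ltr01) : (p j <= s < (N j).+1)%N by rewrite ps.
by apply: filterS => n; rewrite subr0 => /ltW.
Qed.

Let T_bounded z : ~ S0 z -> bounded_quotient T z.
Proof.
move=> hz.
apply: (@bnd_near (fun n => lam n *: q n.+1 + \sum_(j < m) \sum_(s < (N j).+1)
   W j s n *: jetnum (c j) (q n.+1) (q n) s.+1)).
  by apply: filterS T_rep => n <-.
apply: bndD; first by apply: bndZ lam_le1 _; exact: bnd_1.
apply: bnd_sum => // j; apply: bnd_sum => // s.
by apply: bndZ (W_le1 (ltn_ord s)) _; apply: bnd_jetnum => // w; exact: bnd_q.
Qed.

Let jet_vanish j s : (s < p j)%N ->
  (fun n => jet (c j) (q n.+1) (T n) s) @ \oo --> (0 : R[i]).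
Proof.
move=> sp; set K := (max_order L j).+1.
have [C C0 hC] : exists2 C : R, 0 <= C & \forall n \near \oo,
    \sum_(r < K) normc (jet (c j) (q n.+1) (T n) r) <= C.
  elim: K => [|K [C C0 IH]].
    by exists 0 => //; exists 0%N => // n _ /=; rewrite big_ord0.
  have [M hM] := bnd_jetnum j K T_bounded (c_out (j := j)).
  exists (C + `|M|); first by rewrite addr_ge0.
  have := locf_at hM; apply: filterS2 IH => n IH /= [_ h].
  rewrite big_ord_recr /=; apply: lerD => //.
  by apply: le_trans h _; exact: ler_norm.
apply/cvg_normcP => e e0; pose e' := e / 2 / (1 + C).
have C1 : 0 < 1 + C by lra.
have e'0 : 0 < e' by rewrite /e' !divr_gt0.
near=> n; rewrite subr0.
have m1 : mass n (T n) = 1 by near: n.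
have hc : \sum_(r < K) normc (jet (c j) (q n.+1) (T n) r) <= C by near: n.
have [_ /(_ s sp) h] : let B := \sum_(s < p j) normc (w n (T n) j s) in
  (forall s, (p j <= s < (N j).+1)%N -> normc (w n (T n) j s) <= e' * B) /\
  (forall s, (s < p j)%N -> normc (jet (c j) (q n.+1) (T n) s) <=
     e' * (B + \sum_(r < K) normc (jet (c j) (q n.+1) (T n) r))).
  by near: n; apply: filterS (weights_dominated j e'0) => n; exact.
apply: le_lt_trans h _; have := mass_ge_node n (T n) j; rewrite m1 => h2.
apply: (@le_lt_trans _ _ (e' * (1 + C))).
  by rewrite ler_wpM2l ?(ltW e'0)// lerD.
by rewrite /e' divfK; lra.
Unshelve. all: by end_near. Qed.

Section AlongUltrafilter.
Variable U : set_system nat.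
Hypothesis UU : UltraFilter U.
Hypothesis ooU : \oo `<=` U.

Let PU : ProperFilter U := @ultra_proper _ _ UU.

Let toU (x : nat -> R[i]) (l : R[i]) : x @ \oo --> l -> x @ U --> l.
Proof. by move=> h A /h; exact: ooU. Qed.

Let exists_lim (x : nat -> R[i]) (M : R) : (\forall n \near \oo, normc (x n) <= M) ->
  exists l : R[i], x @ U --> l.
Proof. by move=> /ooU; exact: bounded_ultra_cvg. Qed.

Let jet_q_lim : {t : 'I_m * nat -> R[i] | forall jr : 'I_m * nat,
  (fun n => jet (c jr.1) (q n.+1) (q n) jr.2) @ U --> t jr}.
Proof.
have h : forall jr : 'I_m * nat, exists l : R[i],
    (fun n => jet (c jr.1) (q n.+1) (q n) jr.2) @ U --> l.
  move=> [j r] /=; have [M hM] := bnd_jetnum j r bnd_q (c_out (j := j)).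
  apply: (@exists_lim _ M); have := locf_at hM; apply: filterS => n [_]; exact.
have [t ht] := choice h; by exists t.
Qed.

Let t j r := sval jet_q_lim (j, r).

Let W_lim : {b : 'I_m * nat -> R[i] | forall js : 'I_m * nat,
  (js.2 < (N js.1).+1)%N -> W js.1 js.2 @ U --> b js}.
Proof.
have h : forall js : 'I_m * nat, exists l : R[i],
   (js.2 < (N js.1).+1)%N -> W js.1 js.2 @ U --> l.
  move=> [j s] /=; have [sN|] := boolP (s < (N j).+1)%N; last by exists 0.
  by have [l hl] := exists_lim (W_le1 sN); exists l.
have [b hb] := choice h; by exists b.
Qed.

Let b j s := sval W_lim (j, s).

Let b_vanish j s : (p j <= s < (N j).+1)%N -> b j s = 0.
Proof.
move=> hs; have sN : (s < (N j).+1)%N by case/andP: hs.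
have h1 := (svalP W_lim) (j, s) sN.
exact: (cvg_unique (@norm_hausdorff _ R[i]) h1 (toU (W_vanish hs))).
Qed.

Let lam_lim : {l : R[i] | lam @ U --> l}.
Proof. by apply/cid; exact: exists_lim lam_le1. Qed.

Let l := sval lam_lim.

Let remainder_cvg j s z : ~ S0 z -> z != c j ->
  (fun n => quot (jetnum (c j) (q n.+1) (q n) s) (q n.+1) z) @ U -->
  remainder sq (t j) (c j) s z.
Proof.
move=> hz zc; have zs : (z - c j) ^+ s != 0 by rewrite expf_neq0// subr_eq0.
have h1 : (fun n => quot (q n) (q n.+1) z) @ U --> u z.
  exact: (toU (locf_cvg_at (rho_cvg hz))).
have h2 : (fun n => \sum_(r < s) jet (c j) (q n.+1) (q n) r * (z - c j) ^+ r) @ U -->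
    \sum_(r < s) t j r * (z - c j) ^+ r.
  apply: (@ultra_cvg_sum R 'I_s (index_enum _) U
    (fun r n => jet (c j) (q n.+1) (q n) r * (z - c j) ^+ r)
    (fun r => t j r * (z - c j) ^+ r)) => r.
  exact: (cvgM (svalP jet_q_lim (j, r : nat)) (cvg_cst _)).
have h3 : (fun n => (quot (q n) (q n.+1) z -
    \sum_(r < s) jet (c j) (q n.+1) (q n) r * (z - c j) ^+ r) * ((z - c j) ^+ s)^-1) @ U -->
    remainder sq (t j) (c j) s z.
  exact: (cvgM (cvgB h1 h2) (cvg_cst _)).
apply: cvg_trans h3; apply: near_eq_cvg.
have qz := ooU (locf_at (q_neq0 hz)); have qc := ooU (locf_at (q_neq0 (c_out (j := j)))).
apply: filterS2 qz qc => n qz qc; rewrite {1}/quot.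
have /(congr1 (horner^~ z)) /= := jetnum_expansion (q n) s qc.
rewrite hornerD !hornerM horner_exp hornerXsubC horner_sum => ->.
have -> : \sum_(i < s) (jet (c j) (q n.+1) (q n) i *: ('X - (c j)%:P) ^+ i).[z] =
    \sum_(r < s) jet (c j) (q n.+1) (q n) r * (z - c j) ^+ r.
  by apply: eq_bigr => r _; rewrite hornerZ horner_exp hornerXsubC.
by rewrite /quot; set A := \sum_(_ < _) _; set B := (jetnum _ _ _ _).[z]; field; rewrite zs qz.
Qed.

Let quotient_cvg z : ~ S0 z -> (forall j, z != c j) ->
  (fun n => quot (T n) (q n.+1) z) @ U --> limit_fun sq c p l b t z.
Proof.
move=> hz zc.
have h : (fun n => lam n + \sum_(j < m) \sum_(s < (N j).+1) W j s n *
    quot (jetnum (c j) (q n.+1) (q n) s.+1) (q n.+1) z) @ U -->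
    l + \sum_(j < m) \sum_(s < (N j).+1) b j s * remainder sq (t j) (c j) s.+1 z.
  apply: (cvgD (svalP lam_lim)).
  apply: (@ultra_cvg_sum R 'I_m (index_enum _) U
    (fun j n => \sum_(s < (N j).+1) W j s n *
      quot (jetnum (c j) (q n.+1) (q n) s.+1) (q n.+1) z)
    (fun j => \sum_(s < (N j).+1) b j s * remainder sq (t j) (c j) s.+1 z)) => j.
  apply: (@ultra_cvg_sum R 'I_(N j).+1 (index_enum _) U
    (fun s n => W j s n * quot (jetnum (c j) (q n.+1) (q n) s.+1) (q n.+1) z)
    (fun s => b j s * remainder sq (t j) (c j) s.+1 z)) => s.
  have hb : W j s @ U --> b j s := svalP W_lim (j, s : nat) (ltn_ord s).
  exact: (cvgM hb (@remainder_cvg j s.+1 z hz (zc j))).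
have E : l + \sum_(j < m) \sum_(s < (N j).+1) b j s * remainder sq (t j) (c j) s.+1 z =
    limit_fun sq c p l b t z.
  congr (_ + _); apply: eq_bigr => j _.
  rewrite (big_ord_widen _ (fun s => b j s * remainder sq (t j) (c j) s.+1 z) (dim_le j)).
  rewrite [RHS]big_mkcond /=; apply: eq_bigr => s _; case: ltnP => // ps.
  by rewrite b_vanish ?mul0r// ps ltn_ord.
rewrite E in h; apply: cvg_trans h; apply: near_eq_cvg.
have qz := ooU (locf_at (q_neq0 hz)).
apply: filterS2 qz (ooU T_rep) => n qz repn.
rewrite [RHS]/quot [in RHS](repn : T n = _) hornerD hornerZ mulrDl mulfK//; congr (_ + _).
rewrite horner_sum mulr_suml; apply: eq_bigr => j _.
rewrite horner_sum mulr_suml; apply: eq_bigr => s _.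
by rewrite hornerZ -mulrA.
Qed.

(** The Taylor coefficients of order below [p j] tend to 0, so only the remainder of
    order [p j] contributes to the limit. *)
Let limit_vanishes j : vanishes_to (c j) (p j) (limit_fun sq c p l b t).
Proof.
have [M hM] := bnd_jetnum j (p j) T_bounded (c_out (j := j)).
exists M; have h1 := near_other_nodes c_inj j.
apply: filterS2 (filterI h1 (openS (c_out (j := j)))) (locf_near hM).
move=> z [zn hz] hMz zc; have {zn} zn := zn zc.
have h2 : (fun n => quot (T n) (q n.+1) z - \sum_(r < p j)
    jet (c j) (q n.+1) (T n) r * (z - c j) ^+ r) @ U -->
    limit_fun sq c p l b t z - \sum_(r < p j) 0 * (z - c j) ^+ r.
  apply: (cvgB (quotient_cvg hz zn)).
  apply: (@ultra_cvg_sum R 'I_(p j) (index_enum _) U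
    (fun r n => jet (c j) (q n.+1) (T n) r * (z - c j) ^+ r)
    (fun r => 0 * (z - c j) ^+ r)) => r.
  exact: (cvgM (toU (jet_vanish (ltn_ord r))) (cvg_cst _)).
have E : \sum_(r < p j) 0 * (z - c j) ^+ r = 0 :> R[i].
  by rewrite big1// => r _; rewrite mul0r.
rewrite E subr0 in h2; apply: cvg_normc_le h2 _.
have qc := ooU (locf_at (q_neq0 (c_out (j := j)))).
apply: filterS2 qc (ooU (locf_at hMz)) => n qc /= [qz h].
rewrite {1}/quot; have /(congr1 (horner^~ z)) /= := jetnum_expansion (T n) (p j) qc.
rewrite hornerD !hornerM horner_exp hornerXsubC horner_sum => ->.
have -> : \sum_(i < p j) (jet (c j) (q n.+1) (T n) i *: ('X - (c j)%:P) ^+ i).[z] =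
    \sum_(r < p j) jet (c j) (q n.+1) (T n) r * (z - c j) ^+ r.
  by apply: eq_bigr => r _; rewrite hornerZ horner_exp hornerXsubC.
rewrite mulrDl mulrAC mulfV// mul1r addrAC subrr add0r mulrAC normcM normcX.
by rewrite ler_wpM2r// exprn_ge0// normc_ge0.
Qed.

Let limits := limit_fun_unique sP c_inj (fun j => segS (c_out (j := j))) limit_vanishes.

(** Otherwise uniqueness would make all limit weights vanish, against the
    normalisation. *)
Let l_neq0 : l != 0.
Proof.
apply/eqP => l0; have b0 := limits.1 l0.
pose K := 1 + \sum_(j < m) (p j)%:R : R.
have K0 : 0 < K.
  by rewrite /K ltr_pwDl// sumr_ge0// => j _; rewrite ler0n.
have e0 : 0 < K^-1 by rewrite invr_gt0.
have hl : \forall n \near U, normc (lam n) < K^-1.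
  have /cvg_normcP/(_ _ e0) := svalP lam_lim; apply: filterS => n.
  by rewrite -/l l0 subr0.
have hW : \forall n \near U, forall (j : 'I_m) (s : 'I_(p j)), normc (W j s n) < K^-1.
  apply: filter_forall => j; apply: filter_forall => s.
  have sN : (s < (N j).+1)%N by rewrite (leq_trans (ltn_ord s)).
  have /cvg_normcP/(_ _ e0) := svalP W_lim (j, s : nat) sN; apply: filterS => n /=.
  by rewrite -/(b j s) b0// subr0.
have [n [[m1 h1] h2]] := filter_ex (filterI (filterI (ooU T_mass) hl) hW).
have : mass n (T n) < 1.
  have -> : 1 = K^-1 + \sum_(j < m) \sum_(s < p j) K^-1.
    under eq_bigr do rewrite sumr_const card_ord -mulr_natr mulrC.
    by rewrite -mulr_suml -[X in X + _]mul1r -mulrDl -/K divff// gt_eqF.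
  apply: ltr_leD => //; apply: ler_sum => j _; apply: ler_sum => s _.
  exact/ltW/h2.
by rewrite m1 ltxx.
Qed.

Let lam_not_small : ~ (lam @ U --> (0 : R[i])).
Proof.
move=> h; have e := cvg_unique (@norm_hausdorff _ R[i]) h (svalP lam_lim).
by move: l_neq0; rewrite /l -e eqxx.
Qed.

Let quotient_lead_cvg z : ~ S0 z -> (forall j, z != c j) ->
  (fun n => quot (T n) (q n.+1) z / lam n) @ U -->
  zero_product sq c p z / (node_poly c p).[z].
Proof.
move=> hz zc.
have E : zero_product sq c p z / (node_poly c p).[z] = limit_fun sq c p l b t z * l^-1.
  have n0' : (node_poly c p).[z] != 0.
    rewrite /node_poly horner_prod; apply/prodf_neq0 => j _.
    by rewrite horner_exp hornerXsubC expf_neq0// subr_eq0.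
  have e := limits.2 z (segS hz) zc.
  apply: (mulIf n0'); rewrite divfK// mulrAC e mulrAC mulfV ?mul1r//.
have h' := cvgM (quotient_cvg hz zc) (cvgV l_neq0 (svalP lam_lim)).
rewrite E; exact: h'.
Qed.

Lemma ultra_limits : ~ (lam @ U --> (0 : R[i])) /\
  forall z, ~ S0 z -> (forall j, z != c j) ->
  (fun n => quot (T n) (q n.+1) z / lam n) @ U -->
  zero_product sq c p z / (node_poly c p).[z].
Proof. by split; [exact: lam_not_small|exact: quotient_lead_cvg]. Qed.

End AlongUltrafilter.

Lemma normalized_asymptotics :
  (exists2 d : R, 0 < d & \forall n \near \oo, d <= normc (lam n)) /\
  forall z, ~ S0 z ->
   (exists M : R, \forall a \near locf z, (lam a.2 *: q a.2.+1).[a.1] != 0 /\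
      normc (quot (T a.2) (lam a.2 *: q a.2.+1) a.1) <= M) /\
   (fun n => quot (T n) (lam n *: q n.+1) z) @ \oo -->
     zero_product sq c p z / (node_poly c p).[z].
Proof.
have [d d0 hd] : exists2 d : R, 0 < d & \forall n \near \oo, d <= normc (lam n).
  by apply: ultra_bounded_below => U UU ooU; exact: (ultra_limits UU ooU).1.
split; first by exists d.
have lam0 : \forall n \near \oo, lam n != 0.
  by apply: filterS hd => n; apply: contraTneq => ->; rewrite normc0 -ltNge.
move=> z hz; split.
  have [M hM] := T_bounded hz; exists (M / d).
  apply: filterS2 (locf_snd z (filterI hd lam0)) hM => -[w n] /= [hdn l0] [qz Tz].
  rewrite hornerZ mulf_neq0//; split => //.
  rewrite /quot hornerZ invfM mulrCA normcM normcV mulrC.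
  have dn : 0 < normc (lam n) by lra.
  apply: ler_pM; rewrite ?normc_ge0 ?invr_ge0 ?normc_ge0//.
  by rewrite lef_pV2.
have ratE : (fun n => quot (T n) (lam n *: q n.+1) z) =
    (fun n => quot (T n) (q n.+1) z / lam n).
  by apply/funext => n; rewrite /quot hornerZ invfM mulrCA mulrC.
rewrite ratE; have [zc|/forallNP zc] := pselect (exists j, z = c j); last first.
  apply: cvg_ultra => U UU ooU; apply: (ultra_limits UU ooU).2 => // j.
  by apply/eqP; exact: zc.
have [j zE] := zc; rewrite zE.
have -> : zero_product sq c p (c j) / (node_poly c p).[c j] = 0.
  rewrite (node_polyE c p j) hornerM horner_exp hornerXsubC subrr.
  by rewrite expr0n (gtn_eqF (p_gt0 j)) mul0r invr0 mulr0.
have /cvg_normcP h := jet_vanish (p_gt0 j).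
apply/cvg_normcP => e e0; have ed : 0 < e * d by rewrite mulr_gt0.
apply: filterS2 (h _ ed) hd => n; rewrite !subr0 jet0 => h1 dn.
rewrite [X in X < _]normcM normcV.
rewrite ltr_pdivrMr; last by lra.
by apply: lt_le_trans h1 _; rewrite ler_wpM2l// ltW.
Qed.

End Normalized.

End SobolevAsymptotics.

(** * Ratio asymptotics of the Sobolev polynomials *)

Section Unnormalized.
Context {R : realType}.
Variables (sq : R[i] -> R[i]) (S0 : set R[i]) (n0 : nat).
Variables (q : nat -> {poly R[i]}) (alpha beta : nat -> R[i]).
Variables (m : nat) (c : 'I_m -> R[i]) (N : 'I_m -> nat).
Variable L : forall j : 'I_m, 'I_(N j).+1 -> {poly R[i]}.
Hypothesis sP : is_sqrt_branch sq.
Hypothesis qP : perturbed_chebyshev n0 q alpha beta.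
Hypothesis segS : forall z, ~ S0 z -> ~ segment11 z.
Hypothesis ndS : forall z, ~ S0 z -> no_decay q z.
Hypothesis openS : forall z, ~ S0 z -> \forall w \near z, ~ S0 w.
Hypothesis c_inj : injective c.
Hypothesis c_out : forall j, ~ S0 (c j).
Hypothesis regL : regular_form L.

Notation p := (pruned_dim L).
Notation w n S j s := (sobolev_weight q alpha c L n S j s).
Implicit Types (a : R[i]) (T : {poly R[i]}).

Lemma diffopZ a (D T : {poly R[i]}) : diffop D (a *: T) = a *: diffop D T.
Proof.
rewrite /diffop scaler_sumr; apply: eq_bigr => k _.
by rewrite derivnZ !scalerA mulrC.
Qed.

Lemma diffopD (D T T' : {poly R[i]}) : diffop D (T + T') = diffop D T + diffop D T'.
Proof.
rewrite /diffop -big_split; apply: eq_bigr => k _.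
by rewrite derivnD scalerDr.
Qed.

Lemma sobolev_weightZ a n T j s : w n (a *: T) j s = a * w n T j s.
Proof.
rewrite /sobolev_weight mulrCA; congr (_ * _); rewrite mulr_sumr; apply: eq_bigr => i _.
case: ifP => _; last by rewrite mulr0.
by rewrite /sobolev_data diffopZ hornerZ !mulrA.
Qed.

Lemma lead_ratioZ a n T : lead_ratio q n (a *: T) = a * lead_ratio q n T.
Proof. by rewrite /lead_ratio coefZ mulrA. Qed.

Lemma representedZ a n T : represented q alpha c L n T ->
  represented q alpha c L n (a *: T).
Proof.
rewrite /represented => {1}->; rewrite scalerDr scalerA lead_ratioZ; congr (_ + _).
rewrite scaler_sumr; apply: eq_bigr => j _; rewrite scaler_sumr.
by apply: eq_bigr => s _; rewrite scalerA sobolev_weightZ.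
Qed.

Lemma massZ a n T : mass q alpha c L n (a *: T) = normc a * mass q alpha c L n T.
Proof.
rewrite /mass lead_ratioZ normcM mulrDr mulr_sumr; congr (_ + _).
apply: eq_bigr => j _; rewrite mulr_sumr; apply: eq_bigr => s _.
by rewrite sobolev_weightZ normcM.
Qed.

Lemma mass_ge0 n T : 0 <= mass q alpha c L n T.
Proof.
rewrite /mass addr_ge0 ?normc_ge0//; apply: sumr_ge0 => j _; apply: sumr_ge0 => s _.
exact: normc_ge0.
Qed.

(** The weights of high order being dominated, only the zero polynomial has no mass. *)
Lemma mass_neq0 : \forall n \near \oo, forall T, represented q alpha c L n T ->
  T != 0 -> mass q alpha c L n T != 0.
Proof.
have h : \forall n \near \oo, forall j T s, (p j <= s < (N j).+1)%N ->
    normc (w n T j s) <= 1 * \sum_(s < p j) normc (w n T j s).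
  apply: filter_forall => j.
  by apply: filterS (weights_dominated sP qP segS ndS c_out regL j ltr01) => n h T; have [] := h T.
apply: filterS h => n h T repT; apply: contra_neq => m0.
have [l0 W0] : lead_ratio q n T = 0 /\ forall j, \sum_(s < p j) normc (w n T j s) = 0.
  have hs j : 0 <= \sum_(s < p j) normc (w n T j s).
    by apply: sumr_ge0 => s _; exact: normc_ge0.
  move/eqP: m0; rewrite /mass paddr_eq0 ?normc_ge0//; last by apply: sumr_ge0.
  by rewrite normc_eq0 psumr_eq0// => /andP[/eqP-> /allP W0]; split => // j;
    apply/eqP/W0; rewrite mem_index_enum.
have w0 j (s : 'I_(N j).+1) : w n T j s = 0.
  apply/eqP; rewrite -normc_eq0; have [sp|ps] := ltnP s (p j).
    have := W0 j; move/eqP; rewrite psumr_eq0 => [|i _]; last exact: normc_ge0.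
    by move=> /allP/(_ (Ordinal sp)); apply; rewrite mem_index_enum.
  rewrite eq_le normc_ge0 andbT; have := h j T s; rewrite ps ltn_ord => /(_ isT).
  by rewrite W0 mulr0.
rewrite repT l0 scale0r add0r big1// => j _; rewrite big1// => s _.
by rewrite w0 scale0r.
Qed.

(** The quotient does not change under scaling, so [S] may be normalised to mass 1. *)
Lemma sobolev_asymptotics (S : nat -> {poly R[i]}) :
  (\forall n \near \oo, represented q alpha c L n (S n)) ->
  (\forall n \near \oo, S n != 0) ->
  (forall j, (0 < p j)%N) ->
  (\forall n \near \oo, lead_ratio q n (S n) != 0) /\
  forall z, ~ S0 z ->
   (exists M : R, \forall k \near locf z,
      (lead_ratio q k.2 (S k.2) *: q k.2.+1).[k.1] != 0 /\
      normc (quot (S k.2) (lead_ratio q k.2 (S k.2) *: q k.2.+1) k.1) <= M) /\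
   (fun k => quot (S k.2) (lead_ratio q k.2 (S k.2) *: q k.2.+1) k.1) @ locf z -->
     zero_product sq c p z / (node_poly c p).[z].
Proof.
move=> S_rep S_neq0 p_gt0; pose b n := (mass q alpha c L n (S n))^-1.
pose T n := (b n)%:C *: S n.
have m0 : \forall n \near \oo, mass q alpha c L n (S n) != 0.
  by apply: filterS3 mass_neq0 S_rep S_neq0 => n h h1 h2; exact: h.
have T_rep : \forall n \near \oo, represented q alpha c L n (T n).
  by apply: filterS S_rep => n; exact: representedZ.
have T_mass : \forall n \near \oo, mass q alpha c L n (T n) = 1.
  apply: filterS m0 => n m0; rewrite massZ normc_real ger0_norm ?invr_ge0 ?mass_ge0//.
  by rewrite mulVf.
have b0 : \forall n \near \oo, (b n)%:C != 0.
  by apply: filterS m0 => n m0; rewrite -normc_eq0 normc_real normr_eq0 invr_eq0.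
have [[d d0 hd] hT] :=
  normalized_asymptotics sP qP segS ndS openS c_inj c_out regL T_rep T_mass p_gt0.
split.
  apply: filterS hd => n; apply: contraTneq => h.
  by rewrite lead_ratioZ h mulr0 normc0 -ltNge.
move=> z hz; have [[M hM] cvT] := hT z hz.
have hE n x : (b n)%:C != 0 ->
    quot (T n) (lead_ratio q n (T n) *: q n.+1) x =
    quot (S n) (lead_ratio q n (S n) *: q n.+1) x.
  move=> bn; rewrite /quot lead_ratioZ /T !hornerZ -(mulrA _ (lead_ratio q n (S n))).
  rewrite invfM mulrACA.
  by rewrite mulfV ?mul1r.
have hM' : \forall k \near locf z,
      (lead_ratio q k.2 (S k.2) *: q k.2.+1).[k.1] != 0 /\
      normc (quot (S k.2) (lead_ratio q k.2 (S k.2) *: q k.2.+1) k.1) <= M.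
  apply: filterS2 (locf_snd z b0) hM => -[x n] /= bn; rewrite hE// => -[h1 h2]; split => //.
  by apply: contraNneq h1 => h; rewrite lead_ratioZ -scalerA hornerZ h mulr0.
split; first by exists M.
apply: (locf_lipschitz (P := S) (Q := fun n => lead_ratio q n (S n) *: q n.+1) hM').
apply: cvg_trans cvT; apply: near_eq_cvg.
by apply: filterS b0 => n bn; rewrite hE.
Qed.

End Unnormalized.

(** * Zeros of the orthonormal polynomials and of their derivatives near infinity *)

Section GaussLucas.
Context {R : realType}.
Implicit Types (P Q : {poly R[i]}) (z : R[i]).

Lemma Re_gt_half (x : R[i]) : normc (x - 1) < normc x -> 1 / 2 < complex.Re x.
Proof.
move=> h; have : normc (x - 1) ^+ 2 < normc x ^+ 2.
  by rewrite ltr_pXn2r ?nnegrE ?normc_ge0.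
case: x {h} => a b; rewrite /normc /=.
by rewrite !sqr_sqrtr ?addr_ge0 ?sqr_ge0// subr0 => h; nra.
Qed.

(** Each root [x] contributes [z / (z - x)], which is closer to 1 than to 0
    because [x] is closer to the origin than [z]; so its real part exceeds 1/2. *)
Lemma logderiv_Re z (r : seq R[i]) : (forall x, x \in r -> normc x < normc z) ->
  let Q := \prod_(x <- r) ('X - x%:P) in
  Q.[z] != 0 /\ (size r)%:R / 2 <= complex.Re (z * Q^`().[z] / Q.[z]).
Proof.
elim: r => [|x r IH] hr /=.
  by rewrite big_nil hornerC oner_neq0 derivC hornerC mulr0 !mul0r.
have [Q0 hQ] : let Q := \prod_(x <- r) ('X - x%:P) in
    Q.[z] != 0 /\ (size r)%:R / 2 <= complex.Re (z * Q^`().[z] / Q.[z]).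
  by apply: IH => y yr; apply: hr; rewrite inE yr orbT.
rewrite big_cons; move: Q0 hQ; set Q := \prod_(_ <- _) _ => Q0 hQ.
have xz : normc x < normc z by apply: hr; rewrite inE eqxx.
have zx : z - x != 0.
  by rewrite subr_eq0; apply: contraTneq xz => ->; rewrite ltxx.
rewrite derivM derivXsubC mul1r hornerD !hornerM hornerXsubC mulf_neq0//; split => //.
have -> : z * (Q.[z] + (z - x) * Q^`().[z]) / ((z - x) * Q.[z]) =
    z / (z - x) + z * Q^`().[z] / Q.[z] by field; rewrite Q0 zx.
have : 1 / 2 < complex.Re (z / (z - x)).
  apply: Re_gt_half.
  have -> : z / (z - x) - 1 = x / (z - x) by field.
  by rewrite !normcM ltr_pM2r// normcV invr_gt0 normc_gt0.
by rewrite raddfD /= -[(size r).+1%:R]natr1 mulrDl; lra.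
Qed.

(** Gauss--Lucas for discs centred at the origin. *)
Lemma gauss_lucas_disc P (r : R) : (1 < size P)%N ->
  (forall z, r <= normc z -> P.[z] != 0) ->
  forall z, r <= normc z -> P^`().[z] != 0.
Proof.
move=> sP hP z zr; have [rs PE] := closed_field_poly_normal P.
have P0 : P != 0 by rewrite -size_poly_gt0 ltnW.
have lP : lead_coef P != 0 by rewrite lead_coef_eq0.
have hrs x : x \in rs -> normc x < normc z.
  move=> xr; apply: lt_le_trans zr; rewrite ltNge; apply/negP => /hP; apply/negP.
  by rewrite negbK -[_ == 0]/(root P x) PE rootZ// root_prod_XsubC.
have [Q0 hQ] := logderiv_Re hrs.
rewrite PE derivZ hornerZ mulf_neq0//; apply: contraTneq hQ => ->.
rewrite mulr0 mul0r -ltNge /= divr_gt0// ltr0n.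
move: sP; rewrite PE size_scale// size_prod_XsubC.
by [].
Qed.

Lemma size_derivn_char0 P k : size (P^`(k)) = (size P - k)%N.
Proof.
apply/eqP; rewrite eqn_leq; apply/andP; split.
  apply/leq_sizeP => j hj; rewrite coef_derivn nth_default ?mul0rn//.
  by rewrite -leq_subLR.
have [kP|Pk] := ltnP k (size P); last by have -> : (size P - k = 0)%N by lia.
rewrite -[(size P - k)%N]prednK ?subn_gt0// ltnNge; apply/negP.
move=> /leq_sizeP/(_ _ (leqnn _)); rewrite coef_derivn.
have -> : (k + (size P - k).-1 = (size P).-1)%N by lia.
move/eqP; rewrite -mulr_natr mulf_eq0 pnatr_eq0 -[_ == 0]/(lead_coef P == 0).
rewrite lead_coef_eq0 -size_poly_eq0 => /orP[/eqP h|]; first by rewrite h in kP.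
by rewrite -leqn0 leqNgt ffact_gt0; move: kP; lia.
Qed.

Lemma gauss_lucas_derivn P (r : R) k : (k < size P)%N ->
  (forall z, r <= normc z -> P.[z] != 0) ->
  forall z, r <= normc z -> P^`(k).[z] != 0.
Proof.
move=> + hP; elim: k => [//|k IH] kP; rewrite derivnS; apply: gauss_lucas_disc.
  by rewrite size_derivn_char0; lia.
by apply: IH; exact: ltnW.
Qed.

End GaussLucas.

Section NearInfinity.
Context {R : realType}.
Variables (n0 : nat) (q : nat -> {poly R[i]}) (alpha beta : nat -> R[i]).
Hypothesis qP : perturbed_chebyshev n0 q alpha beta.

(** Far from the origin the recurrence makes the moduli increase. *)
Lemma zero_free_infinity : exists2 r : R, 0 < r & \forall n \near \oo,
  forall z, r <= normc z -> (q n).[z] != 0.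
Proof.
have [sq rec a0 acv bcv] := qP.
have [K _ hK] : \forall n \near \oo, normc (alpha n) <= 1 /\ normc (beta n) <= 1.
  have e2 : 0 < 1 / 2 :> R by lra.
  move/cvg_normcP : acv => /(_ _ e2) h1; move/cvg_normcP : bcv => /(_ 1 ltr01) h2.
  apply: filterS2 h1 h2 => n; rewrite subr0 => h1 /ltW h2; split => //.
  by have := normcB (alpha n) 2^-1; rewrite normcV normc_nat; lra.
pose M := maxn K n0.+1.
have nM n : (M <= n)%N -> [/\ (n0 < n)%N, normc (alpha n) <= 1 & normc (beta n) <= 1].
  by rewrite geq_max => /andP[/hK[]].
have sM : size (q M) = M.+1 by apply: sq; have [/ltnW] := nM M (leqnn _).
have sM1 : size (q M.+1) = M.+2 by apply: sq; have [/ltnW/leqW] := nM M (leqnn _).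
have [T1 T11 h1] : exists2 T : R, 1 <= T & forall z, T <= normc z ->
    (q M).[z] != 0 /\ normc (quot 0 (q M) z) <= 1.
  by apply: quot_infty; rewrite ?size_poly0 ?sM.
have [T2 T21 h2] : exists2 T : R, 1 <= T & forall z, T <= normc z ->
    (q M.+1).[z] != 0 /\ normc (quot (q M) (q M.+1) z) <= 1.
  by apply: quot_infty; rewrite ?sM1 ?sM.
exists (T1 + T2 + 3); first by lra.
exists M => // n Mn z hz.
suff h k : (q (M + k)).[z] != 0 /\ normc (q (M + k)).[z] <= normc (q (M + k).+1).[z].
  by rewrite -(subnKC Mn); exact: (h _).1.
elim: k => [|k [qk IH]].
  rewrite addn0; have z1 : T1 <= normc z by lra.
  have z2 : T2 <= normc z by lra.
  split; first exact: (h1 z z1).1.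
  have [q1 ] := h2 z z2; rewrite /quot normcM normcV ler_pdivrMr ?normc_gt0//.
  by rewrite mul1r.
rewrite addnS; set n' := (M + k)%N in qk IH *.
have q0 : 0 < normc (q n').[z] by rewrite normc_gt0.
split; first by rewrite -normc_gt0; lra.
have [n0n an _] : [/\ (n0 < n')%N, normc (alpha n') <= 1 & normc (beta n') <= 1].
  by apply: nM; rewrite leq_addr.
have [n0n1 an1 bn1] : [/\ (n0 < n'.+1)%N, normc (alpha n'.+1) <= 1 & normc (beta n'.+1) <= 1].
  by apply: nM; rewrite leqW// leq_addr.
have [_ an2 _] : [/\ (n0 < n'.+2)%N, normc (alpha n'.+2) <= 1 & normc (beta n'.+2) <= 1].
  by apply: nM; rewrite !leqW// leq_addr.
have /(congr1 (horner^~ z)) := rec _ n0n1.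
rewrite /= !(hornerD, hornerM, hornerZ, hornerX) /= => E.
have {}E : alpha n'.+2 * (q n'.+2).[z] =
    z * (q n'.+1).[z] - (beta n'.+1 * (q n'.+1).[z] + alpha n'.+1 * (q n').[z]).
  by rewrite E; ring.
have h3 := normcB (z * (q n'.+1).[z]) (beta n'.+1 * (q n'.+1).[z] + alpha n'.+1 * (q n').[z]).
have h4 := normcD (beta n'.+1 * (q n'.+1).[z]) (alpha n'.+1 * (q n').[z]).
rewrite -E !normcM in h3; rewrite !normcM in h4.
have x0 := normc_ge0 (q n'.+1).[z]; have y0 := normc_ge0 (q n'.+2).[z].
have k1 : normc (beta n'.+1) * normc (q n'.+1).[z] <= normc (q n'.+1).[z] by rewrite ler_piMl.
have k2 : normc (alpha n'.+1) * normc (q n').[z] <= normc (q n').[z].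
  by rewrite ler_piMl// ltW.
have k3 : normc (alpha n'.+2) * normc (q n'.+2).[z] <= normc (q n'.+2).[z] by rewrite ler_piMl.
have k4 : 3 * normc (q n'.+1).[z] <= normc z * normc (q n'.+1).[z].
  by rewrite ler_wpM2r//; lra.
by lra.
Qed.

End NearInfinity.

(** * Ratios of derivatives, and the neighbourhood of infinity *)

Section Comparison.
Context {R : realType}.
Variables (S0 : set R[i]) (F tau : R[i] -> R[i]) (L S : nat -> {poly R[i]}).

(** [S] and [L] are asymptotically comparable off [S0], with ratio [F], and the
    derivatives of [L] behave like those of the powers of a function with
    logarithmic derivative [tau]. *)
Definition comparable_polys : Prop :=
  [/\ forall nu z, ~ S0 z ->
        (\forall k \near locf z, (L k.2)^`(nu).[k.1] != 0) /\
        (fun k => (L k.2)^`(nu.+1).[k.1] / (k.2%:R * (L k.2)^`(nu).[k.1])) @ locf z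
          --> tau z,
      forall z, ~ S0 z -> tau z != 0,
      forall z, ~ S0 z -> (fun k => quot (S k.2) (L k.2) k.1) @ locf z --> F z,
      forall z, ~ S0 z -> {for z, continuous F}
    & forall e : R, 0 < e -> exists T : R, forall z, T <= normc z -> normc (F z - 1) < e]
  /\ [/\ \forall n \near \oo, size (L n) = n.+1 /\ size (S n) = n.+1,
      \forall n \near \oo, L n \is monic /\ S n \is monic,
      exists2 r : R, 0 < r & \forall n \near \oo, forall z, r <= normc z -> (L n).[z] != 0,
      exists r : R, forall z, S0 z -> normc z < r
    & forall z, ~ S0 z -> \forall w \near z, ~ S0 w].

Hypothesis LS : comparable_polys.

Let n_neq0 (z : R[i]) : \forall k \near locf z, (k.2%:R : R[i]) != 0.
Proof.
apply: (@locf_snd _ z (fun n => (n%:R : R[i]) != 0)).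
by exists 1%N => // n /= n1; rewrite pnatr_eq0 -lt0n.
Qed.

(** Differentiating adds to the ratio a bounded derivative divided by a
    logarithmic derivative that grows with the degree. *)
Lemma derivn_ratio_cvg nu z : ~ S0 z ->
  (fun k => quot (S k.2)^`(nu) (L k.2)^`(nu) k.1) @ locf z --> F z.
Proof.
have [[hL tau0 hF _ _] _] := LS.
move=> hz; elim: nu => [|nu IH].
  exact: hF.
have [L0 Lt] := hL nu z hz; have [L1 _] := hL nu.+1 z hz.
have hM : \forall k \near locf z, (L k.2)^`(nu).[k.1] != 0 /\
    normc (quot (S k.2)^`(nu) (L k.2)^`(nu) k.1) <= normc (F z) + 1.
  exact: (filterI L0 (locf_cvg_bounded IH)).
have [M hM'] := locf_cauchy (P := fun n => (S n)^`(nu)) (Q := fun n => (L n)^`(nu)) hM.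
have hV : \forall k \near locf z, normc (((L k.2)^`(nu.+1).[k.1] /
    (k.2%:R * (L k.2)^`(nu).[k.1]))^-1) <= normc (tau z)^-1 + 1.
  exact: (locf_cvg_bounded (cvgV (tau0 z hz) Lt)).
pose E (k : R[i] * nat) := (((S k.2)^`(nu)^`().[k.1] * (L k.2)^`(nu).[k.1] -
    (S k.2)^`(nu).[k.1] * (L k.2)^`(nu)^`().[k.1]) / (L k.2)^`(nu).[k.1] ^+ 2) *
    ((L k.2)^`(nu.+1).[k.1] / (k.2%:R * (L k.2)^`(nu).[k.1]))^-1.
have hE : (fun k => E k / k.2%:R) @ locf z --> (0 : R[i]).
  apply: (@locf_bounded_div _ _ _ (M * (normc (tau z)^-1 + 1))).
  apply: filterS2 hM' hV => k h1 h2; rewrite /E normcM.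
  by apply: ler_pM; rewrite ?normc_ge0.
have h : (fun k => quot (S k.2)^`(nu) (L k.2)^`(nu) k.1 + E k / k.2%:R) @ locf z --> F z + 0.
  exact: (cvgD IH hE).
rewrite addr0 in h; apply: cvg_trans h; apply: near_eq_cvg.
apply: filterS3 L0 L1 (n_neq0 z) => k l0 l1 k0.
rewrite /E /quot -!derivnS; set a := (S _)^`(nu.+1).[_]; set b := (S _)^`(nu).[_].
set x := (L _)^`(nu).[_] in l0 *; set y := (L _)^`(nu.+1).[_] in l1 *.
by field; rewrite k0 l0 l1.
Qed.

Lemma size_derivn_sub nu n : (nu <= n)%N ->
  size (L n) = n.+1 -> size (S n) = n.+1 -> L n \is monic -> S n \is monic ->
  (size ((S n)^`(nu) - (L n)^`(nu))%R < size (L n)^`(nu))%N.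
Proof.
move=> nun sL sS mL mS; rewrite -derivnB !size_derivn_char0 sL.
have : (size (S n - L n)%R <= n)%N.
  apply/leq_sizeP => j; rewrite leq_eqVlt coefB => /orP[/eqP<-|nj].
    have := monicP mL; have := monicP mS.
    by rewrite !lead_coefE sL sS /= => -> ->; rewrite subrr.
  by rewrite !nth_default ?sL ?sS// subrr.
by move=> h; rewrite subSn // ltnS leq_sub2r.
Qed.

(** By the maximum principle outside of a disc, the ratio is close to 1 near
    infinity as soon as it is so on a circle. *)
Lemma exterior_ratio nu (e : R) : 0 < e -> exists2 T : R, 0 < T &
  (forall z, T <= normc z -> ~ S0 z /\ normc (F z - 1) < e) /\
  \forall n \near \oo, forall z, T <= normc z ->
    (L n)^`(nu).[z] != 0 /\ normc (quot (S n)^`(nu) (L n)^`(nu) z - 1) < e.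
Proof.
move=> e0; have [[hL _ _ _ Finf] [sizes monics [r1 r10 far] [r2 S0r] _]] := LS.
have e40 : 0 < e / 4 by lra.
have [T0 hT0] := Finf _ e40; pose T := `|T0| + r1 + `|r2|.
have T00 : T0 <= T by have := ler_norm T0; have := normr_ge0 r2; rewrite /T; lra.
have T0r : r1 <= T by have := normr_ge0 T0; have := normr_ge0 r2; rewrite /T; lra.
have T2r : r2 <= T by have := normr_ge0 T0; have := ler_norm r2; rewrite /T; lra.
have Tpos : 0 < T by lra.
have outS z : T <= normc z -> ~ S0 z by move=> Tz /S0r; lra.
exists T => //; split=> [z Tz|].
  by split; [exact: outS|have := hT0 z (le_trans T00 Tz); lra].
have cC : compact [set z : R[i] | normc z = T].
  apply: (@compact_normc _ _ T); last by move=> z ->.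
  apply: (@closed_comp _ _ (@normc R) [set x | x = T]).
    by move=> z _; exact: normc_continuous.
  exact: closed_eq.
have hC : \forall n \near \oo, [set z : R[i] | normc z = T] `<=`
    (fun z => normc (quot (S n)^`(nu) (L n)^`(nu) z - 1) <= e / 2).
  move/compact_near_coveringP : cC; apply => z zT /=.
  have Tz : T <= normc z by rewrite zT.
  have /cvg_normcP/(_ _ e40) := derivn_ratio_cvg nu (outS _ Tz).
  apply: filterS => k h; have h2 := hT0 z (le_trans T00 Tz).
  have := normcD (quot (S k.2)^`(nu) (L k.2)^`(nu) k.1 - F z) (F z - 1).
  by rewrite addrA subrK; lra.
have nun : \forall n \near \oo, (nu <= n)%N by exists nu.
near=> n.
have [sL sS] : size (L n) = n.+1 /\ size (S n) = n.+1 by near: n.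
have [mL mS] : L n \is monic /\ S n \is monic by near: n.
have nn : (nu <= n)%N by near: n.
have fn : forall z, r1 <= normc z -> (L n).[z] != 0 by near: n.
have Cn : [set z : R[i] | normc z = T] `<=`
    (fun z => normc (quot (S n)^`(nu) (L n)^`(nu) z - 1) <= e / 2) by near: n.
have L0 : forall z, T <= normc z -> (L n)^`(nu).[z] != 0.
  move=> z Tz; apply: (@gauss_lucas_derivn _ _ r1) => //; first by rewrite sL ltnS.
  exact: le_trans T0r Tz.
have ratE z : T <= normc z -> quot ((S n)^`(nu) - (L n)^`(nu)) (L n)^`(nu) z =
    quot (S n)^`(nu) (L n)^`(nu) z - 1.
  by move=> /L0 l0; rewrite /quot hornerD hornerN mulrDl mulNr divff.
move=> z Tz; split; first exact: L0.
apply: (@le_lt_trans _ _ (e / 2)); last by lra.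
rewrite -ratE//; apply: (rational_max_exterior Tpos) => //.
  exact: size_derivn_sub.
by move=> x xT; rewrite ratE ?xT//; exact: Cn.
Unshelve. all: by end_near. Qed.

(** By compactness, the part of [C] near infinity being covered by
    [exterior_ratio]. *)
Lemma zeros_excluded (C : set R[i]) : closed C ->
  (forall z, C z -> ~ S0 z /\ F z != 0) ->
  \forall n \near \oo, forall z, C z -> (S n).[z] != 0.
Proof.
move=> clC hC; have [[hL _ hF _ _] _] := LS.
have [T T0 [_ hT]] := exterior_ratio 0 (ltr01 : 0 < (1 : R)).
have cCT : compact (C `&` [set z | normc (z - 0) <= T]).
  apply: (@compact_normc _ _ T).
    by apply: closedI => //; exact: closed_disc_closed.
  by move=> z [_ /=]; rewrite subr0.
have h1 : \forall n \near \oo, C `&` [set z | normc (z - 0) <= T] `<=`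
    (fun z => (S n).[z] != 0).
  move/compact_near_coveringP : cCT; apply => z [Cz _] /=.
  have [hz Fz] := hC z Cz.
  have := locf_cvg_neq0 (hF z hz) Fz; apply: filterS => k /=.
  by rewrite /quot mulf_eq0 negb_or => /andP[].
apply: filterS2 h1 hT => n h1 hT z Cz; have [zT|Tz] := leP (normc z) T.
  by apply: h1; split => //=; rewrite subr0.
have [_ ] := hT z (ltW Tz); apply: contraTneq => h.
by rewrite /quot /= h mul0r sub0r normc_opp normc1 ltxx.
Qed.

End Comparison.

(** * Counting zeros near a node *)

Section Hurwitz.
Context {R : realType}.
Variables (S0 : set R[i]) (F tau : R[i] -> R[i]) (L S : nat -> {poly R[i]}).
Hypothesis LS : comparable_polys S0 F tau L S.

Lemma normc_prod_XsubC_le (rs : seq R[i]) z (b : R) :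
  (forall x, x \in rs -> normc (z - x) <= b) ->
  normc (\prod_(x <- rs) ('X - x%:P)).[z] <= b ^+ size rs.
Proof.
elim: rs => [|x rs IH] h; first by rewrite big_nil hornerC normc1 expr0.
rewrite big_cons hornerM hornerXsubC normcM exprS.
apply: ler_pM; rewrite ?normc_ge0//; first by apply: h; rewrite inE eqxx.
by apply: IH => y yr; apply: h; rewrite inE yr orbT.
Qed.

Lemma normc_prod_XsubC_ge (rs : seq R[i]) z (a : R) : 0 <= a ->
  (forall x, x \in rs -> a <= normc (z - x)) ->
  a ^+ size rs <= normc (\prod_(x <- rs) ('X - x%:P)).[z].
Proof.
move=> a0; elim: rs => [|x rs IH] h; first by rewrite big_nil hornerC normc1 expr0.
rewrite big_cons hornerM hornerXsubC normcM exprS.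
apply: ler_pM; rewrite ?exprn_ge0//; first by apply: h; rewrite inE eqxx.
by apply: IH => y yr; apply: h; rewrite inE yr orbT.
Qed.

Section AtNode.
Variables (c : R[i]) (r a b : R) (d : nat).
Hypothesis r_gt0 : 0 < r.
Hypothesis a_gt0 : 0 < a.
Hypothesis discS : forall z, normc (z - c) <= r -> ~ S0 z.
Hypothesis F_bounds : forall z, normc (z - c) <= r ->
  a * normc (z - c) ^+ d <= normc (F z) <= b * normc (z - c) ^+ d.

Let LS1 := LS.1.

Let L_neq0 : \forall n \near \oo, forall z, normc (z - c) <= r -> (L n).[z] != 0.
Proof.
have := @closed_disc_compact R c r; rewrite compact_near_coveringP.
have [hL _ _ _ _] := LS1.
move=> /(_ _ \oo (fun n z => (L n).[z] != 0) _)/=; apply => z zr.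
exact: (hL 0%N z (discS zr)).1.
Qed.

Let circle_bounds (t : R) : 0 < t <= r -> \forall n \near \oo, forall z,
  normc (z - c) = t -> a * t ^+ d / 2 <= normc (quot (S n) (L n) z) <= 2 * b * t ^+ d.
Proof.
have a0 := a_gt0.
move=> /andP[t0 tr]; have [_ _ hF _ _] := LS1.
have cC : compact [set z : R[i] | normc (z - c) = t].
  apply: (@compact_normc _ _ (normc c + t)).
    apply: (@closed_comp _ _ (fun z => normc (z - c)) [set x | x = t]).
      by move=> z _; exact: normcB_continuous.
    exact: closed_eq.
  by move=> z /= <-; have := normcD (z - c) c; rewrite subrK; lra.
have td : 0 < t ^+ d by rewrite exprn_gt0.
have e0 : 0 < a * t ^+ d / 2 by rewrite !mulr_gt0// invr_gt0.
have := cC; rewrite compact_near_coveringP.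
move=> /(_ _ \oo (fun n z =>
   a * t ^+ d / 2 <= normc (quot (S n) (L n) z) <= 2 * b * t ^+ d) _)/=; apply => z zt.
have zr : normc (z - c) <= r by rewrite zt.
have /cvg_normcP/(_ _ e0) := hF z (discS zr); apply: filterS => k h.
have := F_bounds zr; rewrite zt => /andP[F1 F2].
have h1 := normcB (quot (S k.2) (L k.2) k.1) (F z).
have h2 := normcB (F z) (quot (S k.2) (L k.2) k.1); rewrite normc_sub in h2.
by apply/andP; split; lra.
Qed.

Let no_zero_annulus (t : R) : 0 < t -> \forall n \near \oo, forall z,
  normc (z - c) <= r -> (S n).[z] = 0 -> normc (z - c) < t.
Proof.
move=> t0; have : \forall n \near \oo, forall z,
    ([set z | t <= normc (z - c)] `&` [set z | normc (z - c) <= r]) z -> (S n).[z] != 0.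
  apply: (zeros_excluded LS).
    apply: closedI; last exact: closed_disc_closed.
    apply: (@closed_comp _ _ (fun z => normc (z - c)) [set x | t <= x]).
      by move=> z _; exact: normcB_continuous.
    exact: closed_ge.
  move=> z [/= tz zr]; split; first exact: discS.
  have /andP[F1 _] := F_bounds zr; rewrite -normc_gt0; apply: lt_le_trans F1.
  by rewrite mulr_gt0// exprn_gt0//; lra.
apply: filterS => n h z zr Sz; rewrite ltNge; apply/negP => tz.
by have := h z (conj tz zr); rewrite Sz eqxx.
Qed.

Let circle_point (t : R) : 0 < t -> normc (c + t%:C - c) = t.
Proof. by move=> t0; rewrite addrAC subrr add0r normc_real gtr0_norm. Qed.

Let b_gt0 : 0 < b.
Proof.
have a0 := a_gt0; have r0 := r_gt0.
have h : normc (c + r%:C - c) = r := circle_point r0.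
have := @F_bounds (c + r%:C); rewrite h => /(_ (lexx _))/andP[h1 h2].
have rd : 0 < r ^+ d by rewrite exprn_gt0.
by have := le_trans h1 h2; rewrite ler_pM2r//; lra.
Qed.

(** With more than [d] zeros near [c], the ratio divided by [d + 1] linear factors
    would stay bounded, and the ratio would be too small on a small circle. *)
Let zeros_le : \forall n \near \oo, forall (rs : seq R[i]) Q,
  S n = (\prod_(x <- rs) ('X - x%:P)) * Q ->
  (forall x, x \in rs -> normc (x - c) <= r) -> (size rs <= d)%N.
Proof.
have a0 := a_gt0; have r0 := r_gt0; have b0 := b_gt0.
pose C := 2 * b * r ^+ d / (r / 2) ^+ d.+1.
have C0 : 0 < C by rewrite /C !mulr_gt0 ?exprn_gt0 ?invr_gt0 ?exprn_gt0 //; lra.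
have K0 : 0 < 4 * 2 ^+ d.+1 * C by apply: mulr_gt0 => //; rewrite mulr_gt0 ?exprn_gt0.
(* On the circle of radius [t] the ratio would be at most
   [(2 * t) ^+ d.+1 * C], which is below its lower bound [a * t ^+ d / 2]. *)
pose t := Num.min (r / 2) (a / (4 * 2 ^+ d.+1 * C)).
have t0 : 0 < t.
  have h1 : 0 < a / (4 * 2 ^+ d.+1 * C) by rewrite divr_gt0.
  have h2 : 0 < r / 2 by lra.
  by rewrite /t lt_min h1 h2.
have tr : t <= r / 2 by rewrite /t ge_min lexx.
have ta : t * (4 * 2 ^+ d.+1 * C) <= a.
  rewrite -ler_pdivlMr//.
  by rewrite /t ge_min lexx orbT.
have trr : 0 < t <= r by rewrite t0/=; lra.
have rrr : 0 < r <= r by rewrite r_gt0/=.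
apply: filterS3 L_neq0 (no_zero_annulus t0) (filterI (circle_bounds trr) (circle_bounds rrr)).
move=> n L0 zt [ht hr] rs Q SE rsD; rewrite leqNgt; apply/negP => drs.
pose xs := take d.+1 rs; pose ys := drop d.+1 rs.
have sxs : size xs = d.+1 by rewrite size_takel.
pose Q' := (\prod_(x <- ys) ('X - x%:P)) * Q.
have SE' : S n = (\prod_(x <- xs) ('X - x%:P)) * Q'.
  by rewrite SE /Q' mulrA -big_cat cat_take_drop.
have xst x : x \in xs -> normc (x - c) < t.
  move=> xx; have xr : x \in rs by rewrite -(cat_take_drop d.+1 rs) mem_cat xx.
  apply: zt; first exact: rsD.
  by rewrite SE hornerM (rootP (_ : root _ x)) ?mul0r// root_prod_XsubC.
have ratE z : quot (S n) (L n) z = (\prod_(x <- xs) ('X - x%:P)).[z] * quot Q' (L n) z.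
  by rewrite SE' /quot hornerM mulrA.
have hQ : forall z, normc (z - c) <= r -> normc (quot Q' (L n) z) <= C.
  apply: rational_max_disc => // z zr.
  have /andP[_] := hr z zr; rewrite ratE normcM => h.
  have h1 : (r / 2) ^+ d.+1 <= normc (\prod_(x <- xs) ('X - x%:P)).[z].
    rewrite -sxs; apply: normc_prod_XsubC_ge; first by lra.
    move=> x /xst xc; have -> : z - x = (z - c) - (x - c) by ring.
    by have := normcB (z - c) (x - c); rewrite zr; lra.
  rewrite /C ler_pdivlMr ?exprn_gt0//; last by lra.
  apply: le_trans h; rewrite mulrC ler_wpM2r ?normc_ge0//.
have /andP[h _] := ht _ (circle_point t0).
set z := c + t%:C in h *.
have zct : normc (z - c) = t by exact: circle_point.
have h1 : normc (\prod_(x <- xs) ('X - x%:P)).[z] <= (2 * t) ^+ d.+1.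
  rewrite -sxs; apply: normc_prod_XsubC_le => x /xst xc.
  have -> : z - x = (z - c) + (c - x) by ring.
  by apply: le_trans (normcD _ _) _; rewrite zct (normc_sub c); lra.
have h2 : normc (quot Q' (L n) z) <= C by apply: hQ; rewrite zct; lra.
have : a * t ^+ d / 2 <= (2 * t) ^+ d.+1 * C.
  apply: le_trans h _; rewrite ratE normcM; apply: ler_pM; rewrite ?normc_ge0//.
rewrite exprMn [t ^+ d.+1]exprS.
have td : 0 < t ^+ d by rewrite exprn_gt0.
have -> : 2 ^+ d.+1 * (t * t ^+ d) * C = (t * (4 * 2 ^+ d.+1 * C)) / 4 * t ^+ d by field.
have : (t * (4 * 2 ^+ d.+1 * C)) / 4 * t ^+ d <= a / 4 * t ^+ d.
  by rewrite ler_pM2r// ler_pM2r ?invr_gt0.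
have : 0 < a * t ^+ d by rewrite mulr_gt0.
by lra.
Qed.

(** With fewer than [d] zeros near [c], the product of the corresponding linear
    factors divided by the ratio would stay bounded, and the ratio would be too
    large on a small circle. *)
Let zeros_ge : \forall n \near \oo, forall (rs : seq R[i]) Q,
  S n = (\prod_(x <- rs) ('X - x%:P)) * Q ->
  (forall x, x \in rs -> normc (x - c) <= r) ->
  (forall z, normc (z - c) <= r -> Q.[z] != 0) -> (d <= size rs)%N.
Proof.
have a0 := a_gt0; have r0 := r_gt0; have b0 := b_gt0.
pose C := (2 * r + 1) ^+ d * 2 / (a * r ^+ d).
have C0 : 0 < C.
  by rewrite /C !mulr_gt0 ?invr_gt0 ?mulr_gt0 ?exprn_gt0//; lra.
(* On the circle of radius [2 * t] the product of the linear factors is at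
   least [t ^+ d.-1], but would be at most [K * t ^+ d]. *)
pose K := C * 2 * b * 2 ^+ d.
have K0 : 0 < K.
  rewrite /K; apply: mulr_gt0; last by rewrite exprn_gt0.
  by apply: mulr_gt0 => //; apply: mulr_gt0.
pose t := Num.min (Num.min (r / 2) 1) (1 / (2 * K)).
have t0 : 0 < t.
  have h1 : 0 < 1 / (2 * K) by apply: divr_gt0 => //; apply: mulr_gt0.
  have h2 : 0 < r / 2 by lra.
  by rewrite /t !lt_min h1 h2 ltr01.
have tr : t <= r / 2 by rewrite /t !ge_min lexx.
have t1 : t <= 1 by rewrite /t !ge_min lexx orbT.
have tK : t * (2 * K) <= 1.
  rewrite -ler_pdivlMr; first by rewrite /t ge_min lexx orbT.
  exact: mulr_gt0.
have t20 : 0 < 2 * t by lra.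
have trr : 0 < 2 * t <= r by rewrite t20/=; lra.
have rrr : 0 < r <= r by rewrite r_gt0/=.
apply: filterS3 L_neq0 (no_zero_annulus t0) (filterI (circle_bounds trr) (circle_bounds rrr)).
move=> n L0 zt [ht hr] rs Q SE rsD Q0; rewrite leqNgt; apply/negP => rsd.
have rst x : x \in rs -> normc (x - c) < t.
  move=> xr; apply: zt; first exact: rsD.
  by rewrite SE hornerM (rootP (_ : root _ x)) ?mul0r// root_prod_XsubC.
have AE z : normc (z - c) <= r ->
    (\prod_(x <- rs) ('X - x%:P)).[z] = quot (L n) Q z * quot (S n) (L n) z.
  move=> zr; have q0 := Q0 z zr; have l0 := L0 z zr.
  by rewrite /quot SE hornerM; field; rewrite q0 l0.
have hQ : forall z, normc (z - c) <= r -> normc (quot (L n) Q z) <= C.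
  apply: rational_max_disc => // z zr.
  have /andP[h _] := hr z zr.
  have h1 : normc (\prod_(x <- rs) ('X - x%:P)).[z] <= (2 * r) ^+ size rs.
    apply: normc_prod_XsubC_le => x /rst xc.
    have -> : z - x = (z - c) + (c - x) by ring.
    by apply: le_trans (normcD _ _) _; rewrite zr (normc_sub c); lra.
  have h2 : (2 * r) ^+ size rs <= (2 * r + 1) ^+ d.
    apply: (@le_trans _ _ ((2 * r + 1) ^+ size rs)).
      by apply: lerXn2r; rewrite ?nnegrE; lra.
    by apply: ler_weXn2l; [lra|exact: ltnW].
  rewrite AE ?zr// normcM in h1.
  have ad : 0 < a * r ^+ d by rewrite mulr_gt0// exprn_gt0.
  rewrite /C ler_pdivlMr// -ler_pdivrMr// -mulrA.
  apply: le_trans (le_trans h1 h2); rewrite ler_wpM2l ?normc_ge0//.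
have h2t := circle_point t20; set z := c + (2 * t)%:C in h2t.
have zr : normc (z - c) <= r by rewrite h2t; lra.
have /andP[_ h] := ht _ h2t.
have h1 : t ^+ size rs <= normc (\prod_(x <- rs) ('X - x%:P)).[z].
  apply: normc_prod_XsubC_ge; first exact: ltW.
  move=> x /rst xc; have -> : z - x = (z - c) - (x - c) by ring.
  by have := normcB (z - c) (x - c); rewrite h2t; lra.
have h3 : t ^+ size rs <= C * (2 * b * (2 * t) ^+ d).
  by apply: le_trans h1 _; rewrite AE// normcM ler_pM ?normc_ge0// hQ.
have td : 0 < t ^+ d.-1 by rewrite exprn_gt0.
have h4 : t ^+ d.-1 <= t ^+ size rs.
  by rewrite ler_wiXn2l ?(ltW t0)//; move: rsd; clear; lia.
have : C * (2 * b * (2 * t) ^+ d) = t * (2 * K) / 2 * t ^+ d.-1.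
  have dE : d = d.-1.+1 by rewrite prednK// (leq_ltn_trans _ rsd).
  rewrite /K exprMn [in t ^+ d]dE exprS; by field.
move=> h5; have : t * (2 * K) / 2 * t ^+ d.-1 <= 1 / 2 * t ^+ d.-1.
  by rewrite ler_pM2r// ler_pM2r ?invr_gt0.
by lra.
Qed.

Lemma nzeros_disc : \forall n \near \oo,
  nzeros (S n) [set z | normc (z - c) <= r] = d.
Proof.
have mon := LS.2; have [_ monics _ _ _] := mon.
apply: filterS3 zeros_le zeros_ge monics => n hle hge [_ mS].
rewrite /nzeros; case: closed_field_poly_normal => rs SE /=.
rewrite (monicP mS) scale1r in SE.
pose D : pred R[i] := fun z => z \in [set z : R[i] | normc (z - c) <= r].
have DP z : D z = (normc (z - c) <= r) by rewrite /D; apply/idP/idP; rewrite in_setE.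
rewrite -/D -size_filter; apply/eqP; rewrite eqn_leq.
pose Q := \prod_(x <- [seq x <- rs | ~~ D x]) ('X - x%:P).
have SE' : S n = (\prod_(x <- [seq x <- rs | D x]) ('X - x%:P)) * Q.
  by rewrite SE /Q !big_filter (bigID D).
have hD x : x \in [seq x <- rs | D x] -> normc (x - c) <= r.
  by rewrite mem_filter DP => /andP[].
rewrite (hle _ _ SE' hD) (hge _ _ SE' hD)// => z zr.
rewrite -[_ == 0]/(root Q z) root_prod_XsubC mem_filter DP zr//.
Qed.

(** For large [n], the zeros in the disc lie in any given neighbourhood of [c]. *)
Lemma nzeros_near (U : set R[i]) : nbhs c U -> U `<=` [set z | normc (z - c) <= r] ->
  \forall n \near \oo, nzeros (S n) U = d.
Proof.
move=> /nbhs_normcP[t t0 tU] Ur.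
apply: filterS2 nzeros_disc (no_zero_annulus t0) => n <- ht.
rewrite /nzeros; case: closed_field_poly_normal => rs SE /=.
apply: eq_in_count => z zrs; apply/idP/idP; rewrite !in_setE; first exact: Ur.
move=> zr; apply/tU/ht => //.
by rewrite SE hornerZ (rootP (_ : root _ z)) ?mulr0// root_prod_XsubC.
Qed.

End AtNode.

End Hurwitz.

(** * The limit function *)

Section LimitRatio.
Context {R : realType} (sq : R[i] -> R[i]).
Hypothesis sP : is_sqrt_branch sq.
Variables (m : nat) (c : 'I_m -> R[i]) (p : 'I_m -> nat).
Hypothesis c_inj : injective c.
Hypothesis c_out : forall j, ~ segment11 (c j).
Notation phi := (inv_joukowski sq).
Notation u := (joukowski_inv sq).
Implicit Types (z : R[i]) (j : 'I_m).

Definition limit_ratio z : R[i] := let phi := inv_joukowski sq in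
  \prod_(j < m) ((phi z - phi (c j)) ^+ 2 / (2 * phi z * (z - c j))) ^+ p j.

Lemma limit_ratioE z : ~ segment11 z ->
  zero_product sq c p z / (node_poly c p).[z] = limit_ratio z.
Proof.
move=> hz; rewrite /zero_product /node_poly horner_prod -prodf_div.
apply: eq_bigr => j _; rewrite horner_exp hornerXsubC -expr_div_n (zero_factorE sP)//.
by rewrite -!mulrA -!invfM !mulrA.
Qed.

Let cofactor j z : R[i] := 2 / (phi z * (1 - (phi z)^-1 * (phi (c j))^-1) ^+ 2).

Let cofactor_den_neq0 j z : ~ segment11 z ->
  phi z * (1 - (phi z)^-1 * (phi (c j))^-1) ^+ 2 != 0.
Proof.
move=> hz; rewrite mulf_neq0 ?(phi_neq0 sP hz)// expf_neq0// subr_eq0.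
have h1 := normc_phi_gt1 sP hz; have h2 := normc_phi_gt1 sP (c_out (j := j)).
apply/eqP => /(congr1 (@normc R)); rewrite normc1 normcM !normcV => h.
have : (normc (phi z))^-1 < 1 by rewrite invf_lt1//; lra.
have h3 : (normc (phi (c j)))^-1 < 1 by rewrite invf_lt1//; lra.
have h4 : 0 < (normc (phi z))^-1 by rewrite invr_gt0; lra.
have : (normc (phi z))^-1 * (normc (phi (c j)))^-1 < (normc (phi z))^-1 by rewrite gtr_pMr.
by lra.
Qed.

Let cofactor_neq0 j z : ~ segment11 z -> cofactor j z != 0.
Proof.
by move=> hz; rewrite /cofactor mulf_neq0 ?pnatr_eq0// invr_eq0 cofactor_den_neq0.
Qed.

(** Since [2 * (z - c)] is [(phi z - phi c) * (1 - 1 / (phi z * phi c))], the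
    denominator cancels one of the two zeros of the numerator. *)
Let factorE j z : ~ segment11 z ->
  (phi z - phi (c j)) ^+ 2 / (2 * phi z * (z - c j)) = (z - c j) * cofactor j z.
Proof.
move=> hz; have [->|zc] := eqVneq z (c j); first by rewrite !subrr mul0r expr0n mul0r.
have d0 := cofactor_den_neq0 j hz.
have p0 := phi_neq0 sP hz; have p0' := phi_neq0 sP (c_out (j := j)).
have h2 := phi_add_u sq z; rewrite uE// in h2.
have h2' := phi_add_u sq (c j); rewrite uE// in h2'.
have k0 : 1 - (phi z)^-1 * (phi (c j))^-1 != 0.
  by apply: contraNneq d0 => ->; rewrite expr0n mulr0.
have E : 2 * (z - c j) = (phi z - phi (c j)) * (1 - (phi z)^-1 * (phi (c j))^-1).
  by rewrite mulrBr -h2 -h2'; field; rewrite p0 p0'.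
have zc0 : z - c j != 0 by rewrite subr_eq0.
have E' : phi z - phi (c j) = 2 * (z - c j) / (1 - (phi z)^-1 * (phi (c j))^-1).
  by rewrite E mulfK.
rewrite /cofactor E'; move: k0; set k := 1 - _ => k0.
by field; rewrite zc0 k0 p0.
Qed.

Let cofactor_continuous j z : ~ segment11 z -> {for z, continuous (cofactor j)}.
Proof.
move=> hz; apply: cvgM; first exact: cvg_cst.
apply: cvgV; first exact: cofactor_den_neq0.
have hphi := phi_continuous sP hz.
apply: cvgM; first exact: hphi.
have h : (fun z => 1 - (phi z)^-1 * (phi (c j))^-1) @ z -->
    1 - (phi z)^-1 * (phi (c j))^-1.
  apply: cvgB; first exact: cvg_cst.
  apply: cvgM; last exact: cvg_cst.
  by apply: cvgV hphi; exact: phi_neq0.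
exact: (cvgM h h).
Qed.

Let factor_continuous j z : ~ segment11 z ->
  {for z, continuous (fun z => (z - c j) * cofactor j z)}.
Proof.
move=> hz; apply: cvgM; first by apply: cvgB; [exact: cvg_id|exact: cvg_cst].
exact: cofactor_continuous.
Qed.

Let prod_continuous (r : seq 'I_m) (g : 'I_m -> R[i] -> R[i]) z :
  (forall j, {for z, continuous (g j)}) ->
  {for z, continuous (fun z => \prod_(j <- r) g j z ^+ p j)}.
Proof.
move=> hg.
have hX j n : (fun z => g j z ^+ n) @ z --> g j z ^+ n.
  elim: n => [|n IH]; first by exact: cvg_cst.
  have -> : (fun z => g j z ^+ n.+1) = (fun z => g j z * g j z ^+ n).
    by apply/funext => w; rewrite exprS.
  by rewrite exprS; exact: (cvgM (hg j) IH).
suff h : (fun z => \prod_(j <- r) g j z ^+ p j) @ z --> \prod_(j <- r) g j z ^+ p j.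
  exact: h.
elim: r => [|j r IH].
  have -> : (fun z => \prod_(j <- [::]) g j z ^+ p j) = fun=> 1.
    by apply/funext => w; rewrite big_nil.
  rewrite big_nil; exact: cvg_cst.
have -> : (fun z => \prod_(i <- j :: r) g i z ^+ p i) =
    (fun z => g j z ^+ p j * \prod_(i <- r) g i z ^+ p i).
  by apply/funext => w; rewrite big_cons.
rewrite big_cons; exact: (cvgM (hX j (p j)) IH).
Qed.

Let limit_ratio_factored z : ~ segment11 z ->
  limit_ratio z = \prod_(j < m) ((z - c j) * cofactor j z) ^+ p j.
Proof. by move=> hz; apply: eq_bigr => j _; rewrite factorE. Qed.

Lemma limit_ratio_continuous z : ~ segment11 z -> {for z, continuous limit_ratio}.
Proof.
move=> hz; have := @prod_continuous (index_enum _) (fun j z => (z - c j) * cofactor j z) z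
  (fun j => @factor_continuous j z hz).
move=> h; have {}h : (fun z => \prod_(j < m) ((z - c j) * cofactor j z) ^+ p j) @ z -->
    \prod_(j < m) ((z - c j) * cofactor j z) ^+ p j := h.
rewrite -limit_ratio_factored// in h.
suff h' : limit_ratio @ z --> limit_ratio z by exact: h'.
apply: cvg_trans h; apply: near_eq_cvg.
by apply: filterS (segment11_compl_near hz) => w hw; rewrite limit_ratio_factored.
Qed.

Lemma limit_ratio_neq0 z : ~ segment11 z -> (forall j, z != c j) -> limit_ratio z != 0.
Proof.
move=> hz zc; rewrite limit_ratio_factored//; apply/prodf_neq0 => j _.
by rewrite expf_neq0// mulf_neq0 ?cofactor_neq0// subr_eq0.
Qed.

(** The other factors are continuous and do not vanish at [c j]. *)
Lemma limit_ratio_order j : exists a b : R, 0 < a /\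
  \forall z \near c j, a * normc (z - c j) ^+ p j <= normc (limit_ratio z)
    <= b * normc (z - c j) ^+ p j.
Proof.
have hc := c_out (j := j).
pose g (l : 'I_m) z := if l == j then cofactor j z else (z - c l) * cofactor l z.
pose G z := \prod_(l < m) g l z ^+ p l.
have hG : {for c j, continuous G}.
  apply: (@prod_continuous (index_enum _) g) => l; rewrite /g.
  case: eqP => _; last exact: factor_continuous.
  exact: cofactor_continuous.
have G0 : 0 < normc (G (c j)).
  rewrite normc_gt0; apply/prodf_neq0 => l _; rewrite expf_neq0// /g.
  case: (eqVneq l j) => [_|lj]; first exact: (@cofactor_neq0 j (c j) hc).
  rewrite mulf_neq0 ?cofactor_neq0// subr_eq0; apply: contraNneq lj => /c_inj ->//.
exists (normc (G (c j)) / 2), (2 * normc (G (c j))); split; first by lra.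
have e0 : 0 < normc (G (c j)) / 2 by lra.
move/cvg_normcP : hG => /(_ _ e0) hG.
apply: filterS2 hG (segment11_compl_near hc) => z h hz.
have -> : limit_ratio z = (z - c j) ^+ p j * G z.
  rewrite limit_ratio_factored// /G [LHS](bigD1 j)//= [in RHS](bigD1 j)//= /g eqxx.
  rewrite exprMn -mulrA; congr (_ * (_ * _)); apply: eq_bigr => l lj.
  by rewrite (negPf lj).
rewrite normcM normcX [_ * normc (G z)]mulrC.
have x0 : 0 <= normc (z - c j) ^+ p j by rewrite exprn_ge0// normc_ge0.
have h1 := normcB (G z) (G (c j)); have h2 := normcB (G (c j)) (G z).
rewrite (normc_sub (G (c j))) in h2.
by apply/andP; split; apply: ler_wpM2r => //; lra.
Qed.

(** In terms of [1 / phi] the ratio is rational, with value 1 at 0. *)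
Lemma limit_ratio_infty (e : R) : 0 < e ->
  exists T : R, forall z, T <= normc z -> normc (limit_ratio z - 1) < e.
Proof.
move=> e0.
pose A := \prod_(j < m) ((1 - (phi (c j)) *: 'X) ^+ 2) ^+ p j.
pose B := \prod_(j < m) (1 + 'X ^+ 2 - (2 * c j) *: 'X) ^+ p j.
have A0 : A.[0] = 1.
  rewrite horner_prod big1// => j _.
  by rewrite !horner_exp hornerD hornerN hornerZ hornerX hornerC mulr0 subr0 !expr1n.
have B0 : B.[0] = 1.
  rewrite horner_prod big1// => j _.
  rewrite horner_exp !hornerD hornerN hornerZ horner_exp hornerX hornerC.
  by rewrite mulr0 subr0 expr0n addr0 expr1n.
have B1 : B.[0] != 0 by rewrite B0 oner_neq0.
have /cvg_normcP/(_ _ e0) := quot_continuous (P := A) B1.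
have r0 : quot A B 0 = 1 by rewrite /quot A0 B0 divr1.
rewrite r0 => /nbhs_normcP[d d0 hd].
exists (d^-1 + 2) => z zT.
have d'0 : 0 < d^-1 by rewrite invr_gt0.
have hz : ~ segment11 z.
  move=> [x /= + xz]; rewrite in_itv /= => hx.
  have : `|x| <= 1 by rewrite ler_norml.
  by rewrite -normc_real xz; lra.
have f1 := normc_phi_gt1 sP hz; have p0 := phi_neq0 sP hz.
have u1 : normc (u z) < 1 by rewrite (uE sP hz) normcV invf_lt1//; lra.
have fz : 2 * normc z - 1 <= normc (phi z).
  have := congr1 (@normc R) (phi_add_u sq z); rewrite normcM normc_nat.
  by have := normcD (phi z) (u z); lra.
have ud : normc (u z) < d.
  rewrite (uE sP hz) normcV -[d]invrK ltf_pV2 ?posrE//; lra.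
have := hd (u z); rewrite subr0 => /(_ ud); congr (normc (_ - _) < _).
rewrite /quot /A /B !horner_prod -prodf_div; apply: eq_bigr => j _.
rewrite !horner_exp !hornerD !hornerN !hornerZ horner_exp !hornerX !hornerC.
rewrite -expr_div_n; congr (_ ^+ _).
have h2 := phi_add_u sq z; rewrite (uE sP hz) in h2 *.
have -> : 2 * phi z * (z - c j) = phi z * (2 * z - 2 * c j) by ring.
rewrite -h2.
have -> : phi z - phi (c j) = phi z * (1 - phi (c j) * (phi z)^-1) by field.
have -> : phi z * (phi z + (phi z)^-1 - 2 * c j) =
    phi z ^+ 2 * (1 + (phi z)^-1 ^+ 2 - 2 * c j * (phi z)^-1) by field.
rewrite exprMn invfM mulrACA mulfV ?mul1r// expf_neq0//.
Qed.

End LimitRatio.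

(** * Existence of Sobolev polynomials, and uniform convergence on the sphere *)

Section Existence.
Context {R : realType}.

(** [n] linear conditions on [n + 1] coefficients. *)
Lemma orthogonal_exists (form : {poly R[i]} -> {poly R[i]} -> R[i]) (n : nat) :
  (forall p p' r, form (p + p') r = form p r + form p' r) ->
  (forall a p r, form (a *: p) r = a * form p r) ->
  (forall p r r', form p (r + r') = form p r + form p r') ->
  (forall a p r, form p (a *: r) = a * form p r) ->
  exists2 Q : {poly R[i]}, Q != 0 & (size Q <= n.+1)%N /\ orthogonal_poly form n Q.
Proof.
move=> fDl fZl fDr fZr.
pose A : 'M[R[i]]_(n.+1, n) := \matrix_(k, i) form 'X^i 'X^k.
have K0 : kermx A != 0.
  rewrite -mxrank_eq0 mxrank_ker -lt0n subn_gt0.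
  by apply: leq_ltn_trans (rank_leq_col A) _.
pose v := nz_row (kermx A).
have v0 : v != 0 by rewrite nz_row_eq0.
have vA : v *m A = 0 by apply/sub_kermxP; exact: nz_row_sub.
have f0l r : form 0 r = 0 by rewrite -(scale0r 0) fZl mul0r.
have f0r r : form r 0 = 0 by rewrite -(scale0r 0) fZr mul0r.
have fsuml (k : nat) (F : 'I_k -> {poly R[i]}) r :
    form (\sum_i F i) r = \sum_i form (F i) r.
  exact: (big_morph (form^~ r) (fun x y => fDl x y r) (f0l r)).
have fsumr (k : nat) (F : 'I_k -> {poly R[i]}) r :
    form r (\sum_i F i) = \sum_i form r (F i).
  exact: (big_morph (form r) (fDr r) (f0r r)).
exists (rVpoly v).
  by apply: contra_neq v0 => h; rewrite -[v]rVpolyK h linear0.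
split; first exact: size_poly.
move=> p sp.
have -> : p = \sum_(i < n) p`_i *: 'X^i.
  by rewrite -[LHS](coefK p) poly_def (big_ord_widen_cond _ xpredT (fun i => p`_i *: 'X^i) sp)
    big_mkcond /=; apply: eq_bigr => i _; case: ltnP => // pi; rewrite nth_default ?scale0r.
rewrite fsuml big1// => i _; rewrite fZl.
have := congr1 (fun M : 'rV_n => M 0 i) vA; rewrite !mxE => h.
have -> : rVpoly v = \sum_(k < n.+1) v 0 k *: 'X^k.
  rewrite /rVpoly poly_def; apply: eq_bigr => k _; rewrite insubT//= => kn.
  by congr (v 0 _ *: _); apply: val_inj.
rewrite fsumr -[RHS](mulr0 p`_i); congr (_ * _); rewrite -[RHS]h.
by apply: eq_bigr => k _; rewrite fZr mxE.
Qed.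

End Existence.

Section Sphere.
Context {R : realType}.
Implicit Types (f : R[i] -> R[i]) (z : R[i]).

Lemma value_at_Some f z : {for z, continuous f} -> value_at f (Some z : @sphere R) (f z).
Proof.
move=> fz A Afz; have h : \forall w \near z, A (f w) by exact: fz A Afz.
suff : nbhs (Some z : @sphere R) [set y : @sphere R | y != Some z -> A (oapp f 0 y)] by [].
have : nbhs (Some z : @sphere R) (Some @` [set w | A (f w)]).
  exact: one_point_compactification_some_nbhs.
by apply: filterS => _ [w Aw <-] _.
Qed.

Lemma value_at_None f (l : R[i]) :
  (forall e : R, 0 < e -> exists T : R, forall z, T <= normc z -> normc (f z - l) < e) ->
  value_at f (None : @sphere R) l.
Proof.
move=> h; rewrite /value_at => A /nbhs_normcP[e e0 eA]; have [T hT] := h e e0.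
suff : nbhs (None : @sphere R) [set y : @sphere R | y != None -> A (oapp f 0 y)] by [].
exists [set w : R[i] | normc (w - 0) <= T].
  by split; [exact: closed_disc_compact|exact: closed_disc_closed].
move=> _ [[w /= wT <-] _|-> //]; apply/eA/hT.
by move: wT => /negP; rewrite subr0 -ltNge => /ltW.
Qed.

Lemma near_sphere_Some z (P : nat -> @sphere R -> Prop) :
  (\forall k \near locf z, P k.2 (Some k.1)) ->
  \forall y \near (Some z : @sphere R) & n \near \oo, P n y.
Proof.
move=> [[A B] /= [zA oB] AB]; exists (Some @` A, B) => /=.
  by split => //; exact: one_point_compactification_some_nbhs.
by move=> [_ n] [/= [w Aw <-] Bn]; exact: (AB (w, n)).
Qed.

Lemma near_sphere_None (T : R) (P : nat -> @sphere R -> Prop) :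
  (\forall n \near \oo, (forall z, T <= normc z -> P n (Some z)) /\ P n None) ->
  \forall y \near (None : @sphere R) & n \near \oo, P n y.
Proof.
move=> h; exists ((Some @` ~` [set w : R[i] | normc (w - 0) <= T]) `|` [set None],
  [set n | (forall z, T <= normc z -> P n (Some z)) /\ P n None]) => /=.
  split => //; exists [set w : R[i] | normc (w - 0) <= T] => //.
  by split; [exact: closed_disc_compact|exact: closed_disc_closed].
move=> [y n] [/= [[w /= wT <-]|->] [h1 h2]] //; apply: h1.
by move: wT => /negP; rewrite subr0 -ltNge => /ltW.
Qed.

End Sphere.

Section Conclusions.
Context {R : realType}.
Variables (S0 : set R[i]) (F tau : R[i] -> R[i]) (L S : nat -> {poly R[i]}).
Hypothesis LS : comparable_polys S0 F tau L S.

(** By compactness it suffices to prove a bound near each point of [K]: near a finite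
    point it is locally uniform convergence, near infinity it is [exterior_ratio]. *)
Lemma uniform_convergence nu (K : set (@sphere R)) : compact K ->
  K `&` (Some @` S0) = set0 ->
  cvg_uniformly_on K (fun n z => (S n)^`(nu).[z] / (L n)^`(nu).[z]) F.
Proof.
move=> cK KS e e0; have [[hL _ _ Fc Finf] [sizes monics _ _ openS]] := LS.
pose P n (z : @sphere R) := exists u l : R[i],
  [/\ value_at (fun z => (S n)^`(nu).[z] / (L n)^`(nu).[z]) z u, value_at F z l
    & normc (u - l) < e].
suff : \forall n \near \oo, K `<=` (fun z => P n z) by apply: filterS => n.
move/compact_near_coveringP : cK; apply => -[w|] Kw /=.
  have hw : ~ S0 w.
    move=> Sw; suff : set0 (Some w : @sphere R) by [].
    by rewrite -KS; split => //; exists w.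
  apply: near_sphere_Some.
  have e20 : 0 < e / 2 by lra.
  have /cvg_normcP/(_ _ e20) h1 := derivn_ratio_cvg LS nu hw.
  have /cvg_normcP/(_ _ e20) hF := Fc w hw.
  apply: filterS3 h1 (hL nu w hw).1 (locf_fst (filterI hF (openS w hw))) => k hk1 l0 [h2 hk].
  exists (quot (S k.2)^`(nu) (L k.2)^`(nu) k.1), (F k.1); split.
  - by apply: (value_at_Some (f := quot (S k.2)^`(nu) (L k.2)^`(nu))); exact: quot_continuous.
  - by apply: value_at_Some; exact: Fc.
  - have -> : quot (S k.2)^`(nu) (L k.2)^`(nu) k.1 - F k.1 =
        (quot (S k.2)^`(nu) (L k.2)^`(nu) k.1 - F w) + (F w - F k.1) by ring.
    by apply: le_lt_trans (normcD _ _) _; rewrite (normc_sub (F w)); move: hk1 h2; lra.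
have e20 : 0 < e / 2 by lra.
have [T T0 [hF hT]] := exterior_ratio LS nu e20.
apply: (@near_sphere_None _ T).
have nun : \forall n \near \oo, (nu <= n)%N by exists nu.
apply: filterS3 hT nun (filterI sizes monics) => n hT nn [[sL sS] [mL mS]]; split.
  move=> z Tz; have [l0 h1] := hT z Tz; have [hz h2] := hF z Tz.
  exists (quot (S n)^`(nu) (L n)^`(nu) z), (F z); split.
  - by apply: (value_at_Some (f := quot (S n)^`(nu) (L n)^`(nu))); exact: quot_continuous.
  - by apply: value_at_Some; exact: Fc.
  - have -> : quot (S n)^`(nu) (L n)^`(nu) z - F z =
        (quot (S n)^`(nu) (L n)^`(nu) z - 1) + (1 - F z) by ring.
    by apply: le_lt_trans (normcD _ _) _; rewrite (normc_sub 1); move: h1 h2; lra.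
exists 1, 1; split; last by rewrite subrr normc0.
  apply: value_at_None => d d0.
  have d20 : 0 < d / 2 by lra.
  have [T' _ hT'] := quot_infty (size_derivn_sub nn sL sS mL mS) d20.
  exists T' => z /hT'[l0]; rewrite /quot hornerD hornerN mulrDl mulNr divff// => h.
  by apply: le_lt_trans h _; lra.
exact: value_at_None.
Qed.

End Conclusions.

(** * Location of the zeros, and conclusion *)

Section ZeroLocation.
Context {R : realType}.
Variables (sq : R[i] -> R[i]) (m : nat) (c : 'I_m -> R[i]) (p : 'I_m -> nat).
Variables (S0 : set R[i]) (tau : R[i] -> R[i]) (L S : nat -> {poly R[i]}).
Hypothesis sP : is_sqrt_branch sq.
Hypothesis c_inj : injective c.
Hypothesis segS : forall z, ~ S0 z -> ~ segment11 z.
Hypothesis c_out : forall j, ~ S0 (c j).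
Hypothesis LS : comparable_polys S0 (limit_ratio sq c p) tau L S.

Let good_disc (a b : R) (j : 'I_m) (z : R[i]) : Prop :=
  ~ S0 z /\ a * normc (z - c j) ^+ p j <= normc (limit_ratio sq c p z)
    <= b * normc (z - c j) ^+ p j.

Let good_near j : exists a b : R, 0 < a /\ \forall z \near c j, good_disc a b j z.
Proof.
have [a [b [a0 h]]] := limit_ratio_order sP p c_inj (fun j => segS (c_out (j := j))) j.
have [_ [_ _ _ _ openS]] := LS.
by exists a, b; split => //; apply: filterS2 h (openS _ (c_out (j := j))).
Qed.

Lemma node_attracts j : exists2 U0, nbhs (c j) U0 &
  forall U, nbhs (c j) U -> U `<=` U0 -> \forall n \near \oo, nzeros (S n) U = p j.
Proof.
have [a [b [a0 /nbhs_normcP[e e0 h]]]] := good_near j.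
have e20 : 0 < e / 2 by lra.
exists [set z | normc (z - c j) <= e / 2].
  by apply: filterS (nbhs_normc_ball (c j) e20) => z /ltW.
move=> U; apply: (nzeros_near (b := b) LS e20 a0) => z ze.
  by have [] : good_disc a b j z by apply: h; lra.
by have [] : good_disc a b j z by apply: h; lra.
Qed.

Lemma near_all_nodes (P : 'I_m -> R[i] -> Prop) :
  (forall j, \forall z \near c j, P j z) ->
  exists2 r : R, 0 < r & forall j z, normc (z - c j) <= r -> P j z.
Proof.
move=> h.
have : \forall r \near (0 : R)^'+, forall j z, normc (z - c j) <= r -> P j z.
  apply: filter_forall => j; have /nbhs_normcP[e e0 he] := h j.
  near=> r => z zr; apply: he; apply: le_lt_trans zr _.
  by near: r; exact: nbhs_right_lt.
move=> hr; near (0 : R)^'+ => r; exists r; first by near: r; exact: nbhs_right_gt.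
by near: r.
Unshelve. all: by end_near. Qed.

(** The zeros that lie neither in [V] nor in small disjoint discs about the nodes are
    excluded for large [n]; each disc contains [p j] zeros, and there are [n] in all. *)
Lemma zeros_concentrate (V : set R[i]) : S0 `<=` interior V ->
  (forall j, ~ closure V (c j)) ->
  \forall n \near \oo, (nzeros (S n) V + \sum_(j < m) p j)%N = n.
Proof.
move=> SV cV.
pose Q j (x : R * R) := 0 < x.1 /\ \forall z \near c j, good_disc x.1 x.2 j z.
have [ab hab] : {ab : 'I_m -> R * R & forall j, Q j (ab j)}.
  by apply: (@choice _ _ Q) => j; have [a [b h]] := good_near j; exists (a, b).
pose P j z := [/\ good_disc (ab j).1 (ab j).2 j z, ~ closure V z &
  forall l, l != j -> normc (z - c j) < normc (z - c l)].
have [r r0 hr] : exists2 r : R, 0 < r & forall j z, normc (z - c j) <= r -> P j z.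
  apply: near_all_nodes => j.
  have h1 : \forall z \near c j, ~ closure V z.
    by have := open_nbhs_nbhs (conj (closed_openC (@closed_closure _ V)) (cV j)).
  have h2 : \forall z \near c j, forall l : 'I_m, l != j -> normc (z - c j) < normc (z - c l).
    have FF : Filter (nbhs (c j)) by exact: complex_nbhs_filter.
    apply: (@filter_forall _ _ (fun l z => l != j -> normc (z - c j) < normc (z - c l))
      (nbhs (c j)) FF) => l.
    have [->|lj] := eqVneq l j; first by apply: near_all => z /eqP.
    have d0 : 0 < normc (c j - c l) / 2.
      by rewrite divr_gt0// normc_gt0 subr_eq0; apply: contraNneq lj => /c_inj ->.
    apply: filterS (nbhs_normc_ball (c j) d0) => z hz _.
    have -> : z - c l = (c j - c l) - (c j - z) by ring.
    by have := normcB (c j - c l) (c j - z); rewrite (normc_sub (c j) z); lra.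
  by apply: filterS3 (hab j).2 h1 h2 => z ? ? ?; split.
pose D j := [set z : R[i] | normc (z - c j) <= r].
have hD : \forall n \near \oo, forall j, nzeros (S n) (D j) = p j.
  apply: filter_forall => j; apply: (nzeros_disc (b := (ab j).2) LS r0 (hab j).1).
  - by move=> z /hr[[]].
  - by move=> z /hr[[_]].
pose C := ~` interior V `&` \bigcap_(j in [set: 'I_m]) [set z | r <= normc (z - c j)].
have hC : \forall n \near \oo, forall z, C z -> (S n).[z] != 0.
  apply: (zeros_excluded LS).
    apply: closedI; first by apply: open_closedC; exact: open_interior.
    apply: closed_bigI => j _.
    apply: (@closed_comp _ _ (fun z => normc (z - c j)) [set x | r <= x]).
      by move=> z _; exact: normcB_continuous.
    exact: closed_ge.
  move=> z [/= Vz zc]; have hz : ~ S0 z by move/SV.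
  split => //; apply: (limit_ratio_neq0 sP p (fun j => segS (c_out (j := j))) (segS hz)) => j.
  by apply: contraTneq r0 => zj; have := zc j I; rewrite /= zj subrr normc0 -leNgt.
have [_ [sizes monics _ _ _]] := LS.
apply: filterS3 hD hC (filterI sizes monics) => n hDn hCn [[_ sS] [_ mS]].
under eq_bigr do rewrite -hDn.
rewrite /nzeros; case: closed_field_poly_normal => rs SE /=.
rewrite (monicP mS) scale1r in SE.
have srs : size rs = n by have := sS; rewrite SE size_prod_XsubC => -[].
rewrite -sum1_count big_mkcond; under [X in (_ + X)%N]eq_bigr do rewrite -sum1_count big_mkcond.
rewrite exchange_big -big_split -[RHS]srs -sum1_size /=; apply: eq_big_seq => z zrs.
have Sz : (S n).[z] = 0 by apply/rootP; rewrite SE root_prod_XsubC.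
have DV j : D j z -> ~ V z.
  by move=> /hr[_ Vz _] /subset_closure.
have Dinj j l : D j z -> D l z -> j = l.
  move=> Dj Dl; apply/eqP/negPn/negP => jl.
  have [_ _ /(_ l)] := hr j z Dj; rewrite eq_sym => /(_ jl) h1.
  by have [_ _ /(_ j jl) h2] := hr l z Dl; have := lt_trans h1 h2; rewrite ltxx.
have [Vz|nVz] := pselect (V z).
  rewrite mem_set// big1// => j _; rewrite memNset// => Dj; exact: DV Dj Vz.
rewrite memNset// add0n.
have [j Dj] : exists j, D j z.
  apply: contrapT => /forallNP nD; have nC : ~ C z by move/hCn; rewrite Sz eqxx.
  apply: nC; split; first by move=> /interior_subset.
  by move=> j _ /=; rewrite leNgt; apply/negP => /ltW; exact: nD.
rewrite (bigD1 j)//= mem_set// big1// => l lj; rewrite memNset// => Dl.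
by move: lj; rewrite (Dinj _ _ Dl Dj) eqxx.
Unshelve. all: by end_near. Qed.

End ZeroLocation.

Section Assembly.
Context {R : realType}.

Lemma locf_cvg_unshift (z : R[i]) (f : R[i] * nat -> R[i]) (l : R[i]) :
  (fun k => f (k.1, k.2.+1)) @ locf z --> l -> f @ locf z --> l.
Proof.
move=> /cvg_normcP h; apply/cvg_normcP => e /h /locfP[d [N [d0 hN]]].
apply/locfP; exists d, N.+1; split => // x [//|n] xd Nn; exact: (hN x n xd Nn).
Qed.

Lemma near_unshift (P : nat -> Prop) : (\forall n \near \oo, P n.+1) -> \forall n \near \oo, P n.
Proof. by move=> [N _ h]; exists N.+1 => // -[//|n] /h. Qed.

Variables (sq : R[i] -> R[i]) (mu : complex_measure R) (m : nat) (c : 'I_m -> R[i]).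
Variables (N : 'I_m -> nat) (L : forall j : 'I_m, 'I_(N j).+1 -> {poly R[i]}).
Variables (Ln Sn : nat -> {poly R[i]}).
Hypothesis sP : is_sqrt_branch sq.
Hypothesis muM : classM mu.
Hypothesis c_inj : injective c.
Hypothesis c_out : forall j, ~ supp mu (c j).
Hypothesis L_neq0 : forall j, L (j := j) ord_max != 0.
Hypothesis regL : regular_form L.
Hypothesis LnP : forall n, monic_orthogonal (integral_form mu) n (Ln n).
Hypothesis SnP : forall n, monic_orthogonal (sobolev_form mu c L) n (Sn n).

Lemma pruned_dim_gt0 j : (0 < pruned_dim L j)%N.
Proof.
apply/card_gt0P; exists ord_max; rewrite inE; apply/eqP => /rowP h.
have /negP := L_neq0 j; apply; rewrite -lead_coef_eq0 lead_coefE.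
have sk : ((size (L (j := j) ord_max)).-1 < (max_order L j).+1)%N.
  by rewrite ltnS; exact: (leq_bigmax (F := fun i : 'I_(N j).+1 => (size (L i)).-1) ord_max).
by have := h (Ordinal sk); rewrite !mxE => /= ->.
Qed.

Let cS : compact (supp mu). Proof. exact: muM.1. Qed.

Let supp_out z : ~ supp mu z -> ~ segment11 z.
Proof. by have [_ [[E [_ _ _ ->]] _]] := muM; move=> h s; apply: h; left. Qed.

Lemma sobolev_form_linear :
  [/\ forall p p' r, sobolev_form mu c L (p + p') r =
        sobolev_form mu c L p r + sobolev_form mu c L p' r,
      forall a p r, sobolev_form mu c L (a *: p) r = a * sobolev_form mu c L p r,
      forall p r r', sobolev_form mu c L p (r + r') =
        sobolev_form mu c L p r + sobolev_form mu c L p r'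
    & forall a p r, sobolev_form mu c L p (a *: r) = a * sobolev_form mu c L p r].
Proof.
rewrite /sobolev_form; split.
- move=> p p' r; rewrite !integral_formE mulrDl (intpD _ _ cS) addrACA; congr (_ + _).
  rewrite -big_split; apply: eq_bigr => j _; rewrite -big_split; apply: eq_bigr => i _.
  by rewrite derivnD hornerD mulrDl.
- move=> a p r; rewrite !integral_formE -scalerAl (intpZ _ _ cS) mulrDr; congr (_ + _).
  rewrite mulr_sumr; apply: eq_bigr => j _; rewrite mulr_sumr; apply: eq_bigr => i _.
  by rewrite derivnZ hornerZ mulrA.
- move=> p r r'; rewrite !integral_formE mulrDr (intpD _ _ cS) addrACA; congr (_ + _).
  rewrite -big_split; apply: eq_bigr => j _; rewrite -big_split; apply: eq_bigr => i _.
  by rewrite diffopD hornerD mulrDr.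
- move=> a p r; rewrite !integral_formE -scalerAr (intpZ _ _ cS) mulrDr; congr (_ + _).
  rewrite mulr_sumr; apply: eq_bigr => j _; rewrite mulr_sumr; apply: eq_bigr => i _.
  by rewrite diffopZ hornerZ mulrCA.
Qed.

Lemma size_sobolev_poly n : (size (Sn n) <= n.+1)%N.
Proof.
have [h1 h2 h3 h4] := sobolev_form_linear.
have [Q Q0 [sQ oQ]] := orthogonal_exists n h1 h2 h3 h4.
by have [_ _ /(_ Q Q0 oQ) h] := SnP n; exact: leq_trans h sQ.
Qed.

(** The representation of index [n] describes the Sobolev polynomial of degree
    [n.+1], whence the shifts of indices. *)
Lemma sobolev_comparable :
  comparable_polys (supp mu) (limit_ratio sq c (pruned_dim L)) (fun z => (sq z)^-1) Ln Sn.
Proof.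
have [_ [_ [n0 [q [alpha [beta [hq rec acv bcv bnd]]]]]]] := muM.
have size_q n : (n0 <= n)%N -> size (q n) = n.+1 by move=> /hq[].
have orth_q n (p : {poly R[i]}) : (n0 <= n)%N -> (size p <= n)%N -> intp mu (p * q n) = 0.
  by move=> /hq[_ h _] sp; rewrite -integral_formE h.
have norm_q n : (n0 <= n)%N -> intp mu (q n * q n) = 1.
  by move=> /hq[_ _ h]; rewrite -integral_formE.
have ID p r : intp mu (p + r) = intp mu p + intp mu r by exact: intpD.
have IZ a p : intp mu (a *: p) = a * intp mu p by exact: intpZ.
have qP : perturbed_chebyshev n0 q alpha beta.
  by split => // n; exact: (alpha_neq0 size_q rec).
have ndS z : ~ supp mu z -> no_decay q z.
  have [B hB] := bnd 0; apply: (@q_no_decay _ mu n0 q alpha beta B) => // n nn.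
  by apply: hB => //; rewrite addr0.
have openS z : ~ supp mu z -> \forall w \near z, ~ supp mu w.
  by move=> hz; have := open_nbhs_nbhs (conj (@supp_open_compl _ mu) hz).
have LnE n : (n0 <= n)%N -> Ln n = (lead_coef (q n))^-1 *: q n.
  move=> nn; apply: (monic_orthogonal_q ID IZ size_q orth_q norm_q nn).
  have [h1 h2 h3] := LnP n; split => //.
    by move=> p sp; rewrite -integral_formE; exact: h2.
  by move=> Q Q0 oQ; apply: h3 => // p sp; rewrite integral_formE; exact: oQ.
have n0_near : \forall n \near \oo, (n0 <= n)%N by exists n0.
have k0 n : (n0 <= n)%N -> (lead_coef (q n))^-1 != 0.
  by move=> nn; rewrite invr_eq0 lead_coef_eq0 -size_poly_eq0 size_q.
have qc : \forall n \near \oo, forall j, (q n.+1).[c j] != 0.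
  apply: filter_forall => j.
  have hj := supp_out (c_out (j := j)).
  exact: (locf_at (locf_shift (ratio_asymptotics sP qP hj (ndS _ (c_out (j := j)))).1)).
have S_rep : \forall n \near \oo, represented q alpha c L n (Sn n.+1).
  have hn : \forall n \near \oo, (n0 < n)%N by exists n0.+1.
  apply: filterS2 hn qc => n nn qn.
  apply: (sobolev_representation cS size_q orth_q norm_q rec nn qn).
    exact: size_sobolev_poly.
  by have [_] := SnP n.+1.
have S_neq0 : \forall n \near \oo, Sn n.+1 != 0.
  by exists 0%N => // n _; have [/monic_neq0] := SnP n.+1.
have [lead0 cvS] := sobolev_asymptotics sP qP supp_out ndS openS c_inj c_out regL
  S_rep S_neq0 pruned_dim_gt0.
have sizes : \forall n \near \oo, size (Ln n) = n.+1 /\ size (Sn n) = n.+1.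
  apply: near_unshift; apply: filterS2 lead0 n0_near => n l0 nn.
  have nn1 : (n0 <= n.+1)%N by exact: leqW.
  rewrite LnE// size_scale ?k0// size_q//; split => //.
  apply/eqP; rewrite eqn_leq size_sobolev_poly ltnNge; apply/negP => sSn.
  by move: l0; rewrite /lead_ratio nth_default// mul0r eqxx.
have denE : \forall n \near \oo, lead_ratio q n (Sn n.+1) *: q n.+1 = Ln n.+1.
  have hs : \forall n \near \oo, size (Sn n.+1) = n.+2.
    by case: sizes => K _ h; exists K => // n Kn; have [] := h n.+1 (leqW Kn).
  apply: filterS2 hs n0_near => n hs nn; rewrite LnE; last exact: leqW.
  have [/monicP mS _ _] := SnP n.+1; rewrite /lead_ratio.
  have -> : (Sn n.+1)`_n.+1 = 1 by rewrite -mS lead_coefE hs.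
  by rewrite mul1r.
split; split.
- move=> nu z hz; have [h1 h2] := derivn_ratio sP qP (supp_out hz) (ndS z hz) nu.
  have hn := locf_snd z n0_near; split.
    by apply: filterS2 h1 hn => k h1 nn; rewrite LnE// derivnZ hornerZ mulf_neq0// k0.
  apply: cvg_trans h2; apply: near_eq_cvg; apply: filterS hn => k nn.
  by rewrite (LnE _ nn) !derivnZ !hornerZ mulrCA -mulf_div (divff (k0 _ nn)) mul1r.
- by move=> z hz; rewrite invr_eq0 (branch_neq0 sP (supp_out hz)).
- move=> z hz; apply: locf_cvg_unshift.
  have [_ h] := cvS z hz; rewrite (limit_ratioE sP c _ (supp_out hz)) in h.
  apply: cvg_trans h; apply: near_eq_cvg.
  by apply: filterS (locf_snd z denE) => k ->.
- move=> z hz; exact: (limit_ratio_continuous sP (fun j => supp_out (c_out (j := j))) (supp_out hz)).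
- exact: limit_ratio_infty.
- exact: sizes.
- by exists 0%N => // n _; have [] := LnP n; have [] := SnP n.
- have [r r0 h] := zero_free_infinity qP; exists r => //.
  apply: filterS2 h n0_near => n h nn z zr.
  by rewrite LnE// hornerZ mulf_neq0 ?k0// h.
- have Sx : supp mu (0 : R[i]).
    have [_ [[E [_ _ _ ->]] _]] := muM; left; exists 0 => //=.
    by rewrite in_itv /=; apply/andP; split; lra.
  have [||z /[!inE] _ zmax] :=
      @compact_EVT_max R[i] R (@normc R) (supp mu) _ cS.
  + by exists 0.
  + by apply: continuous_subspaceT; exact: normc_continuous.
  exists (normc z + 1) => w Sw.
  by have := zmax w; rewrite inE => /(_ Sw); lra.
- exact: openS.
Qed.

End Assembly.

Theorem theorem4 (R : realType) (sqrtz21 : R[i] -> R[i])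
    (mu : complex_measure R) (m : nat) (c : 'I_m -> R[i]) (N : 'I_m -> nat)
    (L : forall j : 'I_m, 'I_(N j).+1 -> {poly R[i]})
    (Ln Sn : nat -> {poly R[i]}) :
  is_sqrt_branch sqrtz21 ->
  classM mu ->
  injective c ->
  (forall j, ~ supp mu (c j)) ->
  (forall j, L j ord_max != 0) ->
  regular_form L ->
  (forall n, monic_orthogonal (integral_form mu) n (Ln n)) ->
  (forall n, monic_orthogonal (sobolev_form mu c L) n (Sn n)) ->
  [/\ \forall n \near \oo, size (Sn n) = n.+1,
      forall j, exists2 U0, nbhs (c j) U0 &
        forall U, nbhs (c j) U -> U `<=` U0 ->
          \forall n \near \oo, nzeros (Sn n) U = pruned_dim L j,
      forall V : set R[i], supp mu `<=` interior V -> compact (closure V) ->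
        (forall j, ~ closure V (c j)) ->
        \forall n \near \oo, (nzeros (Sn n) V + \sum_(j < m) pruned_dim L j)%N = n
    & forall (nu : nat) (K : set (@sphere R)),
        compact K -> K `&` (Some @` supp mu) = set0 ->
        cvg_uniformly_on K
          (fun n z => (Sn n)^`(nu).[z] / (Ln n)^`(nu).[z])
          (fun z => let phi := inv_joukowski sqrtz21 in
             \prod_(j < m)
             ((phi z - phi (c j)) ^+ 2 / (2 * phi z * (z - c j))) ^+ pruned_dim L j)].
Proof.
move=> sP muM c_inj c_out L0 regL LnP SnP.
have LS := sobolev_comparable sP muM c_inj c_out L0 regL LnP SnP.
have segS z : ~ supp mu z -> ~ segment11 z.
  by have [_ [[E [_ _ _ ->]] _]] := muM; move=> h s; apply: h; left.
split.
- by have [_ [h _ _ _ _]] := LS; apply: filterS h => n [].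
- exact: (node_attracts sP c_inj segS c_out LS).
- move=> V SV _ cV; exact: (zeros_concentrate sP c_inj segS c_out LS SV cV).
- move=> nu K cK KS; exact: (uniform_convergence LS nu cK KS).
Qed.
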